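(* Let $A\in\mathbb{R}^{m\times n}$ with $m\ge n$ have singular value decomposition $A=U\Sigma V^T$ with singular values $\sigma_1\ge\cdots\ge\sigma_n$, and let $b$ be a block size, $q\ge0$ an integer and $\ell\ge2$. Let $Q_{[\ell-1]}=[Q_1\ \cdots\ Q_{\ell-1}]$ ($Q_i\in\mathbb{R}^{m\times b}$) be the orthonormal-column matrix produced after $\ell-1$ block steps of the blarank or sblarank algorithm (described in the context), $\mathcal{P}_{\ell-1}^\perp=I-Q_{[\ell-1]}Q_{[\ell-1]}^T$, and $B=\mathcal{P}_{\ell-1}^\perp A$ with singular value decomposition $B=\widetilde U\widetilde\Sigma\widetilde V^T$ and singular values $\widetilde\sigma_1\ge\widetilde\sigma_2\ge\cdots\ge\widetilde\sigma_n$. Let $\Omega_\ell$ be an $n\times b$ standard Gaussian matrix, $Q_\ell={\sf orth}((BB^T)^qB\Omega_\ell)$, $Q_{[\ell]}=[Q_{[\ell-1]}\ Q_\ell]$ and $\mathcal{P}_\ell^\perp=I-Q_{[\ell]}Q_{[\ell]}^T$. Partition $\widetilde V^T\Omega_\ell=\begin{bmatrix}\widetilde\Omega_1\\ \widetilde\Omega_2\end{bmatrix}$ with $\widetilde\Omega_1\in\mathbb{R}^{b\times b}$ assumed nonsingular, and let $\widetilde\Sigma_{(b)\perp}$ be the trailing diagonal block of $\widetilde\Sigma$ containing $\widetilde\sigma_{b+1},\dots,\widetilde\sigma_n$. Let $U_{[\ell-1]}$ be the first $b(\ell-1)$ columns of $U$. If \[\epsilon_{\ell-1}=\mathbf{d}(\mathcal{R}(Q_{[\ell-1]}),\mathcal{R}(U_{[\ell-1]}))<1\quad\text{and}\quad\sigma_{b\ell}-\sigma_{b\ell+1}>2\epsilon_{\ell-1}\|A\|_2,\]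 then: (i) $|\widetilde\sigma_j-\sigma_{b(\ell-1)+j}|\le\epsilon_{\ell-1}\|A\|_2$ for $j=1,\dots,n-b(\ell-1)$, and $\widetilde\sigma_j\le\epsilon_{\ell-1}\|A\|_2$ for $j=n-b(\ell-1)+1,\dots,n$; (ii) $\tilde\tau_b:=\dfrac{\widetilde\sigma_{b+1}}{\widetilde\sigma_b}\le\dfrac{\sigma_{b\ell+1}+\epsilon_{\ell-1}\|A\|_2}{\sigma_{b\ell}-\epsilon_{\ell-1}\|A\|_2}<1$; (iii) for $0<\delta<1$, with probability at least $1-\delta$, for $\xi\in\{2,F\}$, \[\|\mathcal{P}_\ell^\perp A\|_{\xi}\le\big(1+\tilde\tau_b^{4q}\|\widetilde\Omega_2\widetilde\Omega_1^{-1}\|_2^2\big)^{1/2}\|\widetilde\Sigma_{(b)\perp}\|_{\xi}\le\big(1+\tilde\tau_b^{4q}\mathcal{C}_{\delta,b,b}^2\big)^{1/2}\|\widetilde\Sigma_{(b)\perp}\|_{\xi},\] where $\mathcal{C}_{\delta,b,b}=2e\sqrt b\,\frac{2}{\delta}\big(\sqrt{n-b}+\sqrt b+\sqrt{2\log(2/\delta)}\big)$; (iv) for $j=1,\dots,b$, \[\widetilde\sigma_j\ge\sigma_j(Q_\ell^TA)\ge\frac{\widetilde\sigma_j}{\sqrt{1+\|\widetilde\Omega_2\|_2^2\|\widetilde\Omega_1^{-1}\|_2^2\big(\widetilde\sigma_{b+1}/\widetilde\sigma_j\big)^{4q+2}}}.\]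
   Context: $\sigma_j(M)$ is the $j$-th largest singular value; $\|\cdot\|_2,\|\cdot\|_F$ spectral and Frobenius norms. For orthonormal-column $W,Z$, $\mathbf{d}(\mathcal{R}(W),\mathcal{R}(Z))=\|(I-ZZ^T)WW^T\|_2$. ${\sf orth}(Y)$ denotes an orthonormal basis of $\mathcal{R}(Y)$ (thin QR factor). The blarank algorithm with block size $b$ and power parameter $q$: start with $Q=[\ ]$; at step $i$, draw an $n\times b$ standard Gaussian $\Omega_i$, set $Y_0={\sf orth}(A\Omega_i)$; for $j=1,\dots,q$: $Y_{j-1}:=Y_{j-1}-Q(Q^TY_{j-1})$, $Z={\sf orth}(A^TY_{j-1})$, $Y_j={\sf orth}(AZ)$; then $\widehat Q_i={\sf orth}(Y_q-Q(Q^TY_q))$ (in sblarank this orthogonalization against $Q$ is performed twice); compute eigenvectors $\widehat U_i$ of $\widehat Q_i^TAA^T\widehat Q_i$ ordered by decreasing eigenvalue, replace $\widehat Q_i$ by $\widehat Q_i\widehat U_i$; set $Q_i={\sf orth}((I-QQ^T)\widehat Q_i)$ and $Q:=[Q\ Q_i]$. A standard Gaussian matrix has i.i.d. $N(0,1)$ entries. *)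

(* Defs.v *)
From HB Require Import structures.
From mathcomp Require Import all_boot all_order all_algebra.
From mathcomp Require Import all_classical all_reals all_analysis.
From mathcomp Require Import normal_distribution.
Set Implicit Arguments. Unset Strict Implicit. Unset Printing Implicit Defensive.
Import Order.TTheory GRing.Theory Num.Theory.
Local Open Scope classical_set_scope.
Local Open Scope ring_scope.

Section Defs.
Context {R : realType}.

Definition vnorm {p} (x : 'cV[R]_p) : R := Num.sqrt (\sum_i x i 0 ^+ 2).
Definition specnorm {p r} (M : 'M[R]_(p, r)) : R :=
  sup [set vnorm (M *m x) | x in [set x : 'cV[R]_r | vnorm x <= 1]].
Definition fnorm {p r} (M : 'M[R]_(p, r)) : R :=
  Num.sqrt (\sum_i \sum_j M i j ^+ 2).

Definition orthonormal_cols {p r} (W : 'M[R]_(p, r)) : Prop := W^T *m W = 1%:M.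

Definition subspace_dist {p r1 r2} (W : 'M[R]_(p, r1)) (Z : 'M[R]_(p, r2)) : R :=
  specnorm ((1%:M - Z *m Z^T) *m (W *m W^T)).

Definition rect_diag {p r} (s : nat -> R) : 'M[R]_(p, r) :=
  \matrix_(i, j) (if (i : nat) == j then s i.+1 else 0).

Definition is_svd {p r} (U : 'M[R]_p) (s : nat -> R) (V : 'M[R]_r)
    (M : 'M[R]_(p, r)) : Prop :=
  [/\ U^T *m U = 1%:M, V^T *m V = 1%:M & M = U *m rect_diag s *m V^T] /\
  [/\ (forall j, (0 < j)%N -> 0 <= s j),
      (forall i j, (0 < i <= j)%N -> s j <= s i) &
      (forall j, (minn p r < j)%N -> s j = 0)].

Definition rowrange {p r} (off k : nat) (M : 'M[R]_(p, r)) : 'M[R]_(k, r) :=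
  \matrix_(i, j) (if @insub _ (fun x => x < p)%N _ (off + i)%N is Some t
                  then M t j else 0).
Definition colrange {p r} (off k : nat) (M : 'M[R]_(p, r)) : 'M[R]_(p, k) :=
  (rowrange off k M^T)^T.

Definition is_orth {p r} (Y Q : 'M[R]_(p, r)) : Prop :=
  orthonormal_cols Q /\
  exists Rm : 'M[R]_r, [/\ forall i j : 'I_r, (j < i)%N -> Rm i j = 0,
                          forall i : 'I_r, 0 < Rm i i & Y = Q *m Rm].

Definition eig_desc {r} (M U : 'M[R]_r) : Prop :=
  U^T *m U = 1%:M /\
  exists d : nat -> R, (forall i j, (i <= j)%N -> d j <= d i) /\
    U^T *m M *m U = \matrix_(i, j) (if i == j then d i else 0).

Fixpoint power_rel {m n b k} (A : 'M[R]_(m, n)) (Q : 'M[R]_(m, k)) (j : nat)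
    (Y Yq : 'M[R]_(m, b)) : Prop :=
  match j with
  | 0 => Yq = Y
  | j'.+1 => exists (Z : 'M[R]_(n, b)) (Y1 : 'M[R]_(m, b)),
      is_orth (A^T *m (Y - Q *m (Q^T *m Y))) Z /\ is_orth (A *m Z) Y1 /\
      power_rel A Q j' Y1 Yq
  end.

Definition blarank_step (sb : bool) {m n b k} (A : 'M[R]_(m, n)) (q : nat)
    (Q : 'M[R]_(m, k)) (Om : 'M[R]_(n, b)) (Qi : 'M[R]_(m, b)) : Prop :=
  exists (Y0 Yq Qh : 'M[R]_(m, b)) (Uh : 'M[R]_b),
    let Y' := Yq - Q *m (Q^T *m Yq) in
    let Y'' := if sb then Y' - Q *m (Q^T *m Y') else Y' in
    [/\ is_orth (A *m Om) Y0, power_rel A Q q Y0 Yq, is_orth Y'' Qh,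
        eig_desc (Qh^T *m A *m A^T *m Qh) Uh &
        is_orth ((1%:M - Q *m Q^T) *m (Qh *m Uh)) Qi].

Fixpoint Qcat {m b} (Qs : nat -> 'M[R]_(m, b)) (k : nat) : 'M[R]_(m, b * k) :=
  match k with
  | 0 => castmx (erefl, esym (muln0 b)) 0
  | k'.+1 => castmx (erefl, esym (mulnSr b k')) (row_mx (Qcat Qs k') (Qs k'))
  end.

Definition blarank_run (sb : bool) {m n b} (A : 'M[R]_(m, n)) (q : nat)
    (Oms : nat -> 'M[R]_(n, b)) (Qs : nat -> 'M[R]_(m, b)) (k : nat) : Prop :=
  forall i, (i < k)%N -> blarank_step sb A q (Qcat Qs i) (Oms i) (Qs i).

Definition indep_family {d} {T : measurableType d} (P : probability T R)
    {I : finType} (X : I -> T -> R) : Prop :=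
  forall B : I -> set R, (forall i, measurable (B i)) ->
    P (\bigcap_(i in [set: I]) (X i @^-1` B i)) = (\prod_(i : I) P (X i @^-1` B i))%E.

Definition std_normal_rv {d} {T : measurableType d} (P : probability T R)
    (X : T -> R) : Prop :=
  measurable_fun [set: T] X /\
  forall B : set R, measurable B -> P (X @^-1` B) = normal_prob 0 1 B.

Definition with_prob_ge {d} {T : measurableType d} (P : probability T R)
    (E : set T) (p : R) : Prop :=
  exists F : set T, [/\ measurable F, F `<=` E & (p%:E <= P F)%E].

End Defs.

Inductive normkind := Spec2 | Frob.
Definition mnorm {R : realType} (xi : normkind) {p r} (M : 'M[R]_(p, r)) : R :=
  match xi with Spec2 => specnorm M | Frob => fnorm M end.

(* Main.v *)
Require Import Defs.
From HB Require Import structures.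
From mathcomp Require Import all_boot all_order all_algebra.
From mathcomp Require Import all_classical all_reals all_analysis.
From mathcomp Require Import measurable_realfun normal_distribution.
From mathcomp Require Import ring lra zify.
Set Implicit Arguments. Unset Strict Implicit. Unset Printing Implicit Defensive.
Import Order.TTheory GRing.Theory Num.Theory.
Local Open Scope classical_set_scope.
Local Open Scope ring_scope.

(** The deterministic bounds come from the Courant-Fischer characterization of
    singular values.  Deflating by [k] directions costs at most [k] indices, whence
    [sA (k + j) <= sB j]; conversely [B] differs from the deflation by the leading
    left singular vectors of [A] by at most [eps * |A|], because the gap between
    two subspaces of equal dimension is symmetric.  The residual bound compares
    [(I - Ql Ql^T) B x] with [B x - Y t], where [Y] is the sketch and [t] cancels
    the [b] leading coordinates of [B x].

    No concentration of the norm of a Gaussian matrix is needed for the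
    probabilistic bound on [N = Om2 Om1^-1].  For a fixed vector [e], rotation
    invariance reduces [Om1 z = e] to [e] proportional to the first basis vector,
    where [z] is proportional to the cofactor vector [c] of the first row [r] of
    [Om1]; then [|N e| / |e| = |Om2 c| / |<r, c>|], a ratio in which the
    denominator is [|c|] times a standard normal variable independent of the
    numerator, whose second moment is at most [(n - b) |c|^2].  Averaging over all
    sign vectors [e] transfers this weak-type bound to the spectral norm, since a
    fixed proportion of them satisfies [|N e| >= |N| / 2].  Rotation invariance of
    families of independent normal variables is obtained by Givens rotations, each
    of which is a product of three shears of the plane. *)

(** * Norms and row ranges *)

(** The inverse of a normal variable has no first moment, so the mean of [|N|] is in general
    infinite and only weak-type bounds survive, one direction at a time. Counting sign vectors
    replaces the supremum over directions: [|N| > C] forces at least a fraction [49 / 225] of the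
    sign events, each of probability at most [2 sqrt b sqrt (n - b) / C], where [sqrt b] is the
    length of a sign vector and [2] pays for the threshold [C / 2]. Markov's inequality gives the
    failure probability [(450 / 49) sqrt b sqrt (n - b) / C], and for [C = Cd] this is at most
    [delta] because [450 / 49 <= 4 e]. [Q], [B] and [Vt] are fixed matrices, so [Vt^T Omega] is
    again a Gaussian family. Conditioning on all rows but one is expressed on [P \x P]: that row is
    read at a second, independent sample point. Events are written with determinants and cofactors
    instead of inverses, which keeps them measurable and defined for singular blocks. *)

Section EuclideanNorm.
Context {R : realType}.

Lemma vnorm_sqr p (x : 'cV[R]_p) : vnorm x ^+ 2 = \sum_i x i 0 ^+ 2.
Proof. by rewrite sqr_sqrtr// sumr_ge0// => i _; exact: sqr_ge0. Qed.

Lemma vnorm_ge0 p (x : 'cV[R]_p) : 0 <= vnorm x.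
Proof. exact: sqrtr_ge0. Qed.
Hint Resolve vnorm_ge0 : core.

Lemma vnorm_mul_tr p (x : 'cV[R]_p) : vnorm x ^+ 2 = (x^T *m x) 0 0.
Proof. by rewrite vnorm_sqr mxE; apply: eq_bigr => i _; rewrite mxE expr2. Qed.

Lemma vnorm0 p : vnorm (0 : 'cV[R]_p) = 0.
Proof. by rewrite /vnorm big1 ?sqrtr0// => i _; rewrite mxE expr0n. Qed.

Lemma vnorm_eq0 p (x : 'cV[R]_p) : (vnorm x == 0) = (x == 0).
Proof.
apply/idP/eqP => [/eqP x0|->]; last by rewrite vnorm0.
apply/matrixP => i j; rewrite ord1 mxE; apply/eqP; rewrite -sqrf_eq0.
have : \sum_i x i 0 ^+ 2 == 0 by rewrite -vnorm_sqr x0 expr0n.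
rewrite psumr_eq0 => [/allP/(_ i)|k _]; last exact: sqr_ge0.
by apply; rewrite mem_index_enum.
Qed.

Lemma vnorm_gt0 p (x : 'cV[R]_p) : (0 < vnorm x) = (x != 0).
Proof. by rewrite lt_neqAle vnorm_ge0 andbT eq_sym vnorm_eq0. Qed.

Lemma vnormZ p (a : R) (x : 'cV[R]_p) : vnorm (a *: x) = `|a| * vnorm x.
Proof.
rewrite -(sqrtr_sqr a) /vnorm -sqrtrM ?sqr_ge0// mulr_sumr.
by congr Num.sqrt; apply: eq_bigr => i _; rewrite mxE exprMn.
Qed.

(** The square of [|y| x - |x| y] is nonnegative; once both norms are nonzero, their product can be
    divided out. *)
Lemma sum_mul_le_vnorm p (x y : 'cV[R]_p) :
  \sum_i x i 0 * y i 0 <= vnorm x * vnorm y.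
Proof.
have [/eqP|x0] := eqVneq (vnorm x) 0.
  by rewrite vnorm_eq0 => /eqP->; rewrite vnorm0 mul0r big1// => i _; rewrite mxE mul0r.
have [/eqP|y0] := eqVneq (vnorm y) 0.
  by rewrite vnorm_eq0 => /eqP->; rewrite vnorm0 mulr0 big1// => i _; rewrite mxE mulr0.
have : 0 <= \sum_i (vnorm y * x i 0 - vnorm x * y i 0) ^+ 2.
  by rewrite sumr_ge0// => i _; exact: sqr_ge0.
rewrite (eq_bigr (fun i => vnorm y ^+ 2 * x i 0 ^+ 2 + vnorm x ^+ 2 * y i 0 ^+ 2
  - 2 * vnorm x * vnorm y * (x i 0 * y i 0))); last by move=> i _; ring.
rewrite sumrB big_split/= -!mulr_sumr -!vnorm_sqr.
have : 0 < vnorm x * vnorm y.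
  by rewrite mulr_gt0// lt_neqAle vnorm_ge0 eq_sym ?x0 ?y0.
set a := vnorm x; set b := vnorm y; set s := \sum_i _ => ab h.
rewrite -(ler_pM2l ab); nra.
Qed.

Lemma mulmx_tr_le_vnorm p (x y : 'cV[R]_p) : (x^T *m y) 0 0 <= vnorm x * vnorm y.
Proof.
apply: le_trans (sum_mul_le_vnorm x y).
by rewrite mxE ler_sum// => i _; rewrite mxE.
Qed.

Lemma vnormD p (x y : 'cV[R]_p) : vnorm (x + y) <= vnorm x + vnorm y.
Proof.
rewrite -(ler_pXn2r (n := 2))// ?nnegrE ?addr_ge0//.
rewrite sqrrD !vnorm_sqr.
rewrite (eq_bigr (fun i => x i 0 ^+ 2 + y i 0 ^+ 2 + 2 * (x i 0 * y i 0))).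
  rewrite !big_split/= -mulr_sumr mulr2n.
  by have := sum_mul_le_vnorm x y; lra.
by move=> i _; rewrite mxE; ring.
Qed.

Lemma ge0_ler_sqr (x y : R) : 0 <= y -> x ^+ 2 <= y ^+ 2 -> x <= y.
Proof. by move=> y0 h; nra. Qed.

Lemma orthonormal_cols_vnorm p r (W : 'M[R]_(p, r)) (x : 'cV[R]_r) :
  orthonormal_cols W -> vnorm (W *m x) = vnorm x.
Proof.
move=> oW; apply/eqP; rewrite -(eqrXn2 (n := 2))//.
by rewrite !vnorm_mul_tr trmx_mul mulmxA -(mulmxA x^T) oW mulmx1.
Qed.

(** [1 - W W^T] is symmetric and idempotent, so [|E x|^2 = <x, E x>]. *)
Lemma orthonormal_cols_pythagoras p r (W : 'M[R]_(p, r)) (x : 'cV[R]_p) :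
  orthonormal_cols W ->
  vnorm ((1%:M - W *m W^T) *m x) ^+ 2 = vnorm x ^+ 2 - vnorm (W^T *m x) ^+ 2.
Proof.
move=> oW; set E := 1%:M - _.
have ET : E^T = E by rewrite linearB/= trmx1 trmx_mul trmxK.
have EE : E *m E = E.
  rewrite {2}/E mulmxBr mulmx1 mulmxA mulmxBl mul1mx -(mulmxA W) oW mulmx1.
  by rewrite subrr mul0mx subr0.
rewrite !vnorm_mul_tr.
have -> : (E *m x)^T *m (E *m x) = x^T *m (E *m x).
  by rewrite trmx_mul ET -mulmxA (mulmxA E) EE.
rewrite trmx_mul trmxK /E mulmxBl mul1mx mulmxBr !mulmxA.
by rewrite [LHS]mxE [X in _ + X]mxE.
Qed.

Lemma projector_contraction p r (W : 'M[R]_(p, r)) (x : 'cV[R]_p) :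
  orthonormal_cols W -> vnorm ((1%:M - W *m W^T) *m x) <= vnorm x.
Proof.
move=> oW; apply: ge0_ler_sqr => //.
by rewrite orthonormal_cols_pythagoras// gerBl sqr_ge0.
Qed.

Lemma orthonormal_cols_tr_contraction p r (W : 'M[R]_(p, r)) (x : 'cV[R]_p) :
  orthonormal_cols W -> vnorm (W^T *m x) <= vnorm x.
Proof.
move=> oW; apply: ge0_ler_sqr => //.
by rewrite -subr_ge0 -orthonormal_cols_pythagoras// sqr_ge0.
Qed.

Lemma fnorm_sqr p r (M : 'M[R]_(p, r)) :
  fnorm M ^+ 2 = \sum_i \sum_j M i j ^+ 2.
Proof.
by rewrite sqr_sqrtr//; do 2 (apply: sumr_ge0 => ? _); exact: sqr_ge0.
Qed.

Lemma fnorm_ge0 p r (M : 'M[R]_(p, r)) : 0 <= fnorm M.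
Proof. exact: sqrtr_ge0. Qed.

(** Supplies the upper bound that makes the supremum in [specnorm] a genuine one; the estimate is
    Cauchy-Schwarz on each row. *)
Lemma vnorm_mulmx_le_fnorm p r (M : 'M[R]_(p, r)) x :
  vnorm (M *m x) <= fnorm M * vnorm x.
Proof.
apply: ge0_ler_sqr; first by rewrite mulr_ge0 ?fnorm_ge0.
rewrite exprMn fnorm_sqr vnorm_sqr mulr_suml; apply: ler_sum => i _.
set y : 'cV[R]_r := (row i M)^T.
have -> : (M *m x) i 0 = (y^T *m x) 0 0.
  by rewrite !mxE; apply: eq_bigr => j _; rewrite !mxE.
have -> : \sum_j M i j ^+ 2 = vnorm y ^+ 2.
  by rewrite vnorm_sqr; apply: eq_bigr => j _; rewrite !mxE.
rewrite -exprMn.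
have h1 := mulmx_tr_le_vnorm y x.
have := mulmx_tr_le_vnorm (- y) x; rewrite -scaleN1r vnormZ normrN1 mul1r.
rewrite linearZ/= -scalemxAl mxE mulN1r => h2; nra.
Qed.

Lemma specnorm_has_sup p r (M : 'M[R]_(p, r)) :
  has_sup [set vnorm (M *m x) | x in [set x : 'cV[R]_r | vnorm x <= 1]].
Proof.
split; first by exists (vnorm (M *m 0)), 0 => //=; rewrite vnorm0.
exists (fnorm M) => _ [x /= x1 <-]; apply: le_trans (vnorm_mulmx_le_fnorm _ _) _.
by rewrite ler_piMr ?fnorm_ge0.
Qed.

Lemma vnorm_mulmx_le_specnorm p r (M : 'M[R]_(p, r)) x :
  vnorm (M *m x) <= specnorm M * vnorm x.
Proof.
have [->|x0] := eqVneq x 0; first by rewrite mulmx0 !vnorm0 mulr0.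
have nx0 : 0 < vnorm x by rewrite vnorm_gt0.
rewrite -ler_pdivrMr//.
have -> : vnorm (M *m x) / vnorm x = vnorm (M *m ((vnorm x)^-1 *: x)).
  by rewrite -scalemxAr vnormZ ger0_norm ?invr_ge0// mulrC.
apply: sup_upper_bound; first exact: specnorm_has_sup.
exists ((vnorm x)^-1 *: x) => //=.
by rewrite vnormZ ger0_norm ?invr_ge0// mulVf// gt_eqF.
Qed.

Lemma specnorm_ge0 p r (M : 'M[R]_(p, r)) : 0 <= specnorm M.
Proof.
apply: sup_upper_bound; first exact: specnorm_has_sup.
by exists 0; rewrite /= ?mulmx0 vnorm0.
Qed.

Lemma specnorm_le p r (M : 'M[R]_(p, r)) c : 0 <= c ->
  (forall x, vnorm (M *m x) <= c * vnorm x) -> specnorm M <= c.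
Proof.
move=> c0 hM; apply: ge_sup; first by case: (specnorm_has_sup M).
by move=> _ [x /= x1 <-]; apply: le_trans (hM x) _; rewrite ler_piMr.
Qed.

Lemma specnormM p r t (M : 'M[R]_(p, r)) (N : 'M[R]_(r, t)) :
  specnorm (M *m N) <= specnorm M * specnorm N.
Proof.
apply: specnorm_le => [|x]; first by rewrite mulr_ge0 ?specnorm_ge0.
rewrite -mulmxA (le_trans (vnorm_mulmx_le_specnorm _ _))// -mulrA.
by rewrite ler_wpM2l ?specnorm_ge0// vnorm_mulmx_le_specnorm.
Qed.

(** A near-maximizer is enough: take [x] in the unit ball with [t < |M x|] and [y = M x / |M x|];
    then [|M^T y| >= <M^T y, x> = |M x|]. *)
Lemma specnorm_gt_tr p r (M : 'M[R]_(p, r)) t : 0 <= t -> t < specnorm M ->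
  exists2 y : 'cV[R]_p, vnorm y = 1 & t < vnorm (M^T *m y).
Proof.
move=> t0 tM; have [_ [x /= x1 <-] txM] : exists2 z,
    [set vnorm (M *m x) | x in [set x : 'cV[R]_r | vnorm x <= 1]] z & t < z.
  by apply: sup_gt => //; case: (specnorm_has_sup M).
have Mx0 : 0 < vnorm (M *m x) by exact: le_lt_trans txM.
exists ((vnorm (M *m x))^-1 *: (M *m x)).
  by rewrite vnormZ ger0_norm ?invr_ge0// mulVf// gt_eqF.
rewrite -scalemxAr vnormZ ger0_norm ?invr_ge0// mulrC ltr_pdivlMr//.
apply: (@lt_le_trans _ _ (vnorm (M *m x) ^+ 2)); first by rewrite expr2 ltr_pM2r.
rewrite vnorm_mul_tr trmx_mul -mulmxA.
apply: le_trans (mulmx_tr_le_vnorm _ _) _.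
by rewrite ler_piMl.
Qed.

(** Tested on the row itself: coordinate [i] of [M y] is then [|y|^2]. *)
Lemma row_sqr_le_specnorm p r (M : 'M[R]_(p, r)) i :
  \sum_j M i j ^+ 2 <= specnorm M ^+ 2.
Proof.
set y : 'cV[R]_r := (row i M)^T.
have yE : \sum_j M i j ^+ 2 = vnorm y ^+ 2.
  by rewrite vnorm_sqr; apply: eq_bigr => j _; rewrite !mxE.
rewrite yE; have [->|y0] := eqVneq y 0; first by rewrite vnorm0 expr0n sqr_ge0.
have ny : 0 < vnorm y by rewrite vnorm_gt0.
rewrite ler_pXn2r ?nnegrE ?specnorm_ge0//.
rewrite -(ler_pM2r ny); apply: le_trans (vnorm_mulmx_le_specnorm M y).
apply: ge0_ler_sqr => //; rewrite -expr2 [leRHS]vnorm_sqr (bigD1 i)//=.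
have -> : (M *m y) i 0 = vnorm y ^+ 2.
  by rewrite -yE mxE; apply: eq_bigr => j _; rewrite !mxE expr2.
by rewrite lerDl sumr_ge0// => j _; rewrite sqr_ge0.
Qed.

End EuclideanNorm.
#[global] Hint Extern 0 (is_true (0 <= vnorm _)) => exact: vnorm_ge0 : core.

Section Rowrange.
Context {R : realType}.

Lemma rowrangeE p r off k (M : 'M[R]_(p, r)) (i : 'I_k) (t : 'I_p) j :
  (t : nat) = (off + i)%N -> rowrange off k M i j = M t j.
Proof.
move=> tE; rewrite mxE; case: insubP => [u _ uE|]; last by rewrite -tE ltn_ord.
by congr (M _ j); apply: val_inj => /=; rewrite uE tE.
Qed.

Lemma rowrange_out p r off k (M : 'M[R]_(p, r)) (i : 'I_k) j :
  (p <= off + i)%N -> rowrange off k M i j = 0.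
Proof. by move=> h; rewrite mxE insubF// ltnNge h. Qed.

Lemma rowrangeM p r t off k (M : 'M[R]_(p, r)) (N : 'M[R]_(r, t)) :
  rowrange off k (M *m N) = rowrange off k M *m N.
Proof.
apply/matrixP => i j; have [h|h] := ltnP (off + i) p.
  rewrite (@rowrangeE _ _ _ _ _ _ (Ordinal h))// !mxE; apply: eq_bigr => u _.
  by rewrite (@rowrangeE _ _ _ _ _ _ (Ordinal h)).
rewrite rowrange_out// mxE big1// => u _.
by rewrite rowrange_out// mul0r.
Qed.

Lemma rowrange_eq0 p r off k (M : 'M[R]_(p, r)) (t : 'I_p) j :
  rowrange off k M = 0 -> (off <= t < off + k)%N -> M t j = 0.
Proof.
move=> M0 /andP[h1 h2]; have h : (t - off < k)%N by lia.
have := @rowrangeE p r off k M (Ordinal h) t j; rewrite M0 mxE => -> //=; lia.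
Qed.

Lemma sum_rowrange_split p b (f : nat -> R) : (b <= p)%N ->
  \sum_(i < p) f i = \sum_(i < b) f i + \sum_(i < p - b) f (b + i)%N.
Proof.
move=> bp; rewrite -(big_mkord xpredT f) (@big_cat_nat _ _ _ b)//= big_mkord.
congr (_ + _); rewrite -{1}[b]add0n big_addn big_mkord.
by apply: eq_bigr => i _; rewrite addnC.
Qed.

Lemma nonzero_kernel p r (C : 'M[R]_(p, r)) : (p < r)%N ->
  exists2 x : 'cV[R]_r, x != 0 & C *m x = 0.
Proof.
move=> pr; have : kermx C^T != 0.
  rewrite -mxrank_eq0 mxrank_ker subn_eq0 -ltnNge mxrank_tr.
  exact: leq_ltn_trans (rank_leq_row C) pr.
case/rowV0Pn => v /sub_kermxP vC v0; exists v^T.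
  by apply: contra_neq v0 => /(congr1 trmx); rewrite trmxK trmx0.
by rewrite -[C]trmxK -trmx_mul vC trmx0.
Qed.

End Rowrange.

(** * Singular values *)

Section SVD.
Context {R : realType}.

(** Coordinates indexed by [nat] with default [0], so that sums over ordinals of different bounds
    compare without casts. *)
Definition vext r (y : 'cV[R]_r) (n : nat) : R :=
  if @insub _ (fun x => x < r)%N _ n is Some t then y t 0 else 0.

Lemma vext_ord r (y : 'cV[R]_r) (t : 'I_r) : vext y t = y t 0.
Proof. by rewrite /vext valK. Qed.

Lemma vext_out r (y : 'cV[R]_r) n : (r <= n)%N -> vext y n = 0.
Proof. by move=> h; rewrite /vext insubF// ltnNge h. Qed.

Lemma vext_rowrange off k r (y : 'cV[R]_r) (i : 'I_k) :
  rowrange off k y i 0 = vext y (off + i)%N.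
Proof. by rewrite mxE. Qed.

Lemma vnorm_vext r (y : 'cV[R]_r) : vnorm y ^+ 2 = \sum_(i < r) vext y i ^+ 2.
Proof. by rewrite vnorm_sqr; apply: eq_bigr => i _; rewrite vext_ord. Qed.

Lemma vnorm_rowrange off k r (y : 'cV[R]_r) :
  vnorm (rowrange off k y) ^+ 2 = \sum_(i < k) vext y (off + i) ^+ 2.
Proof. by rewrite vnorm_sqr; apply: eq_bigr => i _; rewrite vext_rowrange. Qed.

Lemma vnorm_rowrange_split b r (y : 'cV[R]_r) : (b <= r)%N ->
  vnorm y ^+ 2 =
  vnorm (rowrange 0 b y) ^+ 2 + vnorm (rowrange b (r - b) y) ^+ 2.
Proof.
move=> br; rewrite !vnorm_rowrange vnorm_vext.
exact: (sum_rowrange_split (fun i => vext y i ^+ 2)).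
Qed.

Lemma vext_rect_diag p r (s : nat -> R) (y : 'cV[R]_r) i : (i < p)%N ->
  vext (rect_diag s *m y : 'cV[R]_p) i = s i.+1 * vext y i.
Proof.
move=> ip; rewrite (vext_ord _ (Ordinal ip)) mxE.
have [ir|ri] := ltnP i r.
  rewrite (bigD1 (Ordinal ir))//= mxE eqxx (vext_ord y (Ordinal ir)) big1 ?addr0//.
  move=> j; rewrite -val_eqE/= => ji.
  by rewrite mxE/= eq_sym (negbTE ji) mul0r.
rewrite vext_out// mulr0 big1// => j _; rewrite mxE/= ifF ?mul0r//.
by apply/eqP => ij; move: (ltn_ord j); rewrite -ij ltnNge ri.
Qed.

(** The sum runs over the [r] input coordinates: [s] vanishes beyond the [p] rows, and [vext y]
    vanishes beyond [r]. *)
Lemma vnorm_rect_diag p r (s : nat -> R) (y : 'cV[R]_r) :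
  (forall j, (p < j)%N -> s j = 0) ->
  vnorm (rect_diag s *m y : 'cV[R]_p) ^+ 2 = \sum_(i < r) (s i.+1 * vext y i) ^+ 2.
Proof.
move=> s0; rewrite vnorm_vext.
rewrite (eq_bigr (fun i : 'I_p => (s i.+1 * vext y i) ^+ 2)); last first.
  by move=> i _; rewrite vext_rect_diag.
pose f i := (s i.+1 * vext y i) ^+ 2.
have [pr|/ltnW rp] := leqP p r.
  rewrite [RHS](sum_rowrange_split f pr) [X in _ + X]big1 ?addr0// => i _.
  by rewrite /f s0 ?mul0r ?expr0n//; lia.
rewrite [LHS](sum_rowrange_split f rp) [X in _ + X]big1 ?addr0// => i _.
by rewrite /f vext_out ?mulr0 ?expr0n//; lia.
Qed.

(** The inner dimension [t] truncates the product, whence the condition on [s]. *)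
Lemma rect_diagM p t r (s s' : nat -> R) : (forall j, (t < j)%N -> s j = 0) ->
  (rect_diag s : 'M[R]_(p, t)) *m rect_diag s' =
  rect_diag (fun j => s j * s' j) :> 'M[R]_(p, r).
Proof.
move=> s0; apply/matrixP => i j; rewrite !mxE.
have [it|ti] := ltnP i t.
  rewrite (bigD1 (Ordinal it))//= !mxE eqxx big1 ?addr0.
    by rewrite /=; case: eqP => // _; rewrite mulr0.
  by move=> k; rewrite -val_eqE/= => ki; rewrite mxE eq_sym (negbTE ki) mul0r.
rewrite s0 ?ltnS// mul0r if_same big1// => k _.
by rewrite mxE s0 ?ltnS// if_same mul0r.
Qed.

Lemma rect_diag_tr p r (s : nat -> R) :
  (rect_diag s : 'M[R]_(p, r))^T = rect_diag s.
Proof.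
by apply/matrixP => i j; rewrite !mxE eq_sym; case: eqP => // ->.
Qed.

Lemma orthogonal_mul_tr r (V : 'M[R]_r) : V^T *m V = 1%:M -> V *m V^T = 1%:M.
Proof. exact: mulmx1C. Qed.

Lemma orthogonal_tr_vnorm r (V : 'M[R]_r) x : V^T *m V = 1%:M ->
  vnorm (V^T *m x) = vnorm x.
Proof.
move=> /orthogonal_mul_tr h; apply: orthonormal_cols_vnorm.
by rewrite /orthonormal_cols trmxK.
Qed.

Lemma is_svd_tr p r (U : 'M[R]_p) s (V : 'M[R]_r) M :
  is_svd U s V M -> is_svd V s U M^T.
Proof.
move=> [[oU oV ->] [s0 sdec sout]]; split; split => //; last by rewrite minnC.
by rewrite !trmx_mul trmxK rect_diag_tr mulmxA.
Qed.

Section OneSVD.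
Context p r (U : 'M[R]_p) (s : nat -> R) (V : 'M[R]_r) (M : 'M[R]_(p, r)).
Hypothesis svdM : is_svd U s V M.

Lemma svd_ge0 j : 0 <= s j.+1.
Proof. by case: svdM => _ [s0 _ _]; exact: s0. Qed.

Lemma svd_dec i j : (i <= j)%N -> s j.+1 <= s i.+1.
Proof. by move=> ij; case: svdM => _ [_ sd _]; apply: sd; rewrite ltnS. Qed.

Lemma svd_row_out j : (p < j)%N -> s j = 0.
Proof. by move=> h; case: svdM => _ [_ _ so]; apply: so; rewrite gtn_min h. Qed.

Lemma svd_col_out j : (r < j)%N -> s j = 0.
Proof.
by move=> h; case: svdM => _ [_ _ so]; apply: so; rewrite gtn_min h orbT.
Qed.

Lemma svd_tr_mul x : U^T *m (M *m x) = rect_diag s *m (V^T *m x) :> 'cV[R]_p.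
Proof.
by case: svdM => [[oU oV ->] _]; rewrite !mulmxA oU mul1mx.
Qed.

Lemma svd_vnorm x :
  vnorm (M *m x) ^+ 2 = \sum_(i < r) (s i.+1 * vext (V^T *m x) i) ^+ 2.
Proof.
rewrite -(@vnorm_rect_diag p); last exact: svd_row_out.
by rewrite -svd_tr_mul orthogonal_tr_vnorm//; case: svdM => -[].
Qed.

Let Vx x : vnorm x ^+ 2 = \sum_(i < r) vext (V^T *m x) i ^+ 2.
Proof. by rewrite -vnorm_vext orthogonal_tr_vnorm//; case: svdM => -[]. Qed.

(** One half of Courant-Fischer, on the span of the leading [j + 1] right singular vectors;
    [svd_upper] is the half on the complement of the leading [j]. Singular values count from [1] and
    coordinates from [0], so coordinate [j] goes with [s j.+1]. *)
Lemma svd_lower j x : (forall i, (j < i)%N -> vext (V^T *m x) i = 0) ->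
  s j.+1 * vnorm x <= vnorm (M *m x).
Proof.
move=> h; apply: ge0_ler_sqr => //; rewrite exprMn svd_vnorm Vx mulr_sumr.
apply: ler_sum => i _; have [ij|ji] := leqP i j; last by rewrite h// mulr0 expr0n mulr0.
rewrite exprMn ler_wpM2r ?sqr_ge0// ler_pXn2r// ?nnegrE ?svd_ge0//.
exact: svd_dec.
Qed.

Lemma svd_upper j x : (forall i, (i < j)%N -> vext (V^T *m x) i = 0) ->
  vnorm (M *m x) <= s j.+1 * vnorm x.
Proof.
move=> h; apply: ge0_ler_sqr; first by rewrite mulr_ge0 ?svd_ge0.
rewrite exprMn svd_vnorm Vx mulr_sumr.
apply: ler_sum => i _; have [ji|ij] := leqP j i; last by rewrite h// mulr0 expr0n mulr0.
rewrite exprMn ler_wpM2r ?sqr_ge0// ler_pXn2r// ?nnegrE ?svd_ge0//.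
exact: svd_dec.
Qed.

Lemma rowrange_mul_eq0 off k (x : 'cV[R]_r) i :
  rowrange off k V^T *m x = 0 -> (off <= i < off + k)%N -> vext (V^T *m x) i = 0.
Proof.
rewrite -rowrangeM => h hi; have [ir|ri] := ltnP i r; last by rewrite vext_out.
by rewrite (vext_ord _ (Ordinal ir)); apply: rowrange_eq0 h _.
Qed.

(** At most [j] equations [C x = 0], together with the [r - j - 1] that confine [x] to the leading
    [j + 1] right singular vectors, leave a nonzero solution; [svd_lower] applies to it. *)
Lemma svd_le_of_kernel t (C : 'M[R]_(t, r)) j c : (t <= j)%N -> 0 <= c ->
  (forall x, C *m x = 0 -> vnorm (M *m x) <= c * vnorm x) -> s j.+1 <= c.
Proof.
move=> tj c0 hC; have [rj|jr] := leqP r j; first by rewrite svd_col_out.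
have [x x0] : exists2 x : 'cV[R]_r, x != 0 &
    col_mx C (rowrange j.+1 (r - j.+1) V^T) *m x = 0.
  by apply: nonzero_kernel; lia.
rewrite mul_col_mx => /eqP; rewrite col_mx_eq0 => /andP[/eqP Cx /eqP Vx0].
rewrite -(ler_pM2r (x := vnorm x)) ?vnorm_gt0//.
apply: le_trans (hC _ Cx); apply: svd_lower => i ji.
have [ir|ri] := ltnP i r; last by rewrite vext_out.
by apply: rowrange_mul_eq0 Vx0 _; lia.
Qed.

(** The dual count: a space of dimension [t > j], parametrized by the injective [N], contains a
    nonzero vector orthogonal to the leading [j] right singular vectors, where [svd_upper]
    applies. *)
Lemma svd_ge_of_image t (N : 'M[R]_(r, t)) j c : (j < t)%N ->
  (forall y : 'cV[R]_t, y != 0 -> N *m y != 0) ->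
  (forall y : 'cV[R]_t, c * vnorm (N *m y) <= vnorm (M *m (N *m y))) -> c <= s j.+1.
Proof.
move=> jt injN hN.
have [y y0] := nonzero_kernel (rowrange 0 j V^T *m N) jt.
rewrite -mulmxA => Vy.
rewrite -(ler_pM2r (x := vnorm (N *m y))) ?vnorm_gt0 ?injN//.
apply: le_trans (hN _) _; apply: svd_upper => i ij.
exact: rowrange_mul_eq0 Vy _.
Qed.

Lemma svd_power q :
  (M *m M^T) ^+ q *m M = U *m rect_diag (fun j => s j ^+ (2 * q).+1) *m V^T.
Proof.
have [[oU oV ME] _] := svdM.
elim: q => [|q IH]; first by rewrite expr0 mul1mx muln0 {1}ME.
rewrite exprS -!mulmxA IH ME !trmx_mul !trmxK rect_diag_tr !mulmxA.
do 2 (rewrite -(mulmxA _ _^T) ?oU ?oV mulmx1).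
rewrite -(mulmxA U) rect_diagM; last exact: svd_col_out.
rewrite -(mulmxA U) rect_diagM; last first.
  by move=> j pj; rewrite svd_row_out// mul0r.
congr (_ *m _ *m _); apply/matrixP => i j; rewrite !mxE.
by case: eqP => // _; rewrite -mulrA -!exprS; congr (_ ^+ _); lia.
Qed.

End OneSVD.

End SVD.

(** * Orthonormal bases and the gap between subspaces *)

Section Orth.
Context {R : realType}.

Lemma is_orthP p r (Y Q : 'M[R]_(p, r)) : is_orth Y Q ->
  exists2 Rm : 'M[R]_r, Rm \in unitmx & Y = Q *m Rm.
Proof.
move=> [_ [Rm [up diag YE]]]; exists Rm => //.
rewrite unitmxE unitfE -det_tr det_trig; last first.
  by apply/is_trig_mxP => i j ij; rewrite mxE up.
by apply/prodf_neq0 => i _; rewrite mxE gt_eqF.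
Qed.

Lemma is_orth_mul_eq0 p r t (Y Q : 'M[R]_(p, r)) (C : 'M[R]_(t, p)) :
  is_orth Y Q -> C *m Y = 0 -> C *m Q = 0.
Proof.
move=> /is_orthP[Rm uR ->]; rewrite mulmxA => /(congr1 (mulmx^~ (invmx Rm))).
by rewrite mul0mx mulmxK.
Qed.

Lemma orthonormal_cols_cast p r r' (e : r = r') (W : 'M[R]_(p, r)) :
  orthonormal_cols W -> orthonormal_cols (castmx (erefl, e) W).
Proof. by case: r' / e; rewrite castmx_id. Qed.

Lemma orthonormal_cols_row_mx p r t (W : 'M[R]_(p, r)) (Z : 'M[R]_(p, t)) :
  orthonormal_cols W -> orthonormal_cols Z -> W^T *m Z = 0 ->
  orthonormal_cols (row_mx W Z).
Proof.
rewrite /orthonormal_cols => oW oZ WZ.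
rewrite tr_row_mx mul_col_row oW oZ WZ.
have -> : Z^T *m W = 0 by rewrite -[W]trmxK -trmx_mul WZ trmx0.
by rewrite -scalar_mx_block.
Qed.

Lemma orthonormal_cols_tr_proj p r (W : 'M[R]_(p, r)) : orthonormal_cols W ->
  W^T *m (1%:M - W *m W^T) = 0.
Proof. by move=> oW; rewrite mulmxBr mulmx1 mulmxA oW mul1mx subrr. Qed.

(** Each block is the thin QR factor of [(1 - Q Q^T) (Qh Uh)], hence orthogonal to the blocks before
    it; this last operation is common to blarank and sblarank. *)
Lemma blarank_orthonormal sb m n b (A : 'M[R]_(m, n)) q Oms
    (Qs : nat -> 'M[R]_(m, b)) k :
  blarank_run sb A q Oms Qs k -> orthonormal_cols (Qcat Qs k).
Proof.
elim: k => [|k IH] run.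
  by apply/matrixP => -[i hi]; exfalso; move: hi; rewrite muln0.
have oQ : orthonormal_cols (Qcat Qs k) by apply: IH => i ik; apply: run; exact: ltnW.
have [Y0 [Yq [Qh [Uh [_ _ _ _ orth]]]]] := run k (ltnSn k).
apply: orthonormal_cols_cast; apply: orthonormal_cols_row_mx => //; first by case: orth.
apply: is_orth_mul_eq0 orth _.
by rewrite mulmxA orthonormal_cols_tr_proj// mul0mx.
Qed.

Lemma inj_unitmx r (M : 'M[R]_r) : (forall x : 'cV[R]_r, M *m x = 0 -> x = 0) ->
  M \in unitmx.
Proof.
move=> inj; rewrite -unitmx_tr -row_free_unit -kermx_eq0; apply/rowV0P => v.
move=> /sub_kermxP/(congr1 trmx); rewrite trmx_mul trmxK trmx0 => /inj/(congr1 trmx).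
by rewrite trmxK trmx0.
Qed.

(* The square matrix [Z^T W] is bounded below by [sqrt (1 - e^2)], hence so is its
   transpose. *)
Lemma subspace_dist_sym p k (W Z : 'M[R]_(p, k)) (y : 'cV[R]_k) :
  orthonormal_cols W -> orthonormal_cols Z -> subspace_dist W Z < 1 ->
  vnorm ((1%:M - W *m W^T) *m (Z *m y)) <= subspace_dist W Z * vnorm y.
Proof.
set e := subspace_dist W Z => oW oZ e1; have e0 : 0 <= e by exact: specnorm_ge0.
set M := Z^T *m W.
(* [|Z^T W x|^2 = |x|^2 - |(1 - Z Z^T) W x|^2], and the last term is at most [e^2 |x|^2]. *)
have hM x : (1 - e ^+ 2) * vnorm x ^+ 2 <= vnorm (M *m x) ^+ 2.
  have := vnorm_mulmx_le_specnorm ((1%:M - Z *m Z^T) *m (W *m W^T)) (W *m x).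
  rewrite -/(subspace_dist W Z) -/e (orthonormal_cols_vnorm x oW).
  rewrite -mulmxA -(mulmxA W) (mulmxA W^T) oW mul1mx.
  rewrite -(ler_pXn2r (n := 2)) ?nnegrE ?mulr_ge0// orthonormal_cols_pythagoras//.
  by rewrite orthonormal_cols_vnorm// exprMn mulmxA -/M; lra.
have e2 : 0 < 1 - e ^+ 2 by nra.
have uM : M \in unitmx.
  apply: inj_unitmx => x Mx0; apply/eqP; rewrite -vnorm_eq0.
  have := hM x; rewrite Mx0 vnorm0 expr0n/= pmulr_rle0// => hx.
  by rewrite -sqrf_eq0 eq_le hx sqr_ge0.
apply: ge0_ler_sqr; first by rewrite mulr_ge0.
rewrite orthonormal_cols_pythagoras// orthonormal_cols_vnorm// exprMn mulmxA.
have -> : W^T *m Z = M^T by rewrite trmx_mul trmxK.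
have [->|y0] := eqVneq y 0; first by rewrite mulmx0 !vnorm0 expr0n/=; lra.
set x := invmx M *m y; have yE : y = M *m x by rewrite mulKVmx.
have h1 := hM x; rewrite -yE in h1.
(* With [y = M x], [|y|^2 = <M^T y, x>]; as [|x|] is at most [|y| / sqrt (1 - e^2)], the lower bound
   passes from [M] to [M^T]. *)
have h2 : vnorm y ^+ 2 <= vnorm (M^T *m y) * vnorm x.
  rewrite vnorm_mul_tr {2}yE mulmxA.
  have -> : y^T *m M = (M^T *m y)^T by rewrite trmx_mul trmxK.
  exact: mulmx_tr_le_vnorm.
have ny : 0 < vnorm y ^+ 2 by rewrite exprn_gt0// vnorm_gt0.
suff : (1 - e ^+ 2) * vnorm y ^+ 2 <= vnorm (M^T *m y) ^+ 2 by lra.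
rewrite -(ler_pM2r ny).
have h3 : vnorm y ^+ 2 * vnorm y ^+ 2 <= vnorm (M^T *m y) ^+ 2 * vnorm x ^+ 2.
  by rewrite -!exprMn ler_pXn2r ?nnegrE ?mulr_ge0// -expr2.
have h4 : vnorm (M^T *m y) ^+ 2 * ((1 - e ^+ 2) * vnorm x ^+ 2) <=
          vnorm (M^T *m y) ^+ 2 * vnorm y ^+ 2 by rewrite ler_wpM2l ?sqr_ge0.
have := ler_wpM2l (ltW e2) h3; lra.
Qed.

Lemma orthonormal_cols_colrange p k (U : 'M[R]_p) : (k <= p)%N ->
  U^T *m U = 1%:M -> orthonormal_cols (colrange 0 k U).
Proof.
move=> kp oU; rewrite /orthonormal_cols trmxK; apply/matrixP => i j.
rewrite !mxE; have ip := leq_trans (ltn_ord i) kp; have jp := leq_trans (ltn_ord j) kp.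
have := congr1 (fun N : 'M[R]_p => N (Ordinal ip) (Ordinal jp)) oU.
rewrite !mxE -val_eqE/= => <-; apply: eq_bigr => t _.
rewrite (@rowrangeE _ _ _ _ _ _ _ (Ordinal ip))// mxE.
by rewrite [X in _ * X]mxE (@rowrangeE _ _ _ _ _ _ _ (Ordinal jp))// mxE.
Qed.

End Orth.

(** * Singular values of the deflated matrix *)

Section SingularValuePerturbation.
Context {R : realType}.
Context (m n k : nat) (A : 'M[R]_(m, n)) (U : 'M[R]_m) (sA : nat -> R) (V : 'M[R]_n).
Context (Q : 'M[R]_(m, k)) (Ut : 'M[R]_m) (sB : nat -> R) (Vt : 'M[R]_n).
Hypothesis svdA : is_svd U sA V A.
Hypothesis oQ : orthonormal_cols Q.
Let B := (1%:M - Q *m Q^T) *m A.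
Hypothesis svdB : is_svd Ut sB Vt B.

(** [A] and [B] agree on the kernel of [Q^T A], which costs [k] equations; [j] more remove the
    leading right singular vectors of [B]. *)
Lemma deflated_sv_ge j : sA (k + j).+1 <= sB j.+1.
Proof.
apply: (svd_le_of_kernel svdA (C := col_mx (Q^T *m A) (rowrange 0 j Vt^T))) => //.
  exact: svd_ge0 svdB _.
move=> x; rewrite mul_col_mx => /eqP; rewrite col_mx_eq0 => /andP[/eqP QA /eqP Vx].
have -> : A *m x = B *m x.
  by rewrite /B -mulmxA mulmxBl mul1mx -!mulmxA (mulmxA Q^T) QA mulmx0 subr0.
by apply: (svd_upper svdB) => i ij; apply: rowrange_mul_eq0 Vx _.
Qed.

Let e := subspace_dist Q (colrange 0 k U).

(** Only the right singular coordinates [k, ..., k + j - 1] of [A] are forced to vanish. The leading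
    [k], left free, are carried by [Uk], where the deflation leaves at most [e |A| |x|]; the
    remaining ones start at [sA (k + j).+1]. *)
Lemma deflated_sv_le j : (k <= m)%N -> e < 1 ->
  sB j.+1 <= sA (k + j).+1 + e * specnorm A.
Proof.
move=> km e1; have e0 : 0 <= e by exact: specnorm_ge0.
have oU : U^T *m U = 1%:M by case: svdA => -[].
have oUk := orthonormal_cols_colrange km oU.
apply: (svd_le_of_kernel svdB (C := rowrange k j V^T)) => //.
  by rewrite addr_ge0 ?mulr_ge0 ?specnorm_ge0 ?(svd_ge0 svdA).
move=> x Vx; set Uk := colrange 0 k U in oUk *.
have -> : B *m x = (1%:M - Q *m Q^T) *m (Uk *m (Uk^T *m (A *m x))) +
    (1%:M - Q *m Q^T) *m ((1%:M - Uk *m Uk^T) *m (A *m x)).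
  rewrite -mulmxDr /B -(mulmxA _ A); congr (_ *m _).
  by rewrite mulmxBl mul1mx mulmxA addrC subrK.
apply: le_trans (vnormD _ _) _; rewrite mulrDl addrC; apply: lerD.
  apply: le_trans (projector_contraction _ oQ) _.
  apply: ge0_ler_sqr; first by rewrite mulr_ge0 ?(svd_ge0 svdA).
  rewrite orthonormal_cols_pythagoras// trmxK -rowrangeM (svd_tr_mul svdA).
  rewrite -(orthogonal_tr_vnorm (V := U) (A *m x))// (svd_tr_mul svdA).
  set z := rect_diag sA *m _; rewrite (vnorm_rowrange_split z km) addrAC subrr add0r.
  rewrite vnorm_rowrange exprMn -(orthogonal_tr_vnorm (V := V) x); last by case: svdA => -[].
  rewrite (eq_bigr (fun i : 'I_(m - k) =>
    (sA (k + i).+1 * vext (V^T *m x) (k + i)) ^+ 2)); last first.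
    by move=> i _; rewrite vext_rect_diag//; have := ltn_ord i; lia.
  apply: (@le_trans _ _ (\sum_(i < m - k)
      sA (k + j).+1 ^+ 2 * vext (V^T *m x) (k + i) ^+ 2)).
    apply: ler_sum => i _; have [ij|ji] := ltnP i j.
      rewrite (rowrange_mul_eq0 Vx); last by lia.
      by rewrite mulr0 expr0n mulr0.
    rewrite exprMn ler_wpM2r ?sqr_ge0// ler_pXn2r ?nnegrE ?(svd_ge0 svdA)//.
    by apply: (svd_dec svdA); lia.
  rewrite -mulr_sumr ler_wpM2l ?sqr_ge0//.
  rewrite -(vnorm_rowrange k (m - k)).
  apply: (@le_trans _ _ (\sum_(i < m) vext (V^T *m x) i ^+ 2)).
    rewrite (sum_rowrange_split (fun i => vext (V^T *m x) i ^+ 2) km).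
    by rewrite vnorm_rowrange lerDr sumr_ge0// => i _; rewrite sqr_ge0.
  rewrite vnorm_vext; pose f i := vext (V^T *m x) i ^+ 2.
  have [mn|/ltnW nm] := leqP m n.
    rewrite [leRHS](sum_rowrange_split f mn) lerDl sumr_ge0// => i _; exact: sqr_ge0.
  rewrite (sum_rowrange_split f nm) [X in _ + X]big1 ?addr0// => i _.
  by rewrite /f vext_out ?expr0n//; lia.
apply: le_trans (subspace_dist_sym _ oQ oUk e1) _.
rewrite -mulrA ler_wpM2l//.
apply: le_trans (orthonormal_cols_tr_contraction _ oUk) _.
exact: vnorm_mulmx_le_specnorm.
Qed.

End SingularValuePerturbation.

(** * Deterministic range finder bounds *)

Section DiagonalScaling.
Context {R : realType}.

Lemma vextB r (y z : 'cV[R]_r) i : vext (y - z) i = vext y i - vext z i.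
Proof. by rewrite /vext; case: insub => [t|]; rewrite ?subr0// !mxE. Qed.

(** The bounds on [s] are asked only on the support of [y]: for test vectors supported on the
    leading [j + 1] coordinates, later entries [(s i.+1)^-1] may exceed [(s j.+1)^-1]. *)
Lemma vnorm_rect_diag_le r (s : nat -> R) (y : 'cV[R]_r) c : 0 <= c ->
  (forall i, (i < r)%N -> vext y i != 0 -> 0 <= s i.+1 <= c) ->
  vnorm (rect_diag s *m y : 'cV[R]_r) <= c * vnorm y.
Proof.
move=> c0 sc; apply: ge0_ler_sqr; first by rewrite mulr_ge0.
rewrite exprMn !vnorm_vext mulr_sumr; apply: ler_sum => i _.
rewrite vext_rect_diag// exprMn.
have [->|yi] := eqVneq (vext y i) 0; first by rewrite expr0n !mulr0.
have /andP[h1 h2] := sc i (ltn_ord i) yi.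
by rewrite ler_wpM2r ?sqr_ge0// ler_pXn2r.
Qed.

Lemma fnorm_orthogonal p r (M : 'M[R]_(p, r)) (V : 'M[R]_r) : V^T *m V = 1%:M ->
  fnorm M ^+ 2 = \sum_(j < r) vnorm (M *m col j V) ^+ 2.
Proof.
move=> oV; rewrite fnorm_sqr.
transitivity (\sum_i \sum_j (M *m V) i j ^+ 2); last first.
  rewrite exchange_big/=; apply: eq_bigr => j _; rewrite vnorm_sqr.
  apply: eq_bigr => i _; congr (_ ^+ 2); rewrite !mxE.
  by apply: eq_bigr => k _; rewrite mxE.
apply: eq_bigr => i _; transitivity (vnorm (row i M)^T ^+ 2).
  by rewrite vnorm_sqr; apply: eq_bigr => j _; rewrite !mxE.
rewrite -(orthogonal_tr_vnorm (V := V))// vnorm_sqr.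
apply: eq_bigr => j _; rewrite -trmx_mul mxE -row_mul mxE.
by [].
Qed.

(** Cauchy-Schwarz for the vectors [(1, g)] and [(v, u)], scaled by [a]. *)
Lemma cauchy_schwarz_pair (a c u v g : R) : 0 <= g -> 0 <= a -> 0 <= u -> 0 <= v ->
  0 <= c -> c ^+ 2 = u ^+ 2 + v ^+ 2 ->
  a * v + a * g * u <= Num.sqrt (1 + g ^+ 2) * a * c.
Proof.
move=> g0 a0 u0 v0 c0 cE; apply: ge0_ler_sqr; first by rewrite !mulr_ge0 ?sqrtr_ge0.
rewrite !exprMn sqr_sqrtr ?addr_ge0 ?sqr_ge0// cE.
have -> : (a * v + a * g * u) ^+ 2 = a ^+ 2 * (v + g * u) ^+ 2 by ring.
have -> : (1 + g ^+ 2) * a ^+ 2 * (u ^+ 2 + v ^+ 2) =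
  a ^+ 2 * ((1 + g ^+ 2) * (u ^+ 2 + v ^+ 2)) by ring.
rewrite ler_wpM2l ?sqr_ge0//.
have : 0 <= (g * v - u) ^+ 2 by exact: sqr_ge0.
nra.
Qed.

End DiagonalScaling.

Section RangeFinder.
Context {R : realType} (m n b q : nat) (B : 'M[R]_(m, n)).
Context (Ut : 'M[R]_m) (s : nat -> R) (Vt : 'M[R]_n).
Context (Om : 'M[R]_(n, b)) (Ql : 'M[R]_(m, b)).
Hypothesis svdB : is_svd Ut s Vt B.
Hypothesis bn : (b <= n)%N.
Hypothesis b0 : (0 < b)%N.
Hypothesis sb0 : 0 < s b.

Let O1 := rowrange 0 b (Vt^T *m Om).
Let O2 := rowrange b (n - b) (Vt^T *m Om).
Let N := O2 *m invmx O1.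
Let Y := (B *m B^T) ^+ q *m B *m Om.
Let tau := s b.+1 / s b.
Hypothesis uO1 : O1 \in unitmx.
Hypothesis orthQ : is_orth Y Ql.

(** Inverse powers of the leading singular values, which undo the power iteration on the leading
    block. *)
Let S e : 'M[R]_b := rect_diag (fun j => (s j)^-1 ^+ e).

Let s_ge0 j : 0 <= s j.+1. Proof. exact: svd_ge0 svdB _. Qed.

Let sb_le i : (i < b)%N -> s b <= s i.+1.
Proof. by move=> ib; rewrite -(prednK b0); apply: (svd_dec svdB); lia. Qed.

Let s_gt0 i : (i < b)%N -> 0 < s i.+1.
Proof. by move=> ib; apply: lt_le_trans sb0 (sb_le ib). Qed.

Let sout j : (n < j)%N -> s j = 0. Proof. exact: (svd_col_out svdB). Qed.

Let stail i : s (b + i).+1 <= s b.+1.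
Proof. by apply: (svd_dec svdB); lia. Qed.

Let oQl : orthonormal_cols Ql. Proof. by case: orthQ. Qed.
Let oU : Ut^T *m Ut = 1%:M. Proof. by case: svdB => -[]. Qed.
Let oV : Vt^T *m Vt = 1%:M. Proof. by case: svdB => -[]. Qed.

Let YE (t : 'cV[R]_b) : Y *m t =
  Ut *m (rect_diag (fun j => s j ^+ (2 * q).+1) *m (Vt^T *m Om *m t)) :> 'cV[R]_m.
Proof. by rewrite /Y (svd_power svdB) !mulmxA. Qed.

Let vext_top e (t : 'cV[R]_b) i : (i < b)%N ->
  vext (Vt^T *m Om *m (invmx O1 *m (S e *m t))) i = (s i.+1)^-1 ^+ e * vext t i.
Proof.
move=> ib; rewrite -[i in LHS]add0n -(vext_rowrange 0 _ (Ordinal ib)).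
rewrite rowrangeM -/O1 mulKVmx//.
by rewrite -(vext_ord _ (Ordinal ib)) vext_rect_diag.
Qed.

Let vext_bot (t : 'cV[R]_b) i : (i < n - b)%N ->
  vext (Vt^T *m Om *m (invmx O1 *m t)) (b + i) = vext (N *m t) i.
Proof.
move=> ib; rewrite -(vext_rowrange b _ (Ordinal ib)) rowrangeM -/O2.
by rewrite (vext_ord _ (Ordinal ib)) /N mulmxA.
Qed.

Lemma residual_sqr_le x :
  vnorm ((1%:M - Ql *m Ql^T) *m (B *m x)) ^+ 2 <=
  \sum_(i < n - b) (s (b + i).+1 * (vext (Vt^T *m x) (b + i) -
     s (b + i).+1 ^+ (2 * q) * vext (N *m (S (2 * q) *m rowrange 0 b (Vt^T *m x))) i)) ^+ 2.
Proof.
(* [B x] already carries one factor [s i.+1] and [Y] carries [2 q + 1] of them, so the exponent that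
   makes the leading coordinates cancel is [2 q]. *)
set y := Vt^T *m x; set t := invmx O1 *m (S (2 * q) *m rowrange 0 b y).
have -> : (1%:M - Ql *m Ql^T) *m (B *m x) =
          (1%:M - Ql *m Ql^T) *m (B *m x - Y *m t).
  rewrite mulmxBr; have [Rm _ YR] := is_orthP orthQ.
  suff -> : (1%:M - Ql *m Ql^T) *m (Y *m t) = 0 by rewrite subr0.
  rewrite mulmxA YR (mulmxA _ Ql) mulmxBl mul1mx -(mulmxA Ql) oQl mulmx1.
  by rewrite subrr !mul0mx.
set z := y - rect_diag (fun j => s j ^+ (2 * q)) *m (Vt^T *m Om *m t).
have zE : vnorm (B *m x - Y *m t) ^+ 2 = \sum_(i < n) (s i.+1 * vext z i) ^+ 2.
  rewrite -(@vnorm_rect_diag _ m); last exact: svd_row_out svdB.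
  rewrite -(orthogonal_tr_vnorm (V := Ut))// mulmxBr (svd_tr_mul svdB) YE.
  rewrite (mulmxA Ut^T) oU mul1mx /z mulmxBr.
  have -> (v : 'cV[R]_n) : rect_diag s *m
       ((rect_diag (fun j => s j ^+ (2 * q)) : 'M[R]_n) *m v) =
      rect_diag (fun j => s j * s j ^+ (2 * q)) *m v :> 'cV[R]_m.
    by rewrite mulmxA rect_diagM//; exact: sout.
  rewrite (_ : (fun j => s j ^+ (2 * q).+1) = fun j => s j * s j ^+ (2 * q))//.
  by apply/funext => j; rewrite exprS.
apply: (@le_trans _ _ (vnorm (B *m x - Y *m t) ^+ 2)).
  by rewrite ler_pXn2r ?nnegrE// projector_contraction.
rewrite zE (sum_rowrange_split (fun i => (s i.+1 * vext z i) ^+ 2) bn).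
rewrite big1 ?add0r.
  apply: ler_sum => i _; rewrite /z vextB vext_rect_diag; last by have := ltn_ord i; lia.
  by rewrite vext_bot.
move=> i _; have ib := ltn_ord i; rewrite /z vextB vext_rect_diag; last by lia.
rewrite vext_top// [vext (rowrange 0 b y) i]vext_ord vext_rowrange add0n.
by rewrite mulrA exprVn mulfV ?mul1r ?subrr ?mulr0 ?expr0n// expf_neq0// gt_eqF// s_gt0.
Qed.

Let tau_ge0 : 0 <= tau. Proof. by rewrite divr_ge0// ltW. Qed.

Let g := tau ^+ (2 * q) * specnorm N.
Let g_ge0 : 0 <= g. Proof. by rewrite mulr_ge0 ?exprn_ge0 ?specnorm_ge0. Qed.
Let g2 : tau ^+ (4 * q) * specnorm N ^+ 2 = g ^+ 2.
Proof. by rewrite /g [RHS]exprMn -[in RHS]exprM; congr (tau ^+ _ * _); lia. Qed.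

(** The tail coordinates split into [d1], coming from the trailing part of [x], and [d2], coming
    from the leading part through [N]. Since [s b.+1 ^+ (2 * q).+1 / s b ^+ (2 * q)] is
    [s b.+1 * tau ^+ (2 * q)], their norms are at most [s b.+1 |y2|] and [s b.+1 g |y1|]. *)
Lemma residual_spec_le x : vnorm ((1%:M - Ql *m Ql^T) *m (B *m x)) <=
  Num.sqrt (1 + tau ^+ (4 * q) * specnorm N ^+ 2) * s b.+1 * vnorm x.
Proof.
set y := Vt^T *m x; set y1 := rowrange 0 b y; set y2 := rowrange b (n - b) y.
pose d1 : 'cV[R]_(n - b) := rect_diag (fun j => s (b + j)%N) *m y2.
pose d2 : 'cV[R]_(n - b) := rect_diag (fun j => s (b + j)%N ^+ (2 * q).+1) *m
  (N *m (S (2 * q) *m y1)).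
apply: (@le_trans _ _ (vnorm (d1 - d2))).
  apply: ge0_ler_sqr => //; apply: le_trans (residual_sqr_le x) _.
  rewrite vnorm_vext le_eqVlt; apply/orP; left; apply/eqP/eq_bigr => i _.
  rewrite vextB !vext_rect_diag// (vext_ord y2) vext_rowrange addnS.
  by rewrite -/y -/y1 mulrBr mulrA -exprS.
have vnormN p (z : 'cV[R]_p) : vnorm (- z) = vnorm z.
  by rewrite -scaleN1r vnormZ normrN1 mul1r.
apply: le_trans (vnormD _ _) _; rewrite vnormN.
have h1 : vnorm d1 <= s b.+1 * vnorm y2.
  by apply: vnorm_rect_diag_le => // i _ _; rewrite addnS s_ge0 stail.
have h2 : vnorm d2 <= s b.+1 * g * vnorm y1.
  apply: (@le_trans _ _ (s b.+1 ^+ (2 * q).+1 * vnorm (N *m (S (2 * q) *m y1)))).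
    apply: vnorm_rect_diag_le => [|i _ _]; first by rewrite exprn_ge0.
    rewrite addnS exprn_ge0 ?s_ge0//= ler_pXn2r ?nnegrE ?s_ge0//.
  have -> : s b.+1 * g * vnorm y1 = s b.+1 ^+ (2 * q).+1 *
      (specnorm N * ((s b)^-1 ^+ (2 * q) * vnorm y1)).
    by rewrite /g /tau exprMn exprS; ring.
  rewrite ler_wpM2l ?exprn_ge0//.
  apply: le_trans (vnorm_mulmx_le_specnorm _ _) _.
  rewrite ler_wpM2l ?specnorm_ge0//.
  apply: vnorm_rect_diag_le => [|i ib _]; first by rewrite exprn_ge0// invr_ge0 ltW.
  have si := s_gt0 ib; rewrite exprn_ge0 ?invr_ge0 ?(ltW si)//=.
  rewrite lerXn2r ?nnegrE ?invr_ge0 ?(ltW si) ?(ltW sb0)//.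
  by rewrite lef_pV2 ?posrE// sb_le.
apply: le_trans (lerD h1 h2) _; rewrite g2.
apply: cauchy_schwarz_pair => //.
by rewrite -(orthogonal_tr_vnorm (V := Vt))// (vnorm_rowrange_split _ bn).
Qed.

(** The Frobenius norm is summed over the right singular vectors. A trailing one contributes at most
    its own [s (b + i).+1 ^+ 2]; the leading ones contribute weighted squares of entries of [N], and
    along a row these squares add up to at most [specnorm N ^+ 2]. This is how the spectral norm of
    [N] enters a Frobenius bound. *)
Lemma residual_frob_le :
  fnorm ((1%:M - Ql *m Ql^T) *m B) ^+ 2 <= (1 + tau ^+ (4 * q) * specnorm N ^+ 2) *
    \sum_(i < n - b) s (b + i).+1 ^+ 2.
Proof.
rewrite (fnorm_orthogonal _ oV).
pose x (i : nat) : 'cV[R]_n := Vt *m \col_j (i == j)%:R.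
have colx (j : 'I_n) : col j Vt = x j.
  by rewrite colE; congr (_ *m _); apply/matrixP => k l; rewrite !mxE ord1 eqxx andbT eq_sym.
pose f i := vnorm ((1%:M - Ql *m Ql^T) *m B *m x i) ^+ 2.
rewrite (eq_bigr (fun j : 'I_n => f j)); last by move=> j _; rewrite /f colx.
rewrite (sum_rowrange_split f bn) mulrDl mul1r addrC.
have Vx i : Vt^T *m x i = \col_j (i == j)%:R by rewrite /x mulmxA oV mul1mx.
have vextx i k : (k < n)%N -> vext (Vt^T *m x i) k = (i == k)%:R.
  by move=> kn; rewrite Vx (vext_ord _ (Ordinal kn)) mxE.
apply: lerD.
  apply: ler_sum => i _; rewrite /f -mulmxA.
  apply: le_trans (residual_sqr_le _) _.
  have -> : rowrange 0 b (Vt^T *m x (b + i)%N) = 0.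
    apply/matrixP => k l; rewrite ord1 vext_rowrange vextx; last by have := ltn_ord k; lia.
    by rewrite mxE add0n; case: eqP => // h; have := ltn_ord k; lia.
  rewrite !mulmx0 (bigD1 i)//= big1 ?addr0 => [|k].
    rewrite vextx; last by have := ltn_ord i; lia.
    by rewrite eqxx (vext_ord _ i) mxE mulr0 subr0 mulr1.
  rewrite -val_eqE/= => ki; rewrite vextx; last by have := ltn_ord k; lia.
  rewrite eqn_add2l eq_sym (negbTE ki) (vext_ord _ k) mxE mulr0 subr0 mulr0.
  by rewrite expr0n.
apply: (@le_trans _ _ (\sum_(i < b) \sum_(k < n - b)
   s (b + k).+1 ^+ 2 * (tau ^+ (4 * q) * N k i ^+ 2))).
  apply: ler_sum => i _; rewrite /f -mulmxA.
  apply: le_trans (residual_sqr_le _) _.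
  apply: ler_sum => k _; rewrite vextx; last by have := ltn_ord k; lia.
  rewrite (_ : (i == (b + k)%N :> nat) = false) ?sub0r; last first.
    by apply/eqP; have := ltn_ord i; lia.
  have ->: vext (N *m (S (2 * q) *m rowrange 0 b (Vt^T *m x i))) k =
      N k i * (s i.+1)^-1 ^+ (2 * q).
    rewrite vext_ord mxE (bigD1 i)//= big1 ?addr0.
      rewrite -vext_ord vext_rect_diag// vext_ord vext_rowrange vextx; last by have := ltn_ord i; lia.
      by rewrite add0n eqxx mulr1.
    move=> j; rewrite -val_eqE/= => ji.
    rewrite -vext_ord vext_rect_diag// vext_ord vext_rowrange vextx; last by have := ltn_ord j; lia.
    by rewrite add0n eq_sym (negbTE ji) !mulr0.
  rewrite mulrN sqrrN exprMn ler_wpM2l ?sqr_ge0// mulrCA exprMn [leRHS]mulrC.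
  rewrite ler_wpM2l ?sqr_ge0// -exprMn -exprM mulnC mulnA.
  have si := s_gt0 (ltn_ord i).
  rewrite lerXn2r ?nnegrE ?mulr_ge0 ?invr_ge0 ?(ltW si) ?(ltW sb0)//.
  apply: ler_pM => //; rewrite ?invr_ge0 ?(ltW si)//.
  by rewrite lef_pV2 ?posrE// sb_le.
rewrite exchange_big/= mulr_sumr; apply: ler_sum => k _.
rewrite -!mulr_sumr mulrC ler_wpM2r ?sqr_ge0// ler_wpM2l ?exprn_ge0//.
exact: row_sqr_le_specnorm.
Qed.

(* Test vectors [Y Om1^-1 S1^-(2q+1) y] with [y] supported on the first [j + 1]
   coordinates: their image under [Ut^T] is [y] stacked over a small perturbation. *)
Lemma range_sv_ge (U' : 'M[R]_b) s' (V' : 'M[R]_n) j : (j < b)%N ->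
  is_svd U' s' V' (Ql^T *m B) ->
  s j.+1 / Num.sqrt (1 + specnorm O2 ^+ 2 * specnorm (invmx O1) ^+ 2
                         * (s b.+1 / s j.+1) ^+ (4 * q + 2)) <= s' j.+1.
Proof.
(* Passing to the transpose puts the test vectors [Rm T y] in [R^b]: they are the coordinates of
   [Y (T y)] in the basis [Ql]. *)
move=> jb /is_svd_tr svd'; have sj := s_gt0 jb.
set rho := s b.+1 / s j.+1.
set D := 1 + _; have D1 : 1 <= D.
  rewrite /D lerDl; do 2 ?apply: mulr_ge0; rewrite ?sqr_ge0// exprn_ge0//.
  by rewrite divr_ge0// ltW.
have sD0 : 0 < Num.sqrt D by rewrite sqrtr_gt0 (lt_le_trans ltr01 D1).
have [Rm _ YR] := is_orthP orthQ.
pose E : 'M[R]_(b, j.+1) := rect_diag (fun=> 1).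
pose T := invmx O1 *m (S (2 * q).+1 *m E).
have QT y : Ql *m (Rm *m T *m y) = Y *m (T *m y) by rewrite YR !mulmxA.
have vE (y : 'cV[R]_j.+1) i : (i < b)%N -> vext (E *m y) i = vext y i.
  by move=> ib; rewrite vext_rect_diag// mul1r.
have nE (y : 'cV[R]_j.+1) : vnorm (E *m y) = vnorm y.
  apply/eqP; rewrite -(eqrXn2 (n := 2))// !vnorm_vext.
  rewrite (sum_rowrange_split (fun i => vext (E *m y) i ^+ 2) jb).
  rewrite [X in _ + X]big1 ?addr0; last first.
    move=> i _; rewrite vE; last by have := ltn_ord i; lia.
    by rewrite vext_out ?expr0n//; lia.
  by apply/eqP/eq_bigr => i _; rewrite vE//; have := ltn_ord i; lia.
have TE y : T *m y = invmx O1 *m (S (2 * q).+1 *m (E *m y)).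
  by rewrite /T -!mulmxA.
pose w (y : 'cV[R]_j.+1) := Vt^T *m Om *m (T *m y).
have wtop y i : (i < b)%N -> vext (w y) i = (s i.+1)^-1 ^+ (2 * q).+1 * vext y i.
  by move=> ib; rewrite /w TE vext_top// vE.
have wbot y i : (i < n - b)%N ->
    vext (w y) (b + i) = vext (N *m (S (2 * q).+1 *m (E *m y))) i.
  by move=> ib; rewrite /w TE vext_bot.
pose u (y : 'cV[R]_j.+1) : 'cV[R]_m := rect_diag (fun j => s j ^+ (2 * q).+1) *m w y.
have QU y : Ql *m (Rm *m T *m y) = Ut *m u y by rewrite QT YE.
have nu y : vnorm (u y) ^+ 2 = vnorm y ^+ 2 +
    \sum_(i < n - b) (s (b + i).+1 ^+ (2 * q).+1 * vext (w y) (b + i)) ^+ 2.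
  rewrite /u (@vnorm_rect_diag _ m); last first.
    by move=> k mk; rewrite (svd_row_out svdB)// exprS mul0r.
  rewrite (sum_rowrange_split (fun i => (s i.+1 ^+ (2 * q).+1 * vext (w y) i) ^+ 2) bn).
  congr (_ + _); rewrite -(nE y) vnorm_vext; apply: eq_bigr => i _.
  rewrite wtop// vE// mulrA exprVn mulfV ?mul1r// expf_neq0// gt_eqF//.
  exact: s_gt0.
have nuy y : vnorm (u y) <= Num.sqrt D * vnorm y.
  apply: ge0_ler_sqr; first by rewrite mulr_ge0 ?sqrtr_ge0.
  rewrite exprMn [Num.sqrt D ^+ 2]sqr_sqrtr; last exact: le_trans ler01 D1.
  rewrite nu /D mulrDl mul1r lerD2l.
  pose d : 'cV[R]_(n - b) := rect_diag (fun k => s (b + k)%N ^+ (2 * q).+1) *m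
     (N *m (S (2 * q).+1 *m (E *m y))).
  have -> : \sum_(i < n - b) (s (b + i).+1 ^+ (2 * q).+1 * vext (w y) (b + i)) ^+ 2
     = vnorm d ^+ 2.
    rewrite vnorm_vext; apply: eq_bigr => i _.
    by rewrite wbot// vext_rect_diag// addnS.
  have -> : specnorm O2 ^+ 2 * specnorm (invmx O1) ^+ 2 * rho ^+ (4 * q + 2) *
       vnorm y ^+ 2 =
     (s b.+1 ^+ (2 * q).+1 * ((specnorm O2 * specnorm (invmx O1)) *
        ((s j.+1)^-1 ^+ (2 * q).+1 * vnorm (E *m y)))) ^+ 2.
    have -> : (4 * q + 2 = (2 * q).+1 * 2)%N by lia.
    by rewrite nE exprM /rho [(_ / _) ^+ _]exprMn; ring.
  rewrite ler_pXn2r ?nnegrE ?mulr_ge0 ?specnorm_ge0 ?exprn_ge0 ?invr_ge0 ?(ltW sj)//.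
  apply: (@le_trans _ _ (s b.+1 ^+ (2 * q).+1 * vnorm (N *m (S (2 * q).+1 *m (E *m y))))).
    apply: vnorm_rect_diag_le => [|i _ _]; first by rewrite exprn_ge0.
    by rewrite addnS exprn_ge0 ?s_ge0//= lerXn2r ?nnegrE ?s_ge0.
  rewrite ler_wpM2l ?exprn_ge0//.
  apply: le_trans (vnorm_mulmx_le_specnorm _ _) _.
  apply: ler_pM => //; [exact: specnorm_ge0|exact: specnormM|].
  apply: vnorm_rect_diag_le => [|i ib].
    by rewrite exprn_ge0// invr_ge0 ltW.
  rewrite vE// => yi; have ij : (i <= j)%N.
    by rewrite leqNgt; apply: contra yi => ji; rewrite vext_out.
  have si := s_gt0 ib; rewrite exprn_ge0 ?invr_ge0 ?(ltW si)//=.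
  rewrite lerXn2r ?nnegrE ?invr_ge0 ?(ltW si) ?(ltW sj)//.
  by rewrite lef_pV2 ?posrE//; apply: (svd_dec svdB).
apply: (svd_ge_of_image svd' (N := Rm *m T)) => // y.
  move=> y0; rewrite -vnorm_gt0 -(orthonormal_cols_vnorm _ oQl) QU.
  rewrite orthonormal_cols_vnorm// lt_neqAle vnorm_ge0 andbT eq_sym.
  rewrite -sqrf_eq0 nu gt_eqF// ltr_pwDl ?exprn_gt0 ?vnorm_gt0// sumr_ge0// => i _; exact: sqr_ge0.
rewrite -(orthonormal_cols_vnorm (Rm *m T *m y) oQl).
have -> : (Ql^T *m B)^T *m (Rm *m T *m y) = B^T *m (Ut *m u y).
  by rewrite trmx_mul trmxK -QU (mulmxA B^T Ql).
rewrite QU orthonormal_cols_vnorm// mulrAC ler_pdivrMr//.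
(* Denominator: [|u y|] is at most [sqrt D |y|]. Numerator: the leading coordinates of [u y] are
   those of [y], supported on indices at most [j], so [|B^T Ut (u y)|] is at least [s j.+1 |y|]. *)
apply: (@le_trans _ _ (s j.+1 * (Num.sqrt D * vnorm y))).
  by rewrite ler_wpM2l ?(ltW sj).
rewrite mulrCA mulrC ler_pM2r//.
have svdT := is_svd_tr svdB.
apply: ge0_ler_sqr => //; rewrite exprMn (svd_vnorm svdT) mulmxA oU mul1mx.
have bm : (b <= m)%N.
  by rewrite leqNgt; apply/negP => mb; move: sb0; rewrite (svd_row_out svdB)// ltxx.
rewrite (sum_rowrange_split (fun i => (s i.+1 * vext (u y) i) ^+ 2) bm).
apply: (@le_trans _ _ (\sum_(i < b) (s i.+1 * vext (u y) i) ^+ 2)); last first.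
  by rewrite lerDl sumr_ge0// => i _; rewrite sqr_ge0.
rewrite -(nE y) vnorm_vext mulr_sumr; apply: ler_sum => i _.
have -> : vext (u y) i = vext y i.
  rewrite vext_rect_diag; last by have := ltn_ord i; lia.
  rewrite wtop// mulrA exprVn mulfV ?mul1r// expf_neq0// gt_eqF//; exact: s_gt0.
rewrite vE// exprMn; have [ij|ji] := leqP i j; last first.
  by rewrite (@vext_out _ _ _ i)// expr0n !mulr0.
rewrite ler_wpM2r ?sqr_ge0// ler_pXn2r ?nnegrE ?s_ge0//.
exact: (svd_dec svdB).
Qed.

End RangeFinder.

(** * The standard normal law on the line and on the plane *)

Section Density.
Local Open Scope ereal_scope.
Context d (T : measurableType d) (R : realType).
Variables (mu nu : {measure set T -> \bar R}) (w : T -> R).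
Hypothesis mw : measurable_fun setT w.
Hypothesis w0 : forall x, (0 <= w x)%R.
Hypothesis nuE : forall A, measurable A -> nu A = \int[mu]_(x in A) (w x)%:E.

Import HBNNSimple.

(** Simple functions first, then monotone convergence along their increasing approximations. *)
Lemma ge0_integral_density (f : T -> \bar R) : measurable_fun setT f ->
  (forall x, 0 <= f x) -> \int[nu]_x f x = \int[mu]_x (f x * (w x)%:E).
Proof.
move=> mf f0; pose f_ := nnsfun_approx measurableT mf.
have cvf x : (f_ n x)%:E @[n --> \oo] --> f x by exact: cvg_nnsfun_approx.
have ndf x : {homo (fun n => (f_ n x)%:E) : n m / (n <= m)%N >-> n <= m}.
  by move=> n m nm; rewrite lee_fin; exact/lefP/nd_nnsfun_approx.
transitivity (limn (fun n => \int[nu]_x (f_ n x)%:E)).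
  rewrite -monotone_convergence//.
  - by apply: eq_integral => x _; apply/esym/cvg_lim.
  - by move=> n; exact/measurable_EFinP.
  - by move=> n x _; rewrite lee_fin.
transitivity (limn (fun n => \int[mu]_x ((f_ n x)%:E * (w x)%:E))); last first.
  rewrite -monotone_convergence//.
  - by apply: eq_integral => x _; apply/cvg_lim => //; exact: cvgeZr.
  - by move=> n; apply: emeasurable_funM; exact/measurable_EFinP.
  - by move=> n x _; rewrite mule_ge0// lee_fin.
  - by move=> x _ n m nm; rewrite lee_wpmul2r ?lee_fin//; exact: ndf.
apply/congr_lim/funext => n; rewrite integralT_nnsfun sintegralE.
under [RHS]eq_integral.
  move=> x _; rewrite fimfunE -fsumEFin// ge0_mule_fsuml; last first.
    by move=> r; rewrite EFinM nnfun_muleindic_ge0.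
  over.
rewrite [RHS]ge0_integral_fsum//; last 2 first.
- move=> r; apply: emeasurable_funM; last exact/measurable_EFinP.
  by apply/measurable_EFinP; exact: measurable_funM.
- move=> r x _; apply: mule_ge0; last by rewrite lee_fin.
  by rewrite EFinM nnfun_muleindic_ge0.
apply: eq_fsbigr => r /set_mem [y _ <-].
under [RHS]eq_integral do rewrite EFinM -muleA.
rewrite ge0_integralZl//; last 3 first.
- by apply: emeasurable_funM; exact/measurable_EFinP.
- by move=> x _; rewrite mule_ge0// lee_fin.
- by rewrite lee_fin.
congr (_ * _); rewrite nuE//; rewrite integral_mkcond; apply: eq_integral => x _.
by rewrite patchE indicE; case: (x \in _); rewrite ?mul1e ?mul0e.
Qed.

End Density.

Section Lebesgue2.
Local Open Scope ereal_scope.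
Context {R : realType}.
Local Notation mu := (@lebesgue_measure R).
Local Notation gT := (measurableTypeR R).

Lemma lebesgue_measure_shift (a : R) (A : set R) : measurable A ->
  pushforward mu (fun x : gT => (x + a)%R : gT) A = mu A.
Proof.
move=> mA; have ms : measurable_fun setT (fun x : gT => (x + a)%R : gT).
  by apply: measurable_funD.
apply/esym/lebesgue_measure_unique => //= _ [[x y]] _ <-.
rewrite /pushforward/=.
have -> : (fun x0 : R => (x0 + a)%R) @^-1` `]x, y]%classic =
    `](x - a)%R, (y - a)%R]%classic.
  by apply/seteqP; split => z /=; rewrite !in_itv/= ltrBlDr lerBrDr.
rewrite !lebesgue_measure_itv/= !lte_fin ltrD2r; case: ifPn => // _.
by rewrite -!EFinB; congr EFin; ring.
Qed.

Lemma ge0_integral_shift (a : R) (f : gT -> \bar R) : measurable_fun setT f ->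
  (forall x, 0 <= f x) -> \int[mu]_x f (x + a)%R = \int[mu]_x f x.
Proof.
move=> mf f0.
have ms : measurable_fun setT (fun x : gT => (x + a)%R : gT).
  by apply: measurable_funD.
transitivity (\int[pushforward mu (fun x : gT => (x + a)%R : gT)]_x f x).
  by rewrite ge0_integral_pushforward.
by apply: eq_measure_integral => A mA _; exact: lebesgue_measure_shift.
Qed.

Local Notation mu2 := (mu \x mu).

(** Tonelli with the sheared coordinate innermost: for a fixed second coordinate the shear is a
    translation. *)
Lemma integral_shear1 (a : R) (f : gT * gT -> \bar R) : measurable_fun setT f ->
  (forall z, 0 <= f z) ->
  \int[mu2]_z f ((z.1 + a * z.2)%R, z.2) = \int[mu2]_z f z.
Proof.
move=> mf f0; rewrite !fubini_tonelli2//; last first.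
  apply: (measurableT_comp mf); apply: measurable_fun_pair => //.
  by apply: measurable_funD => //; apply: measurable_funM.
apply: eq_integral => y _; rewrite /fubini_G/=.
rewrite (ge0_integral_shift (a * y)%R (f := fun x => f (x, y)))//.
by apply: (measurableT_comp mf); apply: measurable_fun_pair.
Qed.

Lemma integral_shear2 (a : R) (f : gT * gT -> \bar R) : measurable_fun setT f ->
  (forall z, 0 <= f z) ->
  \int[mu2]_z f (z.1, (z.2 + a * z.1)%R) = \int[mu2]_z f z.
Proof.
move=> mf f0; rewrite !fubini_tonelli1//; last first.
  apply: (measurableT_comp mf); apply: measurable_fun_pair => //.
  by apply: measurable_funD => //; apply: measurable_funM.
apply: eq_integral => x _; rewrite /fubini_F/=.
rewrite (ge0_integral_shift (a * x)%R (f := fun y => f (x, y)))//.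
by apply: (measurableT_comp mf); apply: measurable_fun_pair.
Qed.

(* A rotation is a product of three shears. *)
Lemma integral_rotation (c s : R) (f : gT * gT -> \bar R) :
  (s != 0)%R -> (c ^+ 2 + s ^+ 2 = 1)%R -> measurable_fun setT f ->
  (forall z, 0 <= f z) ->
  \int[mu2]_z f ((c * z.1 - s * z.2)%R, (s * z.1 + c * z.2)%R) = \int[mu2]_z f z.
Proof.
(* For a rotation of angle [theta] this is [- tan (theta / 2)], the parameter of the two outer
   shears; the middle one has parameter [s]. *)
move=> s0 cs mf f0; pose t := ((c - 1) / s)%R.
have ts : (t * s = c - 1)%R by rewrite /t divfK.
have tc : (t * (c + 1) = - s)%R.
  apply: (mulfI s0); rewrite /t mulrN.
  have -> : (s * ((c - 1) / s * (c + 1)) = (c ^+ 2 - 1) * (s / s))%R by ring.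
  by rewrite divff// mulr1 -cs; ring.
rewrite -[RHS](integral_shear1 t mf f0).
have m1 : measurable_fun setT (fun z : gT * gT => f ((z.1 + t * z.2)%R, z.2)).
  apply: (measurableT_comp mf); apply: measurable_fun_pair => //.
  by apply: measurable_funD => //; apply: measurable_funM.
rewrite -[RHS](integral_shear2 s m1)//=.
have m2 : measurable_fun setT (fun z : gT * gT =>
    f ((z.1 + t * (z.2 + s * z.1))%R, (z.2 + s * z.1)%R)).
  apply: (measurableT_comp mf); apply: measurable_fun_pair => //.
    apply: measurable_funD => //; apply: measurable_funM => //.
    by apply: measurable_funD => //; apply: measurable_funM.
  by apply: measurable_funD => //; apply: measurable_funM.
rewrite -[RHS](integral_shear1 t m2)//=.
apply: eq_integral => -[x y] _ /=; congr (f (_, _)).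
  have -> : (x + t * y + t * (y + s * (x + t * y)) =
    x * (1 + t * s) + y * (t + (t + t * s * t)))%R by ring.
  have -> : (t + (t + t * s * t) = t * (c + 1))%R by rewrite ts; ring.
  by rewrite ts tc; ring.
have -> : (y + s * (x + t * y) = s * x + (1 + t * s) * y)%R by ring.
by rewrite ts; ring.
Qed.

End Lebesgue2.

Section Gauss.
Local Open Scope ereal_scope.
Context {R : realType}.
Local Notation mu := (@lebesgue_measure R).
Local Notation gT := (measurableTypeR R).
Local Notation gam := (normal_prob (0 : R) 1).
Local Notation phi := (normal_pdf (0 : R) 1).

Lemma ge0_integral_normal_prob (m s : R) (f : gT -> \bar R) :
  measurable_fun setT f -> (forall x, 0 <= f x) ->
  \int[normal_prob m s]_x f x = \int[mu]_x (f x * (normal_pdf m s x)%:E).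
Proof.
move=> mf f0; apply: ge0_integral_density => //.
- exact: measurable_normal_pdf.
- exact: normal_pdf_ge0.
Qed.

Lemma normal_pdf01E x : phi x = (normal_peak 1 * expR (- x ^+ 2 / 2))%R.
Proof.
by rewrite normal_pdfE ?oner_neq0// /normal_fun subr0 expr1n.
Qed.

Lemma normal_prob_prodE (E : set (gT * gT)) : measurable E ->
  (gam \x gam) E = \int[mu \x mu]_z (\1_E z * (phi z.1 * phi z.2))%:E.
Proof.
move=> mE; have m1 : measurable_fun setT (fun z : gT * gT => (\1_E z)%:E : \bar R).
  by apply/measurable_EFinP; exact: measurable_indic.
have mphi : measurable_fun setT (phi : gT -> R) by exact: measurable_normal_pdf.
have phi0 x : (0 <= phi x)%R by exact: normal_pdf_ge0.
rewrite -[E in LHS]setIT -integral_indic// fubini_tonelli1//.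
rewrite ge0_integral_normal_prob; last 2 first.
- by apply: measurable_fun_fubini_tonelli_F.
- by move=> x; apply: integral_ge0.
rewrite fubini_tonelli1; last 2 first.
- apply/measurable_EFinP; apply: measurable_funM; first exact: measurable_indic.
  by apply: measurable_funM; exact: measurableT_comp.
- by move=> z; rewrite lee_fin mulr_ge0// mulr_ge0.
apply: eq_integral => x _; rewrite /fubini_F/=.
have mx : measurable_fun setT (fun y : gT => (\1_E (x, y))%:E : \bar R).
  by apply: (measurableT_comp m1); exact: measurable_fun_pair.
rewrite ge0_integral_normal_prob//.
rewrite [LHS]muleC -ge0_integralZl//; last 3 first.
- by apply: emeasurable_funM => //; exact/measurable_EFinP.
- by move=> y _; rewrite mule_ge0// lee_fin.
- by rewrite lee_fin.
by apply: eq_integral => y _; rewrite -!EFinM; congr EFin; ring.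
Qed.

(** The product density depends on [z.1 ^+ 2 + z.2 ^+ 2] alone, and rotations preserve Lebesgue
    measure. *)
Lemma normal_prob_rotation (c s : R) (E : set (gT * gT)) :
  (c ^+ 2 + s ^+ 2 = 1)%R -> (s != 0)%R -> measurable E ->
  (gam \x gam) ((fun z => ((c * z.1 - s * z.2)%R, (s * z.1 + c * z.2)%R)) @^-1` E) =
  (gam \x gam) E.
Proof.
move=> cs s0 mE.
have mr : measurable_fun setT
    (fun z : gT * gT => ((c * z.1 - s * z.2)%R, (s * z.1 + c * z.2)%R) : gT * gT).
  apply: measurable_fun_pair.
    by apply: measurable_funB; apply: measurable_funM.
  by apply: measurable_funD; apply: measurable_funM.
rewrite !normal_prob_prodE//; last by rewrite -[X in measurable X]setTI; exact: mr.
have mphi : measurable_fun setT (phi : gT -> R) by exact: measurable_normal_pdf.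
have phi0 x : (0 <= phi x)%R by exact: normal_pdf_ge0.
rewrite -(integral_rotation s0 cs (f := fun z => (\1_E z * (phi z.1 * phi z.2))%:E)).
- apply: eq_integral => -[x y] _ /=; congr EFin; congr (_ * _)%R.
  rewrite !normal_pdf01E; set p := normal_peak 1.
  have e u v : (p * expR u * (p * expR v) = p ^+ 2 * expR (u + v))%R.
    by rewrite expRD; ring.
  rewrite !e; congr (_ * expR _)%R.
  by rewrite -!mulrDl; congr (_ / _)%R; rewrite -[LHS]mulr1 -cs; ring.
- apply/measurable_EFinP; apply: measurable_funM; first exact: measurable_indic.
  by apply: measurable_funM; exact: measurableT_comp.
- by move=> z; rewrite lee_fin mulr_ge0// mulr_ge0.
Qed.

(** Serves for reflections: clearing an orthogonal matrix by rotations may leave a diagonal entry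
    [-1]. *)
Lemma normal_prob_opp (A : set gT) : measurable A ->
  gam ((-%R : gT -> gT) @^-1` A) = gam A.
Proof.
move=> mA; rewrite /normal_prob [LHS]integral_mkcond [RHS]integral_mkcond.
have mphi : measurable_fun setT (phi : gT -> R) by exact: measurable_normal_pdf.
have mo : measurable_fun setT (-%R : gT -> gT) by exact: oppr_measurable.
transitivity (\int[pushforward mu (-%R : gT -> gT)]_x
    ((fun x => (phi x)%:E) \_ A) x); last first.
  by apply: eq_measure_integral => B mB _; exact: lebesgue_measureN.
rewrite ge0_integral_pushforward//=.
- apply: eq_integral => x _; rewrite !patchE/=.
  by rewrite (_ : (- x)%R \in A = (x \in -%R @^-1` A))// !normal_pdf01E sqrrN.
- by apply/(measurable_restrictT _ _).1 => //; apply/measurable_EFinP; exact: measurable_funTS.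
- by move=> x _; rewrite patchE; case: ifP => // _; rewrite lee_fin normal_pdf_ge0.
Qed.

(** The density is at most [1 / sqrt (2 pi) <= 1 / 2], by [pi >= 2], and the interval has length
    [2 z]. *)
Lemma normal_prob_ball_le (z : R) : (0 <= z)%R ->
  gam [set x : gT | (`|x| < z)%R] <= z%:E.
Proof.
move=> z0; have -> : [set x : gT | (`|x| < z)%R] = `](- z)%R, z[%classic.
  by apply/seteqP; split => x /=; rewrite in_itv/= ltr_norml.
apply: (@le_trans _ _ (\int[mu]_(x in `](- z)%R, z[) (normal_peak (1 : R))%:E)).
  apply: ge0_le_integral => //=.
  - by move=> x _; rewrite lee_fin normal_pdf_ge0.
  - by apply/measurable_EFinP/measurable_funTS; exact: measurable_normal_pdf.
  - by move=> x _; rewrite lee_fin normal_pdf_ub// oner_neq0.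
rewrite integral_cst//= lebesgue_measure_itv/= lte_fin.
case: ifPn => [_|_]; last by rewrite mule0 lee_fin.
rewrite -EFinB -EFinM lee_fin.
suff : (normal_peak (1 : R) <= 2^-1)%R by nra.
rewrite /normal_peak expr1n mul1r lef_pV2 ?posrE//; last first.
  by rewrite sqrtr_gt0 mulrn_wgt0// pi_gt0.
rewrite -[leLHS]ger0_norm// -sqrtr_sqr ler_sqrt; last first.
  by rewrite -mulr_natr mulr_ge0// pi_ge0.
by have := pi_ge2 R; rewrite -mulr_natr; lra.
Qed.

(* From [x^2 <= (exp (a x^2) - 1) / a] with [a = (1 - s^-2) / 2], for which
   [exp (a x^2)] times the standard density is [s] times the density of variance [s^2];
   then [s] tends to [1]. *)
Lemma normal_second_moment_le : \int[gam]_x ((x ^+ 2)%:E) <= 1.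
Proof.
have mphi s : measurable_fun setT (normal_pdf (0 : R) s : gT -> R).
  exact: measurable_normal_pdf.
have msq : measurable_fun setT (fun x : gT => (x ^+ 2)%:E : \bar R).
  by apply/measurable_EFinP; exact: measurable_funX.
rewrite ge0_integral_normal_prob//; last by move=> x; rewrite lee_fin sqr_ge0.
apply/lee_addgt0Pr => e e0; pose s : R := (1 + e / 2)%R.
have s1 : (1 < s)%R by rewrite ltrDl divr_gt0.
have s0 : (0 < s)%R by apply: lt_trans s1.
pose a : R := ((1 - s ^- 2) / 2)%R.
have s2 : (s ^- 2 < 1)%R by rewrite invf_lt1 ?exprn_gt0// expr_gt1// ltW.
have a0 : (0 < a)%R by rewrite divr_gt0// subr_gt0.
have ub x : (x ^+ 2 * phi x + a^-1 * phi x <= a^-1 * s * normal_pdf 0 s x)%R.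
  rewrite normal_pdf01E normal_pdfE ?gt_eqF// /normal_fun subr0.
  have -> : (normal_peak s = s^-1 * normal_peak (1 : R))%R.
    rewrite /normal_peak expr1n mul1r -mulrnAr sqrtrM ?sqr_ge0// sqrtr_sqr.
    by rewrite (gtr0_norm s0) invfM.
  have -> : (expR (- x ^+ 2 / (s ^+ 2 *+ 2)) =
      expR (- x ^+ 2 / 2) * expR (a * x ^+ 2))%R.
    rewrite -expRD; congr expR; rewrite /a -[(_ *+ 2)%R]mulr_natr invfM.
    by rewrite !mulrA; field; rewrite gt_eqF.
  have p0 : (0 <= normal_peak (1 : R) * expR (- x ^+ 2 / 2))%R.
    by rewrite mulr_ge0 ?normal_peak_ge0 ?expR_ge0.
  have h := expR_ge1Dx (a * x ^+ 2).
  have -> : (a^-1 * s * (s^-1 * normal_peak 1 *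
      (expR (- x ^+ 2 / 2) * expR (a * x ^+ 2))) =
      (normal_peak 1 * expR (- x ^+ 2 / 2)) * (a^-1 * expR (a * x ^+ 2)))%R.
    by field; rewrite !gt_eqF.
  rewrite -mulrDl mulrC; apply: ler_wpM2l => //.
  by rewrite mulrC ler_pdivlMr// mulrDl mulVf ?gt_eqF// mulrC addrC.
have : \int[mu]_x ((x ^+ 2)%:E * (phi x)%:E) + (a^-1)%:E <= (a^-1 * s)%:E.
  have -> : (a^-1)%:E = \int[mu]_x ((a^-1)%:E * (phi x)%:E).
    rewrite ge0_integralZl//; first by rewrite integral_normal_pdf mule1.
    - exact/measurable_EFinP.
    - by move=> x _; rewrite lee_fin normal_pdf_ge0.
    - by rewrite lee_fin invr_ge0 ltW.
  have -> : (a^-1 * s)%:E = \int[mu]_x ((a^-1 * s)%:E * (normal_pdf 0 s x)%:E).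
    rewrite ge0_integralZl//; first by rewrite integral_normal_pdf mule1.
    - exact/measurable_EFinP.
    - by move=> x _; rewrite lee_fin normal_pdf_ge0.
    - by rewrite lee_fin mulr_ge0 ?invr_ge0// ltW.
  rewrite -ge0_integralD//.
  - apply: ge0_le_integral => //.
    + by move=> x _; rewrite adde_ge0// mule_ge0// lee_fin ?sqr_ge0 ?normal_pdf_ge0 ?invr_ge0 ?ltW.
    + by apply: emeasurable_funD; apply: emeasurable_funM => //; exact/measurable_EFinP.
    + by apply: emeasurable_funM => //; exact/measurable_EFinP.
    + by move=> x _; rewrite -!EFinM -EFinD lee_fin.
  - by move=> x _; rewrite mule_ge0// lee_fin ?sqr_ge0 ?normal_pdf_ge0.
  - by apply: emeasurable_funM => //; exact/measurable_EFinP.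
  - by move=> x _; rewrite mule_ge0// lee_fin ?normal_pdf_ge0 ?invr_ge0 ?ltW.
  - by apply: emeasurable_funM => //; exact/measurable_EFinP.
rewrite -leeBrDr// -EFinB => /le_trans; apply; rewrite -EFinD lee_fin.
(* This quantity equals [2 s^2 / (s + 1)]; with [s = 1 + e / 2] it stays below [1 + e]. *)
have -> : (a^-1 * s - a^-1 = (s - 1) / a)%R by ring.
rewrite ler_pdivrMr// /a.
have -> : ((1 + e) * ((1 - s ^- 2) / 2) = (1 + e) * (s ^+ 2 - 1) / 2 / s ^+ 2)%R.
  by field; rewrite gt_eqF.
rewrite ler_pdivlMr ?exprn_gt0//.
suff : (0 <= (s - 1) * ((1 + e) * (s + 1) - 2 * s ^+ 2))%R by nra.
rewrite mulr_ge0 ?subr_ge0 ?(ltW s1)// /s; nra.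
Qed.

End Gauss.

(** * Orthogonal invariance of Gaussian families *)

Section GaussianFamily.
Context {R : realType} d (T : measurableType d) (P : probability T R).
Local Notation gT := (measurableTypeR R).
Local Notation gam := (normal_prob (0 : R) 1).

(** A single product formula on boxes encodes independence and standard normal marginals together:
    taking all but one [B i] equal to the whole line recovers a marginal. *)
Definition gaussian_family (I : finType) (X : I -> T -> gT) : Prop :=
  (forall i, measurable_fun setT (X i)) /\
  forall B : I -> set gT, (forall i, measurable (B i)) ->
    P (\bigcap_(i in [set: I]) (X i @^-1` B i)) = (\prod_(i : I) gam (B i))%E.

Lemma gaussian_familyP (I : finType) (X : I -> T -> R) :
  (forall i, std_normal_rv P (X i)) -> indep_family P X -> gaussian_family X.
Proof.
move=> nX iX; split=> [i|B mB]; first by case: (nX i).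
rewrite (iX B mB); apply: eq_bigr => i _.
by case: (nX i) => _ /(_ _ (mB i)) ->.
Qed.

Lemma gaussian_family_marginal (I : finType) (X : I -> T -> gT) i (A : set gT) :
  gaussian_family X -> measurable A -> P (X i @^-1` A) = gam A.
Proof.
move=> [mX PX] mA; pose B j : set gT := if j == i then A else setT.
have := PX B; have -> : \bigcap_(j in [set: I]) (X j @^-1` B j) = X i @^-1` A.
  apply/seteqP; split => [w /(_ i Logic.I)|w Xw j _]; first by rewrite /B eqxx.
  by rewrite /B /=; case: eqP => // ->.
move=> ->; last by move=> j; rewrite /B; case: ifP.
rewrite (bigD1 i)//= big1 ?mule1; first by rewrite /B eqxx.
move=> j /negbTE ji; rewrite /B ji; exact: probability_setT.
Qed.

Lemma gaussian_family_reindex (I J : finType) (h : J -> I) (X : I -> T -> gT) :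
  injective h -> gaussian_family X -> gaussian_family (fun j => X (h j)).
Proof.
move=> injh [mX PX]; split=> [j|B mB]; first exact: mX.
pose B' i : set gT := if [pick j | h j == i] is Some j then B j else setT.
have B'h j : B' (h j) = B j.
  rewrite /B'; case: pickP => [k /eqP/injh ->//|/(_ j)]; by rewrite eqxx.
have mB' i : measurable (B' i) by rewrite /B'; case: pickP.
have -> : \bigcap_(i in [set: J]) (X (h i) @^-1` B i) =
          \bigcap_(i in [set: I]) (X i @^-1` B' i).
  apply/seteqP; split => w /= Xw i _.
    rewrite /B'; case: pickP => // j /eqP <-; exact: Xw.
  by rewrite -B'h; exact: Xw.
rewrite PX// (bigID (mem (codom h)))/= [X in (_ * X)%E]big1 ?mule1; last first.
  move=> i; rewrite /B'; case: pickP => [j /eqP <-|_ _]; first by rewrite codom_f.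
  exact: probability_setT.
rewrite -big_uniq/=; last by rewrite map_inj_uniq ?enum_uniq.
by rewrite big_map big_enum; apply: eq_bigr => j _; rewrite B'h.
Qed.

Lemma gaussian_family_opp (I : finType) (X : I -> T -> gT) (i : I) :
  gaussian_family X ->
  gaussian_family (fun k w => if k == i then - X k w else X k w).
Proof.
move=> [mX PX]; have mo : measurable_fun setT (-%R : gT -> gT).
  exact: oppr_measurable.
split=> [k|B mB]; first by case: eqP => _ //; exact: measurableT_comp.
pose B' k : set gT := if k == i then -%R @^-1` B k else B k.
have mB' k : measurable (B' k).
  by rewrite /B'; case: ifP => // _; rewrite -[X in measurable X]setTI; exact: mo.
transitivity (P (\bigcap_(k in [set: I]) (X k @^-1` B' k))).
  congr (P _); apply: eq_bigcapr => k _; apply/seteqP.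
  by split => w /=; rewrite /B'; case: eqP.
rewrite PX//; apply: eq_bigr => k _; rewrite /B'; case: eqP => // _.
exact: normal_prob_opp.
Qed.

(** Rectangles form a generating pi-system. The factor [k] allows a total mass other than one: [nu]
    will be the law of two coordinates restricted to an event on the others. *)
Lemma scaled_product_measure_unique (m1 m2 : probability gT R)
    (nu : {measure set (gT * gT) -> \bar R}) (k : {nonneg R}) :
  (forall A B, measurable A -> measurable B ->
     nu (A `*` B) = (k%:num%:E * (m1 A * m2 B))%E) ->
  forall E, measurable E -> nu E = (k%:num%:E * (m1 \x m2)%E E)%E.
Proof.
move=> nuE E mE.
pose C : set (set (gT * gT)) :=
  [set C | exists A B, [/\ measurable A, measurable B & C = A `*` B]].
have nuT : nu setT = (k%:num)%:E.
  by rewrite -setXTT nuE// !probability_setT !mule1.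
rewrite (_ : (_ * _)%E = mscale k (m1 \x m2)%E E)//.
apply: (measure_unique C (fun=> setT)) => //.
- rewrite measurable_prod_measurableType; congr (<<s _ >>).
  apply/seteqP; split => X /=.
    by move=> [A mA [B mB <-]]; exists A, B.
  by move=> [A [B [mA mB ->]]]; exists A => //; exists B.
- move=> _ _ [A [B [mA mB ->]]] [A' [B' [mA' mB' ->]]].
  rewrite -setXI; exists (A `&` A'), (B `&` B').
  by split => //; exact: measurableI.
- by move=> _; exists setT, setT; rewrite setXTT.
- by rewrite bigcup_const//; exists 0%N.
- by move=> _ [A [B [mA mB ->]]]; rewrite nuE//; congr (_ * _)%E; exact/esym/product_measure1E.
- by move=> _; rewrite nuT ltry.
Qed.

(** Fix the boxes of the other coordinates. Restricted to that event, the pair [(X i, X j)] has law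
    [k0 (gam \x gam)], which the planar rotation preserves. *)
Lemma gaussian_family_rotation (I : finType) (X : I -> T -> gT) (i j : I) (c s : R) :
  i != j -> c ^+ 2 + s ^+ 2 = 1 -> s != 0 -> gaussian_family X ->
  gaussian_family (fun k w => if k == i then c * X i w - s * X j w
                   else if k == j then s * X i w + c * X j w else X k w).
Proof.
move=> ij cs s0 [mX PX]; split=> [k|B mB].
  case: eqP => _; first by apply: measurable_funB; apply: measurable_funM => //; exact: mX.
  by case: eqP => _ //; apply: measurable_funD; apply: measurable_funM => //; exact: mX.
pose D := \bigcap_(k in [set k | (k != i) && (k != j)]) (X k @^-1` B k).
have mXB k A : measurable A -> measurable (X k @^-1` A).
  by move=> mA; rewrite -[X in measurable X]setTI; exact: mX.
have mD : measurable D by apply: fin_bigcap_measurable => [|k _]; [exact: finite_finset|exact: mXB].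
pose Z w : gT * gT := (X i w, X j w).
have mZ : measurable_fun setT Z by exact: measurable_fun_pair.
have [k0 k0E] : exists k : {nonneg R}, (\prod_(k | (k != i) && (k != j)) gam (B k) =
    (k%:num)%:E)%E.
  have pf : (\prod_(k | (k != i) && (k != j)) gam (B k) \is a fin_num)%E.
    apply: (big_ind (fun x : \bar R => x \is a fin_num)) => // [x y|k _].
      exact: fin_numM.
    exact: fin_num_measure.
  have p0 : 0 <= fine (\prod_(k | (k != i) && (k != j)) gam (B k))%E.
    by apply: fine_ge0; apply: prode_ge0.
  by exists (NngNum p0) => /=; rewrite fineK.
have nuE A A' : measurable A -> measurable A' ->
    pushforward (mrestr P mD) Z (A `*` A') = (k0%:num%:E * (gam A * gam A'))%E.
  move=> mA mA'; rewrite /pushforward /mrestr.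
  pose B' k := if k == i then A else if k == j then A' else B k.
  have -> : Z @^-1` (A `*` A') `&` D = \bigcap_(k in [set: I]) (X k @^-1` B' k).
    apply/seteqP; split => [w [[/= XA XA'] Dw] k _|w Xw].
      rewrite /B' /=; case: eqP => [->//|/eqP ki]; case: eqP => [->//|/eqP kj].
      by apply: Dw => /=; rewrite ki kj.
    split; first split => /=.
    - by have := Xw i Logic.I; rewrite /B' eqxx.
    - by have := Xw j Logic.I; rewrite /B' eqxx eq_sym (negbTE ij).
    - move=> k /= /andP[ki kj]; have := Xw k Logic.I.
      by rewrite /B' (negbTE ki) (negbTE kj).
  rewrite PX; last by move=> k; rewrite /B'; case: ifP => // _; case: ifP.
  rewrite (bigD1 i)//= (bigD1 j) 1?eq_sym//= muleA muleC -k0E.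
  congr (_ * (_ * _))%E; last 2 first.
  - by rewrite /B' eqxx.
  - by rewrite /B' eqxx eq_sym (negbTE ij).
  by apply: eq_bigr => k /andP[ki kj]; rewrite /B' (negbTE ki) (negbTE kj).
pose rot (z : gT * gT) : gT * gT := (c * z.1 - s * z.2, s * z.1 + c * z.2).
have mrot : measurable_fun setT rot.
  apply: measurable_fun_pair.
    by apply: measurable_funB; apply: measurable_funM.
  by apply: measurable_funD; apply: measurable_funM.
have mE : measurable (rot @^-1` (B i `*` B j)).
  by rewrite -[X in measurable X]setTI; apply: mrot => //; exact: measurableX.
transitivity (pushforward (mrestr P mD) Z (rot @^-1` (B i `*` B j))).
  rewrite /pushforward /mrestr; congr (P _); apply/seteqP; split => [w Xw|w].
    split; first split => /=.
    - by have := Xw i Logic.I; rewrite /= eqxx.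
    - by have := Xw j Logic.I; rewrite /= eqxx eq_sym (negbTE ij).
    - move=> k /= /andP[ki kj]; have := Xw k Logic.I.
      by rewrite /= (negbTE ki) (negbTE kj).
  move=> [[/= XA XA'] Dw] k _ /=; case: eqP => [->//|/eqP ki]; case: eqP => [->//|/eqP kj].
  by apply: Dw => /=; rewrite ki kj.
rewrite (scaled_product_measure_unique nuE)// normal_prob_rotation//; last exact: measurableX.
rewrite product_measure1E// -k0E [RHS](bigD1 i)//= [in RHS](bigD1 j) 1?eq_sym//=.
by rewrite [LHS]muleC -muleA.
Qed.

End GaussianFamily.

Section OrthogonalInvariance.
Context {R : realType} d (T : measurableType d) (P : probability T R).
Local Notation gT := (measurableTypeR R).

Definition mxact (J : finType) n (W : 'M[R]_n) (X : 'I_n * J -> T -> gT) :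
    'I_n * J -> T -> gT :=
  fun ij w => \sum_k W ij.1 k * X (k, ij.2) w.

Section Rows.
Context (J : finType) (n : nat).
Implicit Types (X : 'I_n * J -> T -> gT) (W : 'M[R]_n).

(** [A] selects the columns already rotated: a rotation of two rows is built one column at a time,
    each time from a rotation of two entries. *)
Definition rowrot (i j : 'I_n) (c s : R) (A : {pred J}) X : 'I_n * J -> T -> gT :=
  fun k w => if k.2 \in A then
      (if k.1 == i then c * X (i, k.2) w - s * X (j, k.2) w
       else if k.1 == j then s * X (i, k.2) w + c * X (j, k.2) w else X k w)
    else X k w.

Lemma gaussian_family_rowrot i j c s X :
  i != j -> c ^+ 2 + s ^+ 2 = 1 -> s != 0 -> gaussian_family P X ->
  gaussian_family P (rowrot i j c s predT X).
Proof.
move=> ij cs s0 gX.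
suff h (cs' : seq J) : uniq cs' -> gaussian_family P (rowrot i j c s (mem cs') X).
  have := h (enum J) (enum_uniq J); congr gaussian_family.
  by apply/funext => k; apply/funext => w; rewrite /rowrot mem_enum.
elim: cs' => [_|a t IH /= /andP[at' ut]].
  by have -> : rowrot i j c s (mem [::]) X = X by apply/funext => k; apply/funext.
have ija : (i, a) != (j, a) by rewrite xpair_eqE (negbTE ij).
have := gaussian_family_rotation ija cs s0 (IH ut); congr gaussian_family.
apply/funext => -[k b]; apply/funext => w; rewrite /rowrot/= !xpair_eqE inE.
have [->|ba] := eqVneq b a; last by rewrite !andbF.
by rewrite !andbT (negbTE at') /=; case: eqP => // _.
Qed.

Lemma gaussian_family_rowopp i X : gaussian_family P X ->
  gaussian_family P (fun k w => if k.1 == i then - X k w else X k w).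
Proof.
move=> gX.
suff h (cs' : seq J) : uniq cs' -> gaussian_family P
    (fun k w => if (k.1 == i) && (k.2 \in cs') then - X k w else X k w).
  have := h (enum J) (enum_uniq J); congr gaussian_family.
  by apply/funext => k; apply/funext => w; rewrite mem_enum andbT.
elim: cs' => [_|a t IH /= /andP[at' ut]].
  have -> : (fun k w => if (k.1 == i) && (k.2 \in [::]) then - X k w else X k w) = X.
    by apply/funext => k; apply/funext => w; rewrite andbF.
  by [].
have := gaussian_family_opp (i, a) (IH ut); congr gaussian_family.
apply/funext => -[k b]; apply/funext => w; rewrite /= xpair_eqE inE.
have [->|ba] := eqVneq b a; last by rewrite !andbF.
by rewrite !andbT (negbTE at') andbF/=; case: eqP.
Qed.

Definition mxrowrot (i j : 'I_n) (c s : R) W : 'M[R]_n :=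
  \matrix_(a, b) (if a == i then c * W i b - s * W j b
                  else if a == j then s * W i b + c * W j b else W a b).

Lemma mxrowrot_orthogonal i j c s W : i != j -> c ^+ 2 + s ^+ 2 = 1 ->
  W^T *m W = 1%:M -> (mxrowrot i j c s W)^T *m mxrowrot i j c s W = 1%:M.
Proof.
move=> ij cs <-; have ji : j != i by rewrite eq_sym.
apply/matrixP => a b; rewrite !mxE (bigD1 i)//= (bigD1 j)//=.
rewrite [RHS](bigD1 i)//= [in RHS](bigD1 j)//= !mxE !eqxx (negbTE ji) !addrA.
congr (_ + _); last first.
  apply: eq_bigr => t /andP[ti tj]; by rewrite !mxE (negbTE ti) (negbTE tj).
rewrite -[RHS]mulr1 -cs; ring.
Qed.

(** The rotation by the opposite angle undoes [mxrowrot], so invariance under [W] will follow from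
    invariance under a matrix with one more cleared entry. *)
Lemma mxact_rowrot i j c s W X : i != j -> c ^+ 2 + s ^+ 2 = 1 ->
  rowrot i j c (- s) predT (mxact (mxrowrot i j c s W) X) = mxact W X.
Proof.
move=> ij cs; have ji : j != i by rewrite eq_sym.
apply/funext => -[k a]; apply/funext => w; rewrite /rowrot/= /mxact/=.
have Ei : \sum_k mxrowrot i j c s W i k * X (k, a) w =
    c * (\sum_k W i k * X (k, a) w) - s * (\sum_k W j k * X (k, a) w).
  rewrite !mulr_sumr -sumrB; apply: eq_bigr => t _; rewrite !mxE eqxx; ring.
have Ej : \sum_k mxrowrot i j c s W j k * X (k, a) w =
    s * (\sum_k W i k * X (k, a) w) + c * (\sum_k W j k * X (k, a) w).
  rewrite !mulr_sumr -big_split; apply: eq_bigr => t _; rewrite !mxE eqxx (negbTE ji)/=; ring.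
case: eqP => [->|/eqP ki]; last case: eqP => [->|/eqP kj].
- by rewrite Ei Ej -[RHS]mul1r -cs; ring.
- by rewrite Ei Ej -[RHS]mul1r -cs; ring.
- by apply: eq_bigr => t _; rewrite !mxE (negbTE ki) (negbTE kj).
Qed.

(** Column [j] being a basis vector, its scalar product with column [i] is the entry [W j i]. *)
Lemma orthogonal_col_row W j : W^T *m W = 1%:M ->
  (forall i, W i j = (i == j)%:R) -> forall i, W j i = (i == j)%:R.
Proof.
move=> oW Wj i.
have := congr1 (fun M : 'M[R]_n => M j i) oW; rewrite !mxE (bigD1 j)//= !mxE Wj eqxx.
rewrite mul1r big1 ?addr0 => [->|k kj]; first by rewrite eq_sym.
by rewrite !mxE Wj (negbTE kj) mul0r.
Qed.

(* Givens elimination: column [k] is cleared by rotations in planes [(k, i)]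
   until [W] is the identity. *)
Lemma gaussian_family_orthogonal_step k W X :
  (forall W', W'^T *m W' = 1%:M ->
     (forall (a b : 'I_n), (b <= k)%N -> W' a b = (a == b)%:R) ->
     gaussian_family P (mxact W' X)) ->
  (k < n)%N ->
  W^T *m W = 1%:M -> (forall (a b : 'I_n), (b < k)%N -> W a b = (a == b)%:R) ->
  gaussian_family P (mxact W X).
Proof.
move=> IH kn; pose K := Ordinal kn.
(* Inner induction on the number of nonzero off-diagonal entries of column [K]. *)
have [t] := ubnP #|[pred i | (i != K) && (W i K != 0)]|.
elim: t W => // t IHt W; rewrite ltnS => Wt oW Wk.
have Wrow (a b : 'I_n) : (a < k)%N -> W a b = (a == b)%:R.
  by move=> ak; rewrite (orthogonal_col_row oW) ?[b == a]eq_sym// => i; exact: Wk.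
have [i /andP[iK WiK]|noW] := pickP [pred i | (i != K) && (W i K != 0)].
  have ki : (k < i)%N.
    rewrite ltn_neqAle; apply/andP; split; first by rewrite eq_sym; apply: iK.
    by rewrite leqNgt; apply/negP => ik; move: WiK; rewrite Wrow// (negbTE iK) eqxx.
  pose r := Num.sqrt (W K K ^+ 2 + W i K ^+ 2).
  have r2 : 0 < W K K ^+ 2 + W i K ^+ 2.
    by rewrite ltr_wpDl ?sqr_ge0// lt_neqAle sqr_ge0 andbT eq_sym sqrf_eq0.
  have r0 : r != 0 by rewrite gt_eqF// sqrtr_gt0.
  have rr : r ^+ 2 = W K K ^+ 2 + W i K ^+ 2 by rewrite sqr_sqrtr// ltW.
  (* Chosen so that the rotated entries of column [K] in rows [K] and [i] are [r] and [0]. *)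
  pose c := W K K / r; pose s := - W i K / r.
  have cs : c ^+ 2 + s ^+ 2 = 1.
    by rewrite /c /s !exprMn sqrrN -mulrDl -rr exprVn mulfV// sqrf_eq0.
  have s0 : s != 0 by rewrite mulf_neq0// ?oppr_eq0 ?invr_eq0.
  have Ki : K != i by rewrite eq_sym.
  rewrite -(mxact_rowrot W X Ki cs).
  apply: gaussian_family_rowrot => //; rewrite ?sqrrN ?oppr_eq0//.
  have W'K a : a != K -> a != i -> mxrowrot K i c s W a K = W a K.
    by move=> aK ai; rewrite mxE (negbTE aK) (negbTE ai).
  have W'i : mxrowrot K i c s W i K = 0.
    by rewrite mxE (negbTE iK) eqxx /c /s; ring.
  apply: IHt.
  - apply: leq_trans Wt; apply: proper_card; apply/properP; split.
      apply/fintype.subsetP => a; rewrite !inE => /andP[aK]; rewrite aK /=.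
      have [->|ai] := eqVneq a i; first by rewrite W'i eqxx.
      by rewrite W'K.
    exists i; first by rewrite inE iK WiK.
    by rewrite !inE W'i eqxx andbF.
  - exact: mxrowrot_orthogonal.
  - move=> a b bk; have bK : K != b by rewrite -val_eqE/= neq_ltn bk orbT.
    have bi : i != b by rewrite -val_eqE/= neq_ltn (ltn_trans bk ki) orbT.
    rewrite mxE !Wk// (negbTE bK) (negbTE bi) !mulr0 subr0 addr0.
    case: eqP => [->|_]; first by rewrite (negbTE bK).
    by case: eqP => [->|_] //; rewrite (negbTE bi).
have WK i : i != K -> W i K = 0.
  by move=> iK; have := noW i; rewrite /= iK => /negbT; rewrite negbK => /eqP.
have WKK : W K K ^+ 2 = 1.
  have := congr1 (fun M : 'M[R]_n => M K K) oW; rewrite !mxE (bigD1 K)//= !mxE eqxx.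
  by rewrite big1 ?addr0 -?expr2// => i iK; rewrite WK ?mulr0.
(* Orthogonality leaves [1] or [-1] on the diagonal; the second case is removed by flipping the sign
   of row [K]. *)
move/eqP: WKK; rewrite sqrf_eq1 => /orP[/eqP WKK|/eqP WKK].
  apply: IH => // a b; rewrite leq_eqVlt => /orP[/eqP bk|]; last exact: Wk.
  have -> : b = K by exact: val_inj.
  by case: eqVneq => [->//|aK]; exact: WK.
pose W' : 'M[R]_n := \matrix_(a, b) (if a == K then - W a b else W a b).
have -> : mxact W X = fun k w => if k.1 == K then - mxact W' X k w else mxact W' X k w.
  apply/funext => -[a b]; apply/funext => w; rewrite /mxact/=.
  case: eqP => [->|aK].
    by rewrite -sumrN; apply: eq_bigr => u _; rewrite mxE eqxx mulNr opprK.
  by apply: eq_bigr => u _; rewrite mxE; case: eqP.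
apply: gaussian_family_rowopp; apply: IH.
  rewrite -oW; apply/matrixP => a b; rewrite !mxE; apply: eq_bigr => u _; rewrite !mxE.
  by case: ifP => // _; rewrite mulrNN.
move=> a b; rewrite leq_eqVlt => /orP[/eqP bk|bk]; rewrite mxE.
  have -> : b = K by exact: val_inj.
  by case: eqVneq => [->|aK]; rewrite ?WKK ?opprK// WK.
rewrite !Wk//; case: (eqVneq a K) => // ->.
by rewrite -val_eqE/= gtn_eqF// oppr0.
Qed.

Lemma gaussian_family_orthogonal W X : W^T *m W = 1%:M ->
  gaussian_family P X -> gaussian_family P (mxact W X).
Proof.
move=> oW gX.
(* [k] counts the columns still to be cleared. *)
suff h k : forall W, (k <= n)%N -> W^T *m W = 1%:M ->
    (forall (a b : 'I_n), (b < n - k)%N -> W a b = (a == b)%:R) ->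
    gaussian_family P (mxact W X).
  by apply: (h n) => // a b; rewrite subnn.
elim: k => [|k IH] {oW}W kn oW Wk.
  have -> : mxact W X = X => //.
  apply/funext => -[a b]; apply/funext => w; rewrite /mxact/= (bigD1 a)//= Wk ?subn0//.
  rewrite eqxx mul1r big1 ?addr0// => u ua.
  by rewrite Wk ?subn0// eq_sym (negbTE ua) mul0r.
apply: (gaussian_family_orthogonal_step (k := (n - k.+1)%N)) => //; last by lia.
move=> W' oW' Wk'; apply: IH => //; first by lia.
by move=> a b bk; apply: Wk'; lia.
Qed.

End Rows.

End OrthogonalInvariance.

(** * Linear forms and decoupling of rows *)

Section Householder.
Context {R : realType}.

(** The reflection along [v = x - y] exchanges [x] and [y], because [<v, x> = |v|^2 / 2] when the
    norms agree. Fixing the vectors orthogonal to both is what keeps the trailing coordinates in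
    place in [adjugate_form]. *)
Lemma householder n (x y : 'cV[R]_n) : vnorm x = vnorm y ->
  exists H : 'M[R]_n, [/\ H^T = H, H^T *m H = 1%:M, H *m x = y &
    forall z : 'cV[R]_n, x^T *m z = 0 -> y^T *m z = 0 -> H *m z = z].
Proof.
move=> xy; pose v := x - y.
have [v0|v0] := eqVneq v 0.
  exists 1%:M; rewrite trmx1 !mul1mx; split => //; last by move=> z; rewrite mul1mx.
  by apply/eqP; rewrite -subr_eq0 -/v v0.
pose a := 2 / vnorm v ^+ 2.
have nv0 : vnorm v != 0 by rewrite vnorm_eq0.
have nv : vnorm v ^+ 2 != 0 by rewrite sqrf_eq0.
have vv : v^T *m v = (vnorm v ^+ 2)%:M.
  by rewrite vnorm_mul_tr -mx11_scalar.
exists (1%:M - a *: (v *m v^T)).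
have HT : (1%:M - a *: (v *m v^T))^T = 1%:M - a *: (v *m v^T).
  by rewrite linearB/= trmx1 linearZ/= trmx_mul trmxK.
split => //.
- rewrite HT mulmxBl mul1mx mulmxBr mulmx1 -scalemxAl -scalemxAr.
  rewrite mulmxA -(mulmxA v) vv mul_mx_scalar -scalemxAl !scalerA.
  have -> : a * (a * vnorm v ^+ 2) = a + a by rewrite /a; field.
  by rewrite scalerDl opprB addrK subrK.
- have vx : v^T *m x = (vnorm v ^+ 2 / 2)%:M.
    rewrite [LHS]mx11_scalar; congr (_%:M).
    have yx : (y^T *m x) 0 0 = (x^T *m y) 0 0.
      by rewrite -[y^T *m x]trmxK trmx_mul trmxK mxE.
    have := vnorm_mul_tr x; rewrite {1}xy vnorm_mul_tr => yyxx.
    rewrite vnorm_mul_tr /v linearB/= mulmxBr !mulmxBl.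
    rewrite [LHS]mxE [X in _ + X]mxE [in RHS]mxE [X in (X + _) / 2]mxE.
    rewrite [X in (_ + X + _) / 2]mxE [X in (_ + X) / 2]mxE [X in (_ - X) / 2]mxE.
    by rewrite [X in (_ - (_ + X)) / 2]mxE yx yyxx; field.
  rewrite mulmxBl mul1mx -scalemxAl -mulmxA vx scalar_mxC mul_scalar_mx scalerA.
  by rewrite /a mulrA divfK// divff// scale1r /v subKr.
- move=> z xz yz; rewrite mulmxBl mul1mx -scalemxAl -mulmxA.
  have -> : v^T *m z = 0 by rewrite /v linearB/= mulmxBl xz yz subrr.
  by rewrite mulmx0 scaler0 subr0.
Qed.

End Householder.

Section MeasurableMatrix.
Context {R : realType} d (T : measurableType d).

Lemma inv_measurable : measurable_fun setT (@GRing.inv R).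
Proof.
have -> : [set: R] = [set x | x != 0] `|` [set 0].
  apply/seteqP; split => x //= _; case: (eqVneq x 0); by [right|left].
apply/measurable_funU => //; first by apply: open_measurable; exact: open_neq.
split; last exact: measurable_fun_set1.
apply: open_continuous_measurable_fun; first exact: open_neq.
by move=> x /[!inE] x0; exact: inv_continuous.
Qed.

Lemma sqrt_measurable : measurable_fun setT (@Num.sqrt R).
Proof. by apply: continuous_measurable_fun; exact: sqrt_continuous. Qed.

Lemma measurable_bigprod I (s : seq I) (h : I -> T -> R) :
  (forall i, measurable_fun setT (h i)) ->
  measurable_fun setT (fun x => \prod_(i <- s) h i x).
Proof.
move=> mh; elim: s => [|a s IH].
  by under eq_fun do rewrite big_nil; exact: measurable_cst.
by under eq_fun do rewrite big_cons; exact: measurable_funM.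
Qed.

Definition measurable_mx p r (M : T -> 'M[R]_(p, r)) :=
  forall i j, measurable_fun setT (fun w => M w i j).

Lemma measurable_mx_mul p r t (M : T -> 'M[R]_(p, r)) (N : T -> 'M[R]_(r, t)) :
  measurable_mx M -> measurable_mx N -> measurable_mx (fun w => M w *m N w).
Proof.
move=> mM mN i j; under eq_fun do rewrite mxE.
by apply: measurable_sum => k; exact: measurable_funM.
Qed.

Lemma measurable_mx_rowrange p r off k (M : T -> 'M[R]_(p, r)) :
  measurable_mx M -> measurable_mx (fun w => rowrange off k (M w)).
Proof.
move=> mM i j; under eq_fun do rewrite mxE.
by case: insub => [t|]; [exact: mM|exact: measurable_cst].
Qed.

Lemma measurable_det p (M : T -> 'M[R]_p) :
  measurable_mx M -> measurable_fun setT (fun w => \det (M w)).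
Proof.
move=> mM; apply: measurable_sum => s; apply: measurable_funM => //.
by apply: measurable_bigprod => i; exact: mM.
Qed.

Lemma measurable_cofactor p (M : T -> 'M[R]_p) i j :
  measurable_mx M -> measurable_fun setT (fun w => cofactor (M w) i j).
Proof.
move=> mM; apply: measurable_funM => //; apply: measurable_det => a c.
by under eq_fun do rewrite !mxE; exact: mM.
Qed.

Lemma measurable_vnorm p (x : T -> 'cV[R]_p) :
  measurable_mx x -> measurable_fun setT (fun w => vnorm (x w)).
Proof.
move=> mx; apply: measurableT_comp; first exact: sqrt_measurable.
by apply: measurable_sum => i; apply: measurable_funX; exact: mx.
Qed.

End MeasurableMatrix.

Section LinearForm.
Context {R : realType} d (T : measurableType d) (P : probability T R).
Local Notation gT := (measurableTypeR R).
Local Notation gam := (normal_prob (0 : R) 1).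

(** A symmetric reflection sending the first basis vector to [u] has first row [u], so the form is
    one coordinate of a rotated family. *)
Lemma gaussian_linear_form b (Z : 'I_b -> T -> gT) (u : 'cV[R]_b) (A : set gT) :
  gaussian_family P Z -> vnorm u = 1 -> measurable A ->
  P ((fun w => \sum_j u j 0 * Z j w) @^-1` A) = gam A.
Proof.
case: b Z u => [|b] Z u gZ u1 mA.
  by move: u1; rewrite /vnorm big_ord0 sqrtr0 => /eqP; rewrite eq_sym oner_eq0.
have e1 : vnorm (delta_mx 0 0 : 'cV[R]_b.+1) = 1.
  rewrite /vnorm (bigD1 0)//= big1 ?addr0 ?mxE ?eqxx ?expr1n ?sqrtr1// => i i0.
  by rewrite mxE (negbTE i0) expr0n.
have [H [HT oH Hu _]] := householder (etrans e1 (esym u1)).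
have HE j : H 0 j = u j 0 by rewrite -HT -Hu -colE !mxE.
have gZ' : gaussian_family P (fun k : 'I_b.+1 * unit => Z k.1).
  apply: (gaussian_family_reindex (h := fun k : 'I_b.+1 * unit => k.1)) gZ.
  by move=> [i []] [j []]/= ->.
rewrite -(gaussian_family_marginal (0, tt) (gaussian_family_orthogonal oH gZ') mA).
congr (P (_ @^-1` A)); apply/funext => w; rewrite /mxact/=.
by apply: eq_bigr => j _; rewrite HE.
Qed.

(** Kept free of division by [|u|]: for [u = 0] the event is empty. *)
Lemma gaussian_small_ball b (Z : 'I_b -> T -> gT) (u : 'cV[R]_b) (s t : R) :
  gaussian_family P Z -> 0 < s -> 0 <= t ->
  (P [set w | s * `|\sum_j u j 0 * Z j w| < t * vnorm u]%R <= (t / s)%:E)%E.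
Proof.
move=> gZ s0 t0; have ts : 0 <= t / s by rewrite divr_ge0// ltW.
have [->|u0] := eqVneq u 0.
  rewrite [X in P X](_ : _ = set0) ?measure0 ?lee_fin//.
  apply/seteqP; split => // w /=.
  by rewrite vnorm0 mulr0 ltNge mulr_ge0// ltW.
have nu : 0 < vnorm u by rewrite vnorm_gt0.
pose u' := (vnorm u)^-1 *: u.
have u'1 : vnorm u' = 1 by rewrite vnormZ ger0_norm ?invr_ge0// mulVf ?gt_eqF.
have mball : measurable [set x : gT | `|x| < t / s].
  have -> : [set x : gT | `|x| < t / s] = `](- (t / s)), (t / s)[%classic.
    by apply/seteqP; split => x /=; rewrite in_itv/= ltr_norml.
  exact: measurable_itv.
rewrite [X in P X](_ : _ =
   (fun w => \sum_j u' j 0 * Z j w) @^-1` [set x : gT | `|x| < t / s]).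
  by rewrite (gaussian_linear_form gZ u'1 mball); exact: normal_prob_ball_le.
have uE w : \sum_j u' j 0 * Z j w = (vnorm u)^-1 * \sum_j u j 0 * Z j w.
  by rewrite mulr_sumr; apply: eq_bigr => j _; rewrite mxE mulrA.
have e x : ((vnorm u)^-1 * x < t / s) = (s * x < t * vnorm u).
  by rewrite [ltLHS]mulrC ltr_pdivrMr// mulrAC ltr_pdivlMr// mulrC.
by apply/seteqP; split => w /=; rewrite uE normrM ger0_norm ?invr_ge0// e.
Qed.

Lemma gaussian_form_second_moment b (Z : 'I_b -> T -> gT) (u : 'cV[R]_b) :
  gaussian_family P Z ->
  (\int[P]_w ((\sum_j u j 0 * Z j w) ^+ 2 / vnorm u ^+ 2)%:E <= 1)%E.
Proof.
move=> gZ; have [->|u0] := eqVneq u 0.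
  under eq_integral do rewrite vnorm0 expr0n invr0 mulr0.
  by rewrite integral0.
have nu : 0 < vnorm u by rewrite vnorm_gt0.
pose u' := (vnorm u)^-1 *: u.
have u'1 : vnorm u' = 1 by rewrite vnormZ ger0_norm ?invr_ge0// mulVf ?gt_eqF.
pose S w : gT := \sum_j u' j 0 * Z j w.
have mS : measurable_fun setT S.
  by apply: measurable_sum => j; apply: measurable_funM => //; exact: gZ.1.
apply: le_trans (@normal_second_moment_le R).
have msq : measurable_fun setT (fun x : gT => (x ^+ 2)%:E : \bar R).
  by apply/measurable_EFinP; exact: measurable_funX.
have -> : (\int[gam]_x (x ^+ 2)%:E = \int[pushforward P S]_x ((x : gT) ^+ 2)%:E)%E.
  apply: eq_measure_integral => A mA _.
  exact/esym/(gaussian_linear_form gZ u'1 mA).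
rewrite ge0_integral_pushforward//; last by move=> x _; rewrite lee_fin sqr_ge0.
rewrite le_eqVlt; apply/orP; left; apply/eqP/eq_integral => w _ /=.
congr EFin; rewrite /S.
have -> : \sum_j u' j 0 * Z j w = (vnorm u)^-1 * \sum_j u j 0 * Z j w.
  by rewrite mulr_sumr; apply: eq_bigr => j _; rewrite mxE mulrA.
by rewrite exprMn exprVn mulrC.
Qed.

End LinearForm.

Section Decoupling.
Context {R : realType} d (T : measurableType d) (P : probability T R).
Local Notation gT := (measurableTypeR R).
Local Notation gam := (normal_prob (0 : R) 1).
Context (n b : nat) (X : 'I_n * 'I_b -> T -> gT).
Hypothesis gX : gaussian_family P X.

Definition sample_mx w : 'M[R]_(n, b) := \matrix_(i, j) X (i, j) w.

(** Under [P \x P] the entries have the same joint law as those of [sample_mx], with row [i]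
    independent of the others by construction. This takes the place of conditioning. *)
Definition resample_row (i : 'I_n) (w w' : T) : 'M[R]_(n, b) :=
  \matrix_(a, j) X (a, j) (if a == i then w' else w).

Lemma measurable_sample_mx : measurable_mx sample_mx.
Proof. by move=> i j; under eq_fun do rewrite mxE; exact: gX.1. Qed.

Lemma measurable_resample_row i :
  measurable_mx (fun z : T * T => resample_row i z.1 z.2).
Proof.
move=> a j; under eq_fun do rewrite mxE.
by case: (a == i); apply: measurableT_comp => //; exact: gX.1.
Qed.

Let N := #|{: 'I_n * 'I_b}|.
Let S := N.-tuple gT.

Let rects : set (set S) := [set E | exists2 B : 'I_N -> set gT,
  (forall k, measurable (B k)) & E = \bigcap_(k in [set: 'I_N]) (@tnth _ _ ^~ k) @^-1` B k].

Let measurable_rects : @measurable _ S = <<s rects >>.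
Proof.
apply/seteqP; split.
  apply: smallest_sub; first exact: smallest_sigma_algebra.
  move=> E; rewrite -bigcup_seq => -[k _ [A mA <-]]; apply: sub_sigma_algebra.
  exists (fun k' => if k' == k then A else setT) => [k'|]; first by case: ifP.
  rewrite setTI; apply/seteqP; split => t /= tA.
    by move=> k' _ /=; case: eqP => // ->.
  by have := tA k Logic.I; rewrite /= eqxx.
apply: smallest_sub; first exact: sigma_algebra_measurable.
move=> _ [B mB ->]; apply: fin_bigcap_measurable => // k _.
by rewrite -[X in measurable X]setTI; exact: measurable_tnth.
Qed.

Let decode (t : S) : 'M[R]_(n, b) := \matrix_(i, j) tnth t (enum_rank (i, j)).

Let code w : S := [tuple X (enum_val k) w | k < N].

Let mixcode i (z : T * T) : S :=
  [tuple X (enum_val k) (if (enum_val k).1 == i then z.2 else z.1) | k < N].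

Let measurable_code : measurable_fun setT code.
Proof.
apply/measurable_fun_tnthP => k.
rewrite (_ : _ \o _ = X (enum_val k)); first exact: gX.1.
by apply/funext => w; rewrite /= tnth_mktuple.
Qed.

Let measurable_mixcode i : measurable_fun setT (mixcode i).
Proof.
apply/measurable_fun_tnthP => k.
rewrite (_ : _ \o _ = fun z =>
  X (enum_val k) (if (enum_val k).1 == i then z.2 else z.1)).
  by case: ((enum_val k).1 == i); apply: measurableT_comp => //; exact: gX.1.
by apply/funext => w; rewrite /= tnth_mktuple.
Qed.

Let measurable_decode : measurable_mx decode.
Proof.
by move=> i j; under eq_fun do rewrite mxE; exact: measurable_tnth.
Qed.

Let block_prob (Q : pred ('I_n * 'I_b)) (B : 'I_n * 'I_b -> set gT) :
  (forall k, measurable (B k)) ->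
  P (\bigcap_(k in [set k | Q k]) (X k @^-1` B k)) = (\prod_(k | Q k) gam (B k))%E.
Proof.
move=> mB; pose B' k := if Q k then B k else setT.
have -> : \bigcap_(k in [set k | Q k]) (X k @^-1` B k) =
    \bigcap_(k in setT) (X k @^-1` B' k).
  apply/seteqP; split => w Xw k /=; first by move=> _; rewrite /B'; case: ifP => // /Xw.
  by move=> Qk; have := Xw k Logic.I; rewrite /B' Qk.
rewrite gX.2; last by move=> k; rewrite /B'; case: ifP.
rewrite (bigID Q)/= [X in (_ * X)%E]big1 ?mule1.
  by apply: eq_bigr => k Qk; rewrite /B' Qk.
by move=> k /negbTE Qk; rewrite /B' Qk; exact: probability_setT.
Qed.

(* Both sides integrate against laws on a tuple space that agree on boxes. *)
Lemma decoupling (i : 'I_n) (f : 'M[R]_(n, b) -> \bar R) :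
  (forall M, 0 <= f M)%E ->
  (forall d' (T' : measurableType d') (M : T' -> 'M[R]_(n, b)),
     measurable_mx M -> measurable_fun setT (fun w => f (M w))) ->
  (\int[P]_w f (sample_mx w) = \int[P]_w \int[P]_w' f (resample_row i w w'))%E.
Proof.
move=> f0 mf.
have mfd : measurable_fun setT (fun t : S => f (decode t)) by exact: mf.
transitivity (\int[pushforward P code]_t f (decode t))%E.
  rewrite ge0_integral_pushforward//; apply: eq_integral => w _ /=; congr f.
  by apply/matrixP => a j; rewrite !mxE tnth_mktuple enum_rankK.
transitivity (\int[pushforward (P \x P)%E (mixcode i)]_t f (decode t))%E.
  apply: eq_measure_integral => A mA _.
  apply: (@measure_unique _ R S rects (fun=> setT) measurable_rects _ _ _
    (pushforward P code) (pushforward (P \x P)%E (mixcode i))) => //.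
  - move=> _ _ [B mB ->] [B' mB' ->]; exists (fun k => B k `&` B' k).
      by move=> k; exact: measurableI.
    by rewrite -bigcapI.
  - by move=> _; exists (fun=> setT) => //; rewrite bigcapT.
  - by rewrite bigcup_const//; exists 0%N.
  - move=> _ [B mB ->]; set RB := \bigcap_(k in _) _.
    suff : P (code @^-1` RB) = (P \x P)%E (mixcode i @^-1` RB) by [].
    pose B' k := B (enum_rank k); have mB' k : measurable (B' k) by exact: mB.
    have -> : code @^-1` RB =
        \bigcap_(k in setT) (X k @^-1` B' k).
      apply/seteqP; split => w /= Xw k _.
        by have := Xw (enum_rank k) Logic.I; rewrite /= tnth_mktuple enum_rankK.
      rewrite /= tnth_mktuple; have := Xw (enum_val k) Logic.I.
      by rewrite /B' /= enum_valK.
    pose Q : pred ('I_n * 'I_b) := fun k => k.1 != i.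
    (* A box constrains [w] through the rows other than [i] and [w'] through row [i], so its
       preimage is a rectangle. *)
    have -> : mixcode i @^-1` RB =
        (\bigcap_(k in [set k | Q k]) (X k @^-1` B' k)) `*`
        (\bigcap_(k in [set k | predC Q k]) (X k @^-1` B' k)).
      apply/seteqP; split => [[w w'] /= Xw|[w w'] [/= Xw Xw'] k _].
        split => k /= Qk; have := Xw (enum_rank k) Logic.I;
          rewrite /= tnth_mktuple enum_rankK.
          by rewrite (negbTE Qk).
        by move: Qk; rewrite /Q negbK => ->.
      rewrite /= tnth_mktuple; have [ki|ki] := boolP ((enum_val k).1 == i).
        by have := Xw' (enum_val k); rewrite /= /Q ki /B' enum_valK; apply.
      by have := Xw (enum_val k); rewrite /= /Q ki /B' enum_valK; apply.
    have mb Q' : measurable (\bigcap_(k in [set k | Q' k]) (X k @^-1` B' k)).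
      apply: fin_bigcap_measurable => [|k _]; first exact: finite_finset.
      by rewrite -[X in measurable X]setTI; exact: gX.1.
    rewrite product_measure1E//.
    rewrite gX.2// [LHS](bigID Q)/=; congr (_ * _)%E; first exact/esym/block_prob.
    exact: (esym (block_prob (predC Q) mB')).
  - move=> _; suff : (P (code @^-1` setT) < +oo)%E by [].
    by rewrite preimage_setT probability_setT ltry.
rewrite ge0_integral_pushforward// fubini_tonelli1.
- apply: eq_integral => w _; apply: eq_integral => w' _ /=; congr f.
  by apply/matrixP => a j; rewrite !mxE tnth_mktuple enum_rankK.
- by apply: measurableT_comp.
- by move=> z; exact: f0.
Qed.

Lemma decoupling_le (i : 'I_n) (f : 'M[R]_(n, b) -> \bar R) (h : T -> \bar R) :
  (forall M, 0 <= f M)%E ->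
  (forall d' (T' : measurableType d') (M : T' -> 'M[R]_(n, b)),
     measurable_mx M -> measurable_fun setT (fun w => f (M w))) ->
  measurable_fun setT h ->
  (forall w, \int[P]_w' f (resample_row i w w') <= h w)%E ->
  (\int[P]_w f (sample_mx w) <= \int[P]_w h w)%E.
Proof.
move=> f0 mf mh fh; rewrite (decoupling i f0 mf); apply: ge0_le_integral => //.
- by move=> w _; exact: integral_ge0.
- apply: (@measurable_fun_fubini_tonelli_F _ _ T T R P
    (fun z => f (resample_row i z.1 z.2))) => //.
  by apply: mf; exact: measurable_resample_row.
Qed.

End Decoupling.

(** * Random signs and small balls *)

Section RandomSigns.
Context {R : realType}.

(** The sign vectors as a list, over which sums play the role of expectations; splitting on the head
    gives the recursion of the moments. *)
Fixpoint sign_seqs (b : nat) : seq (seq R) :=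
  if b is b'.+1 then [seq 1 :: e | e <- sign_seqs b'] ++ [seq -1 :: e | e <- sign_seqs b']
  else [:: [::]].

Lemma big_sign_seqsS b (F : seq R -> R) :
  \sum_(e <- sign_seqs b.+1) F e =
  \sum_(e <- sign_seqs b) (F (1 :: e) + F (-1 :: e)).
Proof. by rewrite big_cat/= !big_map big_split. Qed.

Lemma size_sign_seqs b : size (sign_seqs b) = (2 ^ b)%N.
Proof.
elim: b => // b IH; rewrite /= size_cat !size_map IH expnS; lia.
Qed.

Lemma sum_sign_seqs1 b : \sum_(e <- sign_seqs b) 1 = (2 ^ b)%:R :> R.
Proof. by rewrite big_const_seq count_predT size_sign_seqs iter_addr_0. Qed.

Lemma sign_seqs_sqr b e j : e \in sign_seqs b -> (j < b)%N -> nth 0 e j ^+ 2 = 1.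
Proof.
elim: b e j => // b IH e [|j]; rewrite /= mem_cat => /orP[] /mapP[e' e'b ->] jb /=.
- by rewrite expr1n.
- by rewrite sqrrN expr1n.
- exact: IH.
- exact: IH.
Qed.

Definition sign_form (w : nat -> R) b (e : seq R) := \sum_(j < b) w j * nth 0 e j.

Lemma sign_formS w b a e :
  sign_form w b.+1 (a :: e) = w 0%N * a + sign_form (w \o succn) b e.
Proof. by rewrite /sign_form big_ord_recl. Qed.

Lemma sign_second_moment w b x :
  \sum_(e <- sign_seqs b) (x + sign_form w b e) ^+ 2 =
  (2 ^ b)%:R * (x ^+ 2 + \sum_(j < b) w j ^+ 2).
Proof.
elim: b w x => [|b IH] w x.
  by rewrite big_seq1 /sign_form !big_ord0 !addr0 expn0 mul1r.
rewrite big_sign_seqsS big_split/=.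
under eq_bigr do rewrite sign_formS addrA.
under [X in _ + X]eq_bigr do rewrite sign_formS addrA.
by rewrite !IH big_ord_recl/= expnS natrM; ring.
Qed.

(** The offset [x] makes the induction work: averaging over the first sign turns [x^4] into
    [x^4 + 6 x^2 y^2 + y^4], and the claim then holds with slack [2 y^4]. *)
Lemma sign_fourth_moment_le w b x :
  \sum_(e <- sign_seqs b) (x + sign_form w b e) ^+ 4 <=
  (2 ^ b)%:R * (x ^+ 4 + 6 * x ^+ 2 * (\sum_(j < b) w j ^+ 2)
     + 3 * (\sum_(j < b) w j ^+ 2) ^+ 2).
Proof.
elim: b w x => [|b IH] w x.
  by rewrite big_seq1 /sign_form !big_ord0 !addr0 expn0 mul1r mulr0 expr0n mulr0 !addr0.
rewrite big_sign_seqsS big_split/=.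
under eq_bigr do rewrite sign_formS addrA.
under [X in _ + X]eq_bigr do rewrite sign_formS addrA.
apply: le_trans (lerD (IH _ _) (IH _ _)) _.
rewrite big_ord_recl/= expnS natrM.
have -> : \sum_(i < b) w (lift ord0 i) ^+ 2 = \sum_(j < b) (w \o succn) j ^+ 2 by [].
move: (\sum_(j < b) _) (w 0%N) => S y; rewrite -mulrDr [2 * _]mulrC -[leRHS]mulrA.
apply: ler_wpM2l => //; have : 0 <= y ^+ 4 by rewrite exprn_even_ge0.
lra.
Qed.

(* Second-moment method: [1 - (y - 4)^2 (4/15)^2] minorizes the indicator of
   [1/4 <= y] on [0 <= y]. *)
Lemma sign_form_large (w : nat -> R) b : 0 < \sum_(j < b) w j ^+ 2 ->
  49 / 225 * (2 ^ b)%:R <= \sum_(e <- sign_seqs b)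
     ((\sum_(j < b) w j ^+ 2) / 4 <= sign_form w b e ^+ 2)%R%:R :> R.
Proof.
set S := \sum_(j < b) _ => S0.
pose y e := sign_form w b e ^+ 2 / S.
(* The means of [y] and [y^2] are [1] and at most [3], so the minorant averages at least
   [1 - 16 / 225 (3 - 8 + 16) = 49 / 225]. The factor [16 / 225] makes it vanish at [1 / 4]; the
   centre [4] is close to the optimal [11 / 3]. *)
apply: (@le_trans _ _ (\sum_(e <- sign_seqs b) (1 - 16 / 225 * (y e - 4) ^+ 2))).
  have m2 : \sum_(e <- sign_seqs b) y e = (2 ^ b)%:R.
    have := sign_second_moment w b 0; rewrite expr0n add0r -/S.
    under eq_bigr do rewrite add0r.
    by rewrite /y -mulr_suml => ->; rewrite mulfK// gt_eqF.
  have m4 : \sum_(e <- sign_seqs b) y e ^+ 2 <= 3 * (2 ^ b)%:R.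
    have := sign_fourth_moment_le w b 0; rewrite !expr0n/= mulr0 mul0r !add0r -/S.
    under eq_bigr do rewrite add0r.
    under [X in _ -> X <= _]eq_bigr do rewrite /y exprMn -exprM exprVn.
    rewrite -mulr_suml ler_pdivrMr ?exprn_gt0// => /le_trans; apply.
    by rewrite mulrA [_ * 3]mulrC.
  rewrite (eq_bigr (fun e => 1 - 16 / 225 * (y e ^+ 2) + 128 / 225 * y e - 256 / 225 * 1)).
    rewrite sumrB big_split/= sumrB -!mulr_sumr sum_sign_seqs1 m2; lra.
  by move=> e _; field.
apply: ler_sum => e _; have y0 : 0 <= y e by rewrite divr_ge0 ?sqr_ge0// ltW.
case: (leP (S / 4) _) => /= h; first by have := sqr_ge0 (y e - 4); lra.
have : y e < 1 / 4 by rewrite ltr_pdivrMr//; lra.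
nra.
Qed.

End RandomSigns.

Section Cofactors.
Context {R : realType}.

(** The generalized cross product of rows [1, ..., b] of [M]: pairing it with row [0] gives the
    determinant of the leading block. *)
Definition cofactor_vec n b (M : 'M[R]_(n, b.+1)) : 'cV[R]_b.+1 :=
  \col_j cofactor (rowrange 0 b.+1 M) 0 j.

(** The minors delete row [0] and stop at row [b]; hence resampling row [0] or a row past [b] leaves
    the cofactor vector unchanged. *)
Lemma cofactor_vec_ext n b (M M' : 'M[R]_(n, b.+1)) :
  (forall (a : 'I_n) j, (0 < a < b.+1)%N -> M a j = M' a j) ->
  cofactor_vec M = cofactor_vec M'.
Proof.
move=> MM'; apply/matrixP => j k; rewrite !mxE; congr (_ * \det _).
apply/matrixP => a c; rewrite !mxE; case: insubP => // t _ tE.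
apply: MM'; rewrite tE /= add0n; have := ltn_ord a; rewrite /bump leq0n /=; lia.
Qed.

Lemma det_cofactor_vec n b (M : 'M[R]_(n, b.+1)) (i0 : 'I_n) : (i0 : nat) = 0%N ->
  \det (rowrange 0 b.+1 M) = \sum_j cofactor_vec M j 0 * M i0 j.
Proof.
move=> i00; rewrite (expand_det_row _ 0); apply: eq_bigr => j _.
by rewrite (@rowrangeE _ _ _ _ _ _ _ i0) ?i00// mulrC mxE.
Qed.

End Cofactors.

Section SmallBall.
Context {R : realType} d (T : measurableType d) (P : probability T R).
Local Notation gT := (measurableTypeR R).
Context (n b : nat) (X : 'I_n * 'I_b.+1 -> T -> gT).
Hypothesis gX : gaussian_family P X.
Hypothesis bn : (b < n)%N.

Let n0 : (0 < n)%N. Proof. exact: leq_ltn_trans bn. Qed.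
Let i0 := Ordinal n0.

Let bt (M : 'M[R]_(n, b.+1)) := rowrange b.+1 (n - b.+1) M *m cofactor_vec M.

Let measurable_cofactor_vec d' (T' : measurableType d') (M : T' -> 'M[R]_(n, b.+1)) :
  measurable_mx M -> measurable_mx (fun w => cofactor_vec (M w)).
Proof.
move=> mM i j; under eq_fun do rewrite mxE.
by apply: measurable_cofactor; exact: measurable_mx_rowrange.
Qed.

Let measurable_bt d' (T' : measurableType d') (M : T' -> 'M[R]_(n, b.+1)) :
  measurable_mx M -> measurable_mx (fun w => bt (M w)).
Proof.
move=> mM; apply: measurable_mx_mul; first exact: measurable_mx_rowrange.
exact: measurable_cofactor_vec.
Qed.

Let gaussian_row (i : 'I_n) : gaussian_family P (fun j => X (i, j)).
Proof.
by apply: (gaussian_family_reindex (h := fun j => (i, j))) gX => j k [].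
Qed.

Let cofactor_resample (i : 'I_n) w w' : ~~ (0 < i < b.+1)%N ->
  cofactor_vec (resample_row X i w w') = cofactor_vec (sample_mx X w).
Proof.
move=> hi; apply: cofactor_vec_ext => a j ha; rewrite !mxE.
by case: eqP => // ai; rewrite -ai ha in hi.
Qed.

(** Given the other rows, [c] is constant and [<c, row i> / |c|] is standard normal, or [0] when
    [c = 0]. *)
Let row_second_moment (i : 'I_n) : (b < i)%N ->
  (\int[P]_w ((\sum_j cofactor_vec (sample_mx X w) j 0 * sample_mx X w i j) ^+ 2
      / vnorm (cofactor_vec (sample_mx X w)) ^+ 2)%:E <= 1)%E.
Proof.
move=> bi; pose f (M : 'M[R]_(n, b.+1)) : \bar R :=
  ((\sum_j cofactor_vec M j 0 * M i j) ^+ 2 / vnorm (cofactor_vec M) ^+ 2)%:E.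
apply: (@le_trans _ _ (\int[P]_w (cst 1%E w))%E); last first.
  by rewrite integral_cst// mul1e -(probability_setT P).
apply: (decoupling_le gX (i := i) (f := f)) => //.
- by move=> M; rewrite lee_fin divr_ge0 ?sqr_ge0.
- move=> d' T' M mM; apply/measurable_EFinP; apply: measurable_funM.
    apply: measurable_funX; apply: measurable_sum => j; apply: measurable_funM => //.
    exact: measurable_cofactor_vec.
  apply: measurableT_comp; first exact: inv_measurable.
  by apply: measurable_funX; apply: measurable_vnorm; exact: measurable_cofactor_vec.
- move=> w; apply: le_trans (gaussian_form_second_moment
    (cofactor_vec (sample_mx X w)) (gaussian_row i)).
  rewrite le_eqVlt; apply/orP; left; apply/eqP/eq_integral => w' _.
  rewrite /f cofactor_resample; last by lia.
  congr (_ ^+ 2 / _)%:E; apply: eq_bigr => j _; congr (_ * _).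
  by rewrite mxE eqxx.
Qed.

Let bt_sqr w : vnorm (bt (sample_mx X w)) ^+ 2 = \sum_(i : 'I_n | (b < i)%N)
  (\sum_j cofactor_vec (sample_mx X w) j 0 * sample_mx X w i j) ^+ 2.
Proof.
pose g (i : nat) : R := if @insub _ (fun x => x < n)%N _ i is Some t then
  (\sum_j cofactor_vec (sample_mx X w) j 0 * sample_mx X w t j) ^+ 2 else 0.
have gE (i : 'I_n) : g i = (\sum_j cofactor_vec (sample_mx X w) j 0 * sample_mx X w i j) ^+ 2.
  by rewrite /g valK.
under [RHS]eq_bigr do rewrite -gE.
rewrite big_mkcond/= [RHS](sum_rowrange_split (fun i => if (b < i)%N then g i else 0) bn).
rewrite big1 ?add0r => [|i _]; last by rewrite ltnNge -ltnS ltn_ord.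
rewrite vnorm_sqr; apply: eq_bigr => i _.
have hi : (b.+1 + i < n)%N by have := ltn_ord i; lia.
rewrite ifT; last by lia.
rewrite (gE (Ordinal hi)); congr (_ ^+ 2); rewrite mxE; apply: eq_bigr => j _.
by rewrite mulrC (@rowrangeE _ _ _ _ _ _ _ (Ordinal hi)).
Qed.

Let ratio w := vnorm (bt (sample_mx X w)) / vnorm (cofactor_vec (sample_mx X w)).

Let ratio_ge0 w : 0 <= ratio w. Proof. by rewrite divr_ge0. Qed.

Let measurable_ratio : measurable_fun setT ratio.
Proof.
have ms := measurable_sample_mx gX; apply: measurable_funM.
  by apply: measurable_vnorm; exact: measurable_bt.
apply: measurableT_comp; first exact: inv_measurable.
by apply: measurable_vnorm; exact: measurable_cofactor_vec.
Qed.

Let ratio_second_moment : (\int[P]_w (ratio w ^+ 2)%:E <= (n - b.+1)%:R%:E)%E.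
Proof.
have ms := measurable_sample_mx gX.
pose h (i : 'I_n) w : R := (\sum_j cofactor_vec (sample_mx X w) j 0 * sample_mx X w i j) ^+ 2
      / vnorm (cofactor_vec (sample_mx X w)) ^+ 2.
have mh i : measurable_fun setT (h i).
  apply: measurable_funM.
    apply: measurable_funX; apply: measurable_sum => j; apply: measurable_funM => //.
    exact: measurable_cofactor_vec.
  apply: measurableT_comp; first exact: inv_measurable.
  by apply: measurable_funX; apply: measurable_vnorm; exact: measurable_cofactor_vec.
have -> : (\int[P]_w (ratio w ^+ 2)%:E = \int[P]_w \sum_(i : 'I_n | (b < i)%N) (h i w)%:E)%E.
  apply: eq_integral => w _; rewrite sumEFin; congr EFin.
  by rewrite /ratio exprMn exprVn bt_sqr mulr_suml.
under eq_integral do rewrite -big_filter.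
rewrite ge0_integral_sum//; last 2 first.
- by move=> i; exact/measurable_EFinP.
- by move=> i w _; rewrite lee_fin divr_ge0 ?sqr_ge0.
rewrite big_filter; apply: (@le_trans _ _ (\sum_(i : 'I_n | (b < i)%N) 1)%E).
  by apply: lee_sum => i bi; exact: row_second_moment.
rewrite -[1%E]/(1%:E) sumEFin lee_fin.
rewrite big_mkcond/= (sum_rowrange_split (fun i => if (b < i)%N then 1 else 0) bn).
rewrite big1 ?add0r => [|i _]; last by rewrite ltnNge -ltnS ltn_ord.
rewrite (eq_bigr (fun=> 1)) => [|i _]; last by rewrite ifT//; lia.
by rewrite sumr_const card_ord.
Qed.

(** Multiplying by [|det|] avoids the inverse: the event makes sense for singular blocks, and its
    measurability is that of determinants and cofactors. *)
Let small_ball_set (s : R) : set T :=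
  [set w | s * `|\det (rowrange 0 b.+1 (sample_mx X w))| < vnorm (bt (sample_mx X w))].

Let measurable_event d' (T' : measurableType d') (s : R) (M : T' -> 'M[R]_(n, b.+1)) :
  measurable_mx M -> measurable_fun setT (fun w =>
    s * `|\det (rowrange 0 b.+1 (M w))| < vnorm (bt (M w))).
Proof.
move=> mM; apply: measurable_fun_ltr.
  apply: measurable_funM => //; apply: measurableT_comp => //.
  by apply: measurable_det; exact: measurable_mx_rowrange.
by apply: measurable_vnorm; exact: measurable_bt.
Qed.

Lemma measurable_small_ball_set s : measurable (small_ball_set s).
Proof.
rewrite -[X in measurable X]setTI.
exact: (measurable_event s (measurable_sample_mx gX) measurableT
  (Y := [set true])).
Qed.

(** Row [0] is resampled: [det = <c, row 0>] while [c] and [ratio] stay fixed, so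
    [gaussian_small_ball] applies with [t = ratio w]. *)
Let small_ball_ratio s : 0 < s ->
  (P (small_ball_set s) <= \int[P]_w (ratio w / s)%:E)%E.
Proof.
move=> s0; pose f (M : 'M[R]_(n, b.+1)) : \bar R :=
  (if s * `|\det (rowrange 0 b.+1 M)| < vnorm (bt M) then 1 else 0)%:E.
have -> : P (small_ball_set s) = (\int[P]_w f (sample_mx X w))%E.
  rewrite -[small_ball_set s]setIT -integral_indic//; last exact: measurable_small_ball_set.
  apply: eq_integral => w _; rewrite indicE /f; congr EFin.
  rewrite (_ : (w \in small_ball_set s) = (s * `|\det (rowrange 0 b.+1 (sample_mx X w))| <
    vnorm (bt (sample_mx X w)))); last by apply/idP/idP; rewrite inE.
  by case: ifP.
apply: (decoupling_le gX (i := i0)) => //.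
- by move=> M; rewrite lee_fin /f; case: ifP.
- move=> d' T' M mM; apply/measurable_EFinP; apply: measurable_fun_ifT => //.
  exact: measurable_event.
- by apply/measurable_EFinP; apply: measurable_funM.
move=> w; set c := cofactor_vec (sample_mx X w).
have btE : vnorm (bt (sample_mx X w)) = ratio w * vnorm c.
  rewrite /ratio -/c; have [c0|c0] := eqVneq c 0; last by rewrite divfK// vnorm_eq0.
  by rewrite /bt -/c c0 mulmx0 !vnorm0 mulr0.
have := gaussian_small_ball c (gaussian_row i0) s0 (ratio_ge0 w).
apply: le_trans; rewrite -[X in (_ <= P X)%E]setIT -integral_indic//; last first.
  rewrite -[X in measurable X]setTI.
  apply: (measurable_fun_ltr _ _ measurableT (Y := [set true])) => //.
  apply: measurable_funM => //; apply: measurableT_comp => //.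
  by apply: measurable_sum => j; apply: measurable_funM => //; exact: gX.1.
rewrite le_eqVlt; apply/orP; left; apply/eqP/eq_integral => w' _.
have ci : cofactor_vec (resample_row X i0 w w') = c by apply: cofactor_resample.
rewrite /f (det_cofactor_vec _ (i0 := i0))// indicE /bt ci.
have -> : rowrange b.+1 (n - b.+1) (resample_row X i0 w w') =
    rowrange b.+1 (n - b.+1) (sample_mx X w).
  by apply/matrixP => a j; rewrite !mxE; case: insubP => // t _ tE; rewrite !mxE ifF// -val_eqE/= tE.
have -> : \sum_j c j 0 * resample_row X i0 w w' i0 j = \sum_j c j 0 * X (i0, j) w'.
  by apply: eq_bigr => j _; congr (_ * _); rewrite mxE eqxx.
rewrite -/(bt _) btE.
set e := (X in if X then _ else _); rewrite (_ : (w' \in _) = e); first by case: e.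
by apply/idP/idP; rewrite inE.
Qed.

(** The mean of [ratio] is bounded through its second moment. The case [n = b + 1] is treated apart:
    the bottom block is empty and [a] would be zero. *)
Lemma small_ball_prob s : 0 < s ->
  (P (small_ball_set s) <= (Num.sqrt (n - b.+1)%:R / s)%:E)%E.
Proof.
move=> s0; have [nb|nb] := eqVneq (n - b.+1)%N 0%N.
  rewrite (_ : small_ball_set s = set0) ?measure0; first by rewrite lee_fin divr_ge0 ?sqrtr_ge0 ?ltW.
  apply/seteqP; split => // w; rewrite /small_ball_set/=.
  have -> : vnorm (bt (sample_mx X w)) = 0.
    by rewrite /vnorm big1 ?sqrtr0// => i _; move: (ltn_ord i); rewrite {2}nb.
  by rewrite ltNge mulr_ge0// ltW.
set a := Num.sqrt _; have a0 : 0 < a by rewrite sqrtr_gt0 ltr0n lt0n.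
have a2 : a ^+ 2 = (n - b.+1)%:R by rewrite sqr_sqrtr.
apply: le_trans (small_ball_ratio s0) _.
(* AM-GM: [ratio <= (ratio^2 / a + a) / 2] *)
apply: (@le_trans _ _ (\int[P]_w ((2 * s * a)^-1%:E * (ratio w ^+ 2)%:E + (a / (2 * s))%:E))%E).
  apply: ge0_le_integral => //.
  - by move=> w _; rewrite lee_fin divr_ge0// ltW.
  - by apply/measurable_EFinP; apply: measurable_funM.
  - apply: emeasurable_funD => //; apply: emeasurable_funM => //.
    by apply/measurable_EFinP; exact: measurable_funX.
  - move=> w _; rewrite -EFinM -EFinD lee_fin -subr_ge0.
    have -> : (2 * s * a)^-1 * ratio w ^+ 2 + a / (2 * s) - ratio w / s =
        (2 * s * a)^-1 * (ratio w - a) ^+ 2 by field; rewrite !gt_eqF.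
    by rewrite mulr_ge0 ?sqr_ge0// invr_ge0 !mulr_ge0// ltW.
have sa0 : 0 <= (2 * s * a)^-1 by rewrite invr_ge0 !mulr_ge0// ltW.
rewrite ge0_integralD//; last 3 first.
- by move=> w _; rewrite mule_ge0// lee_fin// sqr_ge0.
- apply: emeasurable_funM => //.
  by apply/measurable_EFinP; exact: measurable_funX.
- by move=> w _; rewrite lee_fin divr_ge0 ?mulr_ge0// ltW.
rewrite ge0_integralZl//; last 2 first.
- by apply/measurable_EFinP; exact: measurable_funX.
- by move=> w _; rewrite lee_fin sqr_ge0.
rewrite integral_cst// [X in (_ + _ * X)%E](probability_setT P) mule1.
apply: (@le_trans _ _ ((2 * s * a)^-1%:E * (n - b.+1)%:R%:E + (a / (2 * s))%:E)%E).
  by rewrite leeD2r// lee_wpmul2l.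
rewrite -EFinM -EFinD lee_fin -a2 le_eqVlt; apply/orP; left; apply/eqP.
by field; rewrite !gt_eqF.
Qed.

End SmallBall.

(** * Tail of the range constant *)

Section SignEvent.
Context {R : realType}.

(* If [O] maps [z] to [e] on top, a reflection [K] moving [e] to a multiple of the
   first basis vector makes [z] proportional to the first column of the adjugate. *)
Lemma adjugate_form n b (O : 'M[R]_(n, b.+1)) (e : seq R) (z : 'cV[R]_b.+1)
    (K : 'M[R]_n) (a s : R) (i0 : 'I_n) :
  let x : 'cV[R]_n := \col_i (if (i < b.+1)%N then nth 0 e i else 0) in
  let y : 'cV[R]_n := a *: delta_mx i0 0 in
  (b < n)%N -> (i0 : nat) = 0%N -> 0 < a -> K^T = K -> K^T *m K = 1%:M -> K *m x = y ->
  (forall r : 'cV[R]_n, x^T *m r = 0 -> y^T *m r = 0 -> K *m r = r) ->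
  rowrange 0 b.+1 O \in unitmx ->
  rowrange 0 b.+1 O *m z = \col_j nth 0 e j ->
  s < vnorm (rowrange b.+1 (n - b.+1) O *m z) ->
  s / a * `|\det (rowrange 0 b.+1 (K *m O))| <
    vnorm (rowrange b.+1 (n - b.+1) (K *m O) *m cofactor_vec (K *m O)).
Proof.
move=> x y bn i00 a0 KT oK Kx Kfix uO Oz sO.
(* A vector supported past the leading block is orthogonal to [x] and [y], hence fixed by [K]. *)
have Ktop (r : 'cV[R]_n) : (forall i : 'I_n, (i < b.+1)%N -> r i 0 = 0) -> K *m r = r.
  move=> r0; apply: Kfix; apply/matrixP => i j; rewrite !ord1 !mxE big1// => k _; rewrite !mxE.
    by case: ifP => [/r0 ->|_]; rewrite ?mulr0 ?mul0r.
  have [->|_] := eqVneq k i0; last by rewrite mulr0 mul0r.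
  by rewrite r0 ?mulr0// i00.
have vtop (M : 'M[R]_(n, b.+1)) (u : 'cV[R]_b.+1) (i : 'I_n) (hi : (i < b.+1)%N) :
    (M *m u) i 0 = (rowrange 0 b.+1 M *m u) (Ordinal hi) 0.
  by rewrite -rowrangeM (@rowrangeE _ _ _ _ _ _ _ i).
pose r := O *m z - x.
have r0 (i : 'I_n) : (i < b.+1)%N -> r i 0 = 0.
  by move=> ib; rewrite [LHS]mxE [X in _ + X]mxE [X in _ - X]mxE ib (vtop _ _ _ ib) Oz mxE subrr.
have KOz : K *m O *m z = y + r.
  have -> : K *m O *m z = K *m (x + r) by rewrite /r addrC subrK mulmxA.
  by rewrite mulmxDr Kx Ktop.
(* If the top of [t = K O u] vanishes, [K] fixes [t], so [O u = K t = t] has zero top as well and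
   [u = 0]. *)
have uO' : rowrange 0 b.+1 (K *m O) \in unitmx.
  apply: inj_unitmx => u Ku; pose t := K *m O *m u.
  have t0 (i : 'I_n) : (i < b.+1)%N -> t i 0 = 0.
    by move=> ib; rewrite /t (vtop _ _ _ ib) Ku mxE.
  have tE : t = O *m u.
    rewrite -(Ktop _ t0) /t -(mulmxA K) (mulmxA K K).
    by rewrite -{1}KT oK mul1mx.
  have : rowrange 0 b.+1 O *m u = 0.
    apply/matrixP => i j; rewrite ord1.
    have ib : (i < n)%N := leq_trans (ltn_ord i) bn.
    rewrite [RHS]mxE -[RHS](t0 (Ordinal ib) (ltn_ord i)) tE.
    by rewrite (vtop _ _ (Ordinal ib) (ltn_ord i)); congr (_ _ 0); exact: val_inj.
  by move/(congr1 (mulmx (invmx (rowrange 0 b.+1 O)))); rewrite mulmx0 mulKmx.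
have O2z : rowrange b.+1 (n - b.+1) (K *m O) *m z = rowrange b.+1 (n - b.+1) O *m z.
  rewrite -!rowrangeM KOz; apply/matrixP => i j; rewrite ord1.
  have hi : (b.+1 + i < n)%N by have := ltn_ord i; lia.
  rewrite !(@rowrangeE _ _ _ _ _ _ _ (Ordinal hi))//.
  have yi : y (Ordinal hi) 0 = 0 by rewrite !mxE -val_eqE/= i00 mulr0.
  have xi : x (Ordinal hi) 0 = 0 by rewrite mxE ifF//=; lia.
  have -> : (y + r) (Ordinal hi) 0 =
      y (Ordinal hi) 0 + ((O *m z) (Ordinal hi) 0 - x (Ordinal hi) 0) by rewrite !mxE.
  by rewrite yi xi add0r subr0.
have O1z : rowrange 0 b.+1 (K *m O) *m z = a *: delta_mx 0 0.
  rewrite -rowrangeM KOz; apply/matrixP => i j; rewrite ord1.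
  have hi : (i < n)%N := leq_trans (ltn_ord i) bn.
  rewrite (@rowrangeE _ _ _ _ _ _ _ (Ordinal hi))//.
  by rewrite [LHS]mxE r0//= addr0 !mxE -!val_eqE/= i00.
set M := rowrange 0 b.+1 (K *m O) in uO' O1z *.
(* Cramer's rule: [det M z = adj M (M z)], and [M z] is [a] times the first basis vector. *)
have cz : a *: cofactor_vec (K *m O) = \det M *: z.
  rewrite -[RHS]mul_scalar_mx -mul_adj_mx -mulmxA O1z -scalemxAr; congr (_ *: _).
  by apply/matrixP => i j; rewrite ord1 -colE !mxE.
have cE : cofactor_vec (K *m O) = (\det M / a) *: z.
  by rewrite mulrC -scalerA -cz scalerA mulVf ?gt_eqF// scale1r.
have d0 : 0 < `|\det M| by rewrite normr_gt0 -unitfE -unitmxE.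
rewrite cE -scalemxAr vnormZ O2z normrM (@ger0_norm _ a^-1) ?invr_ge0 ?ltW//.
have -> : s / a * `|\det M| = `|\det M| / a * s by ring.
by rewrite ltr_pM2l// divr_gt0.
Qed.

End SignEvent.

Section Tail.
Context {R : realType} d (T : measurableType d) (P : probability T R).
Local Notation gT := (measurableTypeR R).
Context (n b : nat) (X : 'I_n * 'I_b.+1 -> T -> gT) (V : 'M[R]_n).
Hypothesis gX : gaussian_family P X.
Hypothesis bn : (b < n)%N.
Hypothesis oV : V^T *m V = 1%:M.

Let O1 w := rowrange 0 b.+1 (V^T *m sample_mx X w).
Let O2 w := rowrange b.+1 (n - b.+1) (V^T *m sample_mx X w).
Let rt := Num.sqrt b.+1%:R * Num.sqrt (n - b.+1)%:R : R.

Let rt_ge0 : 0 <= rt. Proof. by rewrite mulr_ge0 ?sqrtr_ge0. Qed.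

(** [W = K V^T] is orthogonal, so the small-ball bound holds for the rotated family. The factor
    [sqrt b.+1] in [rt] is the length [a] of a sign vector. *)
Lemma sign_event (s : R) (e : seq R) : 0 < s -> exists E : set T,
  [/\ measurable E, (P E <= (rt / s)%:E)%E &
    e \in sign_seqs b.+1 -> forall w, O1 w \in unitmx ->
    s < vnorm (O2 w *m (invmx (O1 w) *m \col_j nth 0 e j)) -> E w].
Proof.
(* For lists that are not sign vectors the empty event is taken, so that [choice] applies to a total
   statement. *)
move=> s0; have [eb|_] := boolP (e \in sign_seqs b.+1); last first.
  by exists set0; split; rewrite // measure0 lee_fin divr_ge0// ltW.
have n0 : (0 < n)%N by exact: leq_ltn_trans bn.
pose i0 := Ordinal n0; pose a : R := Num.sqrt b.+1%:R.
have a0 : 0 < a by rewrite sqrtr_gt0.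
pose x : 'cV[R]_n := \col_i (if (i < b.+1)%N then nth 0 e i else 0).
pose y : 'cV[R]_n := a *: delta_mx i0 0.
have xy : vnorm x = vnorm y.
  rewrite vnormZ ger0_norm ?(ltW a0)// /vnorm /a.
  rewrite [in RHS](bigD1 i0)//= [in RHS]big1 ?addr0; last first.
    by move=> i ii0; rewrite mxE (negbTE ii0) expr0n.
  rewrite [in RHS]mxE !eqxx expr1n sqrtr1 mulr1; congr Num.sqrt.
  rewrite (eq_bigr (fun i : 'I_n => if (i < b.+1)%N then nth 0 e i ^+ 2 else 0)).
    rewrite (sum_rowrange_split (fun i => if (i < b.+1)%N then nth 0 e i ^+ 2 else 0) bn).
    rewrite [X in _ + X]big1 ?addr0; last by move=> i _; rewrite ifF//; lia.
    rewrite (eq_bigr (fun=> 1)) ?sumr_const ?card_ord// => i _.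
    by rewrite ltn_ord (sign_seqs_sqr eb).
  by move=> i _; rewrite mxE; case: ifP => // _; rewrite expr0n.
have [K [KT oK Kx Kfix]] := householder xy.
pose W := K *m V^T.
have oW : W^T *m W = 1%:M.
  rewrite trmx_mul trmxK mulmxA -(mulmxA V) oK mulmx1; exact: orthogonal_mul_tr.
have gY := gaussian_family_orthogonal oW gX.
have sY w : sample_mx (mxact W X) w = K *m (V^T *m sample_mx X w).
  rewrite mulmxA; apply/matrixP => i j; rewrite !mxE /mxact/=.
  by apply: eq_bigr => k _; rewrite [sample_mx _ _ _ _]mxE.
have sa0 : 0 < s / a by rewrite divr_gt0.
eexists; split; [exact: (measurable_small_ball_set gY (s / a))| |].
  apply: le_trans (small_ball_prob gY bn sa0) _.
  by rewrite lee_fin invf_div mulrA /rt [Num.sqrt b.+1%:R * _]mulrC.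
move=> _ w uO hs; rewrite /= sY.
have Oz : O1 w *m (invmx (O1 w) *m \col_j nth 0 e j) = \col_j nth 0 e j.
  by rewrite mulKVmx.
exact: (adjugate_form (i0 := i0) bn erefl a0 KT oK Kx Kfix uO Oz hs).
Qed.

(* A large norm is seen by a fixed proportion of the sign vectors; Markov's inequality
   for the number of sign events then gives the tail. *)
Lemma range_constant_prob (C : R) : 0 < C -> exists F : set T,
  [/\ measurable F,
     (forall w, F w -> O1 w \in unitmx -> specnorm (O2 w *m invmx (O1 w)) <= C) &
     ((1 - 450 / 49 * rt / C)%:E <= P F)%E].
Proof.
move=> C0; have C20 : 0 < C / 2 by rewrite divr_gt0.
have /choice[E hE] : forall e : seq R, exists E : set T,
  [/\ measurable E, (P E <= (rt / (C / 2))%:E)%E &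
    e \in sign_seqs b.+1 -> forall w, O1 w \in unitmx ->
    C / 2 < vnorm (O2 w *m (invmx (O1 w) *m \col_j nth 0 e j)) -> E w].
  by move=> e; exact: sign_event.
have mE e : measurable (E e) by case: (hE e).
pose N w : R := \sum_(e <- sign_seqs b.+1) \1_(E e) w.
(* The number of sign vectors guaranteed by [sign_form_large]. *)
pose kap : R := 49 / 225 * (2 ^ b.+1)%:R.
have kap0 : 0 < kap by rewrite mulr_gt0// ltr0n expn_gt0.
have mN : measurable_fun setT N by apply: measurable_sum => e; exact: measurable_indic.
have mlt : measurable [set w | N w < kap].
  rewrite -[X in measurable X]setTI.
  exact: (measurable_fun_ltr mN (measurable_cst kap) measurableT (Y := [set true])).
exists [set w | N w < kap]; split => //.
  move=> w /= Nw uO; rewrite leNgt; apply/negP => hC.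
  (* [v], the image of [y] under the transpose, is longer than [C], so at least [kap] sign vectors
     have [<v, e> ^+ 2 >= |v|^2 / 4]; for these, [|O2 O1^-1 e| > C / 2]. *)
  have [y y1 hy] := specnorm_gt_tr (ltW C0) hC.
  set v := (O2 w *m invmx (O1 w))^T *m y in hy.
  have v2 : \sum_(j < b.+1) vext v j ^+ 2 = vnorm v ^+ 2 by rewrite vnorm_vext.
  have : 0 < \sum_(j < b.+1) vext v j ^+ 2.
    by rewrite v2 exprn_gt0// (le_lt_trans (ltW C0)).
  move=> /sign_form_large; rewrite v2 -/kap; apply/negP; rewrite -ltNge.
  apply: le_lt_trans Nw; rewrite /N big_seq [leRHS]big_seq; apply: ler_sum => e eb.
  rewrite indicE; case: (leP (vnorm v ^+ 2 / 4) (sign_form (vext v) b.+1 e ^+ 2)) => h;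
    last by case: (w \in E e).
  rewrite mem_set//; have [_ _ /(_ eb)] := hE e; apply => //.
  set ev := \col_j _.
  have fE : sign_form (vext v) b.+1 e = (y^T *m (O2 w *m (invmx (O1 w) *m ev))) 0 0.
    have -> : y^T *m (O2 w *m (invmx (O1 w) *m ev)) = v^T *m ev.
      by rewrite /v trmx_mul trmxK !mulmxA.
    rewrite mxE /sign_form; apply: eq_bigr => j _.
    by rewrite vext_ord !mxE.
  set z := O2 w *m _ in fE *.
  have h2 : sign_form (vext v) b.+1 e ^+ 2 <= vnorm z ^+ 2.
    have := mulmx_tr_le_vnorm y z; rewrite -fE y1 mul1r => h1.
    have := mulmx_tr_le_vnorm (- y) z; rewrite -scaleN1r vnormZ normrN1 mul1r y1 mul1r.
    rewrite linearZ/= -scalemxAl mxE mulN1r -fE => h3.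
    have := vnorm_ge0 z; nra.
  have z0 := vnorm_ge0 z; nra.
have -> : [set w | N w < kap] = ~` [set w | kap <= N w].
  by apply/seteqP; split => w /=; rewrite ltNge => /negP.
have mle : measurable [set w | kap <= N w].
  rewrite (_ : [set w | kap <= N w] = ~` [set w | N w < kap]); first exact: measurableC.
  by apply/seteqP; split => w /=; rewrite leNgt => /negP.
rewrite probability_setC// EFinB leeB//.
(* Markov: the integral of [N] is the sum of the probabilities of the [2 ^ b.+1] sign events. *)
have : (kap%:E * P [set w | kap <= N w]%R <= ((2 ^ b.+1)%:R * (rt / (C / 2)))%:E)%E.
  apply: (@le_trans _ _ (\int[P]_w (N w)%:E)%E).
    rewrite -[[set w | kap <= N w]]setIT -integral_indic// -ge0_integralZl//; last 2 first.
    - by apply/measurable_EFinP; exact: measurable_indic.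
    - by rewrite lee_fin ltW.
    apply: ge0_le_integral => //.
    + by move=> w _; rewrite mule_ge0// lee_fin ltW.
    + by apply: emeasurable_funM => //; apply/measurable_EFinP; exact: measurable_indic.
    + exact/measurable_EFinP.
    + move=> w _; rewrite -EFinM lee_fin indicE; case: (boolP (w \in _)) => [/[!inE]/= ?|_].
        by rewrite mulr1.
      by rewrite mulr0 sumr_ge0.
  have -> : (\int[P]_w (N w)%:E = \int[P]_w \sum_(e <- sign_seqs b.+1) (\1_(E e) w)%:E)%E.
    by apply: eq_integral => w _; rewrite sumEFin.
  rewrite ge0_integral_sum//; last by move=> e; apply/measurable_EFinP; exact: measurable_indic.
  apply: (@le_trans _ _ (\sum_(e <- sign_seqs b.+1) (rt / (C / 2))%:E)%E).
    apply: lee_sum => e _; rewrite integral_indic// setIT; by case: (hE e).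
  rewrite sumEFin lee_fin (eq_bigr (fun=> 1 * (rt / (C / 2)))) => [|e _].
    by rewrite -mulr_suml sum_sign_seqs1.
  by rewrite mul1r.
have Pf : P [set w | kap <= N w] \is a fin_num by exact: fin_num_measure.
rewrite -(fineK Pf) -EFinM !lee_fin => h.
have p0 : 0 < (2 ^ b.+1)%:R :> R by rewrite ltr0n expn_gt0.
have -> : 450 / 49 * rt / C = (2 ^ b.+1)%:R * (rt / (C / 2)) / kap.
  by rewrite /kap; field; rewrite !gt_eqF.
by rewrite ler_pdivlMr// mulrC.
Qed.

End Tail.

Lemma gaussian_range_constant (R : realType) d (T : measurableType d)
    (P : probability T R) n b (X : 'I_n * 'I_b -> T -> measurableTypeR R)
    (V : 'M[R]_n) (C : R) :
  let O1 w := rowrange 0 b (V^T *m sample_mx X w) in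
  let O2 w := rowrange b (n - b) (V^T *m sample_mx X w) in
  gaussian_family P X -> (0 < b)%N -> (b <= n)%N -> V^T *m V = 1%:M -> 0 < C ->
  exists F : set T, [/\ measurable F,
     (forall w, F w -> O1 w \in unitmx -> specnorm (O2 w *m invmx (O1 w)) <= C) &
     ((1 - 450 / 49 * (Num.sqrt b%:R * Num.sqrt (n - b)%:R) / C)%:E <= P F)%E].
Proof. by case: b X => [//|b] X O1 O2 gX _ bn oV; exact: (range_constant_prob gX bn oV). Qed.

(** * Assembly of the four bounds *)

Lemma specnorm_rect_diag_ge (R : realType) p (s : nat -> R) :
  (forall j, (p < j)%N -> s j = 0) -> 0 <= s 1%N ->
  s 1%N <= specnorm (rect_diag s : 'M[R]_p).
Proof.
move=> sout s1; case: p sout => [|p] sout; first by rewrite sout// specnorm_ge0.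
have e1 : vnorm (delta_mx 0 0 : 'cV[R]_p.+1) = 1.
  rewrite /vnorm (bigD1 0)//= big1 ?addr0 ?mxE ?eqxx ?expr1n ?sqrtr1// => i i0.
  by rewrite mxE (negbTE i0) expr0n.
have := vnorm_mulmx_le_specnorm (rect_diag s : 'M[R]_p.+1) (delta_mx 0 0).
rewrite e1 mulr1; apply: le_trans; apply: ge0_ler_sqr => //.
rewrite vnorm_rect_diag// (bigD1 ord0)//= (vext_ord _ 0) mxE !eqxx mulr1.
by rewrite lerDl sumr_ge0// => i _; rewrite sqr_ge0.
Qed.

Lemma fnorm_rect_diag (R : realType) p (s : nat -> R) :
  fnorm (rect_diag s : 'M[R]_p) ^+ 2 = \sum_(i < p) s i.+1 ^+ 2.
Proof.
rewrite fnorm_sqr; apply: eq_bigr => i _; rewrite (bigD1 i)//= mxE eqxx big1 ?addr0//.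
by move=> j ji; rewrite mxE val_eqE eq_sym (negbTE ji) expr0n.
Qed.

Lemma power_mul_eq0 (R : realType) m n t (C : 'M[R]_(t, m)) (B : 'M[R]_(m, n)) q :
  C *m B = 0 -> C *m ((B *m B^T) ^+ q *m B) = 0.
Proof.
move=> CB; case: q => [|q]; first by rewrite expr0 mul1mx.
rewrite exprS -[C *m _]/(C *m (B *m B^T *m (B *m B^T) ^+ q *m B)).
by rewrite -!mulmxA (mulmxA C) CB mul0mx.
Qed.

Section Deflation.
Context {R : realType} (m n k b : nat).
Variables (A : 'M[R]_(m, n)) (Q : 'M[R]_(m, k)) (Ql : 'M[R]_(m, b)).
Hypothesis QQl : Q^T *m Ql = 0.

Let QlQ : Ql^T *m Q = 0.
Proof. by rewrite -[Q]trmxK -trmx_mul QQl trmx0. Qed.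

(** Orthogonality of [Q] and [Ql] makes the projector onto the joint complement a product of two
    projectors. *)
Lemma deflated_projector : (1%:M - row_mx Q Ql *m (row_mx Q Ql)^T) *m A =
  (1%:M - Ql *m Ql^T) *m ((1%:M - Q *m Q^T) *m A).
Proof.
rewrite mulmxA; congr (_ *m A).
rewrite tr_row_mx mul_row_col mulmxBl mul1mx mulmxBr mulmx1 mulmxA.
by rewrite -(mulmxA Ql) QlQ mulmx0 mul0mx subr0 opprD addrA.
Qed.

Lemma deflated_tr_mul : Ql^T *m A = Ql^T *m ((1%:M - Q *m Q^T) *m A).
Proof. by rewrite mulmxA mulmxBr mulmx1 mulmxA QlQ mul0mx subr0. Qed.

End Deflation.

(** From [1 + x <= expR x] at [x = 1 / 4]; it gives [4 e >= 625 / 64 > 450 / 49], the margin that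
    closes the probability estimate. *)
Lemma expR1_ge (R : realType) : (5 / 4) ^+ 4 <= expR 1 :> R.
Proof.
have -> : expR 1 = expR 4^-1 ^+ 4 :> R.
  by rewrite -expRM_natl; congr expR; field.
rewrite lerXn2r ?nnegrE ?expR_ge0//; last first.
  by have := expR_ge1Dx (4^-1 : R); lra.
Qed.

Theorem theorem3p6 (R : realType) (m n b q l : nat) (sb : bool)
  (A : 'M[R]_(m, n)) (U : 'M[R]_m) (sA : nat -> R) (V : 'M[R]_n)
  (Oms : nat -> 'M[R]_(n, b)) (Qs : nat -> 'M[R]_(m, b))
  (Ut : 'M[R]_m) (sB : nat -> R) (Vt : 'M[R]_n)
  (d : measure_display) (T : measurableType d) (P : probability T R)
  (G : 'I_n -> 'I_b -> T -> R) (delta : R) :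
  (n <= m)%N -> (0 < b)%N -> (b <= n)%N -> (2 <= l)%N ->
  is_svd U sA V A ->
  blarank_run sb A q Oms Qs l.-1 ->
  let Q := Qcat Qs l.-1 in
  let B := (1%:M - Q *m Q^T) *m A in
  is_svd Ut sB Vt B ->
  (forall i j, std_normal_rv P (G i j)) ->
  indep_family P (fun ij : 'I_n * 'I_b => G ij.1 ij.2) ->
  let k := (b * l.-1)%N in
  let eps := subspace_dist Q (colrange 0 k U) in
  let nA := specnorm A in
  eps < 1 -> sA (b * l)%N - sA (b * l).+1 > 2 * eps * nA ->
  let tau := sB b.+1 / sB b in
  let Sperp : 'M[R]_(n - b) := rect_diag (fun j => sB (b + j)%N) in
  let Cd := 2 * expR 1 * Num.sqrt b%:R * (2 / delta) *
            (Num.sqrt (n - b)%:R + Num.sqrt b%:R + Num.sqrt (2 * ln (2 / delta))) in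
  let Ot1 (Om : 'M[R]_(n, b)) : 'M[R]_b := rowrange 0 b (Vt^T *m Om) in
  let Ot2 (Om : 'M[R]_(n, b)) : 'M[R]_(n - b, b) := rowrange b (n - b) (Vt^T *m Om) in
  let Pl (Ql : 'M[R]_(m, b)) : 'M[R]_m :=
    1%:M - row_mx Q Ql *m (row_mx Q Ql)^T in
  (* (i) *)
  ((forall j, (1 <= j <= n - k)%N -> `|sB j - sA (k + j)%N| <= eps * nA) /\
   (forall j, (n - k < j <= n)%N -> sB j <= eps * nA)) /\
  (* (ii) *)
  (tau <= (sA (b * l).+1 + eps * nA) / (sA (b * l)%N - eps * nA) /\
   (sA (b * l).+1 + eps * nA) / (sA (b * l)%N - eps * nA) < 1) /\
  (* (iii), (iv): deterministic parts, for every realization of Omega_l *)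
  (forall Om : 'M[R]_(n, b), Ot1 Om \in unitmx ->
   forall Ql : 'M[R]_(m, b), is_orth ((B *m B^T) ^+ q *m B *m Om) Ql ->
   (forall xi : normkind,
      mnorm xi (Pl Ql *m A) <=
      Num.sqrt (1 + tau ^+ (4 * q) * specnorm (Ot2 Om *m invmx (Ot1 Om)) ^+ 2)
        * mnorm xi Sperp) /\
   (forall j, (1 <= j <= b)%N ->
    forall (U' : 'M[R]_b) (s' : nat -> R) (V' : 'M[R]_n),
      is_svd U' s' V' (Ql^T *m A) ->
      s' j <= sB j /\
      sB j / Num.sqrt (1 + specnorm (Ot2 Om) ^+ 2 * specnorm (invmx (Ot1 Om)) ^+ 2
                          * (sB b.+1 / sB j) ^+ (4 * q + 2)) <= s' j)) /\
  (* (iii): probabilistic part, for Omega_l standard Gaussian *)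
  (0 < delta < 1 ->
   with_prob_ge P
     [set w | let Om := \matrix_(i, j) G i j w in
        Ot1 Om \in unitmx ->
        forall Ql : 'M[R]_(m, b), is_orth ((B *m B^T) ^+ q *m B *m Om) Ql ->
        forall xi : normkind,
          mnorm xi (Pl Ql *m A) <=
          Num.sqrt (1 + tau ^+ (4 * q) * specnorm (Ot2 Om *m invmx (Ot1 Om)) ^+ 2)
            * mnorm xi Sperp /\
          Num.sqrt (1 + tau ^+ (4 * q) * specnorm (Ot2 Om *m invmx (Ot1 Om)) ^+ 2)
            * mnorm xi Sperp <=
          Num.sqrt (1 + tau ^+ (4 * q) * Cd ^+ 2) * mnorm xi Sperp]
     (1 - delta)).
Proof.
move=> nm b0 bn l2 svdA run Q B svdB nG iG k eps nA eps1 gap tau Sperp Cd Ot1 Ot2 Pl.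
have oQ : orthonormal_cols Q := blarank_orthonormal run.
have eps0 : 0 <= eps by exact: specnorm_ge0.
have nA0 : 0 <= nA by exact: specnorm_ge0.
have en0 : 0 <= eps * nA by rewrite mulr_ge0.
have bl : (b * l = k + b)%N by rewrite /k -mulnSr prednK//; exact: ltnW.
have sA0 j : (0 < j)%N -> 0 <= sA j by case: svdA => _ [+ _ _]; apply.
have sB0 j : (0 < j)%N -> 0 <= sB j by case: svdB => _ [+ _ _]; apply.
(* If [b * l] exceeded [n], [sA (b * l)] would vanish and the gap could not be positive. *)
have bln : (b * l <= n)%N.
  rewrite leqNgt; apply/negP => nbl; move: gap.
  have h := sA0 (b * l).+1 isT.
  by rewrite (svd_col_out svdA nbl); nra.
have km : (k <= m)%N by lia.
have lower j : (0 < j)%N -> sA (k + j)%N <= sB j.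
  by case: j => // j _; rewrite addnS; exact: (deflated_sv_ge svdA svdB).
have upper j : (0 < j)%N -> sB j <= sA (k + j)%N + eps * nA.
  by case: j => // j _; rewrite addnS; exact: (deflated_sv_le svdA oQ svdB _ km eps1).
have i1 : (forall j, (1 <= j <= n - k)%N -> `|sB j - sA (k + j)%N| <= eps * nA) /\
   (forall j, (n - k < j <= n)%N -> sB j <= eps * nA).
  split=> j /andP[j1 j2].
    have := lower j j1; have := upper j j1 => h1 h2.
    by rewrite ler_norml; apply/andP; split; lra.
  have j0 : (0 < j)%N by exact: leq_ltn_trans j1.
  (* Here [k + j] exceeds [n], so [sA (k + j)] is zero. *)
  have := upper j j0; rewrite (svd_col_out svdA) ?add0r//; lia.
(* The gap exceeds [2 * eps * nA] and [sA (b * l).+1] is nonnegative; this makes the denominator in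
   (ii) positive. *)
have sAb : eps * nA < sA (b * l)%N - eps * nA.
  by have := sA0 (b * l).+1 isT; lra.
have sBb : sA (b * l)%N - eps * nA <= sB b.
  by have := lower b b0; rewrite -bl; lra.
have sBb1 : sB b.+1 <= sA (b * l).+1 + eps * nA.
  by have := upper b.+1 isT; rewrite addnS -bl.
have sb0 : 0 < sB b by lra.
have den0 : 0 < sA (b * l)%N - eps * nA by lra.
have tau0 : 0 <= tau by rewrite divr_ge0 ?sB0.
have i2 : tau <= (sA (b * l).+1 + eps * nA) / (sA (b * l)%N - eps * nA) /\
   (sA (b * l).+1 + eps * nA) / (sA (b * l)%N - eps * nA) < 1.
  split; last by rewrite ltr_pdivrMr// mul1r; lra.
  rewrite /tau ler_pM ?invr_ge0 ?sB0 ?(ltW sb0)//.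
  by rewrite lef_pV2 ?posrE.
split => //; split => //.
have QB : Q^T *m B = 0 by rewrite mulmxA orthonormal_cols_tr_proj// mul0mx.
have orthQl (Om : 'M[R]_(n, b)) Ql : is_orth ((B *m B^T) ^+ q *m B *m Om) Ql -> Q^T *m Ql = 0.
  move=> oQl; apply: (is_orth_mul_eq0 oQl).
  by rewrite mulmxA power_mul_eq0// mul0mx.
have PlE (Om : 'M[R]_(n, b)) Ql : is_orth ((B *m B^T) ^+ q *m B *m Om) Ql ->
    Pl Ql *m A = (1%:M - Ql *m Ql^T) *m B.
  by move=> /orthQl; exact: deflated_projector.
have QlE (Om : 'M[R]_(n, b)) Ql : is_orth ((B *m B^T) ^+ q *m B *m Om) Ql -> Ql^T *m A = Ql^T *m B.
  by move=> /orthQl; exact: deflated_tr_mul.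
have iii Om : Ot1 Om \in unitmx ->
   forall Ql : 'M[R]_(m, b), is_orth ((B *m B^T) ^+ q *m B *m Om) Ql ->
   forall xi : normkind,
      mnorm xi (Pl Ql *m A) <=
      Num.sqrt (1 + tau ^+ (4 * q) * specnorm (Ot2 Om *m invmx (Ot1 Om)) ^+ 2)
        * mnorm xi Sperp.
  move=> uO Ql oQl [] /=.
    apply: specnorm_le => [|x]; first by rewrite mulr_ge0 ?sqrtr_ge0 ?specnorm_ge0.
    rewrite (PlE Om)// -mulmxA.
    apply: le_trans (residual_spec_le svdB bn b0 sb0 uO oQl x) _.
    rewrite ler_wpM2r// ler_wpM2l ?sqrtr_ge0//.
    have -> : sB b.+1 = sB (b + 1)%N by rewrite addn1.
    apply: (@specnorm_rect_diag_ge R (n - b) (fun j => sB (b + j)%N)).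
      move=> j hj; apply: (svd_col_out svdB).
      by rewrite -(subnKC bn) ltn_add2l.
    by apply: sB0; rewrite addn1.
  have c0 : 0 <= 1 + tau ^+ (4 * q) * specnorm (Ot2 Om *m invmx (Ot1 Om)) ^+ 2.
    by rewrite addr_ge0// mulr_ge0 ?sqr_ge0// exprn_ge0.
  apply: ge0_ler_sqr; first by rewrite mulr_ge0 ?sqrtr_ge0.
  rewrite exprMn /Sperp fnorm_rect_diag [Num.sqrt (1 + _) ^+ 2]sqr_sqrtr//.
  have := residual_frob_le svdB bn b0 sb0 uO oQl; rewrite -(PlE _ _ oQl).
  by under [X in _ -> _ <= _ * X]eq_bigr do rewrite addnS.
split=> [Om uO Ql oQl|/andP[d0 d1]].
  split; first exact: iii.
  move=> [//|j] /andP[_ jb] U' s' V'; rewrite (QlE Om)// => svd'; split.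
    (* [|Ql^T B x| <= |B x|], so the min-max bound for [B] serves for [Ql^T B]. *)
    apply: (svd_le_of_kernel svd' (C := rowrange 0 j Vt^T)) => //; first exact: sB0.
    move=> x Vx; rewrite -mulmxA.
    have oQl' : orthonormal_cols Ql by case: oQl.
    apply: le_trans (orthonormal_cols_tr_contraction _ oQl') _.
    by apply: (svd_upper svdB) => i ij; apply: rowrange_mul_eq0 Vx _.
  exact: (range_sv_ge svdB bn b0 sb0 uO oQl jb svd').
pose X (ij : 'I_n * 'I_b) : T -> measurableTypeR R := G ij.1 ij.2.
have gX : gaussian_family P X by apply: gaussian_familyP => // ij; exact: nG.
have oVt : Vt^T *m Vt = 1%:M by case: svdB => -[].
have lnd : 0 <= ln (2 / delta) by rewrite ln_ge0// ler_pdivlMr//; lra.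
pose Cd0 : R := 2 * expR 1 * Num.sqrt b%:R * (2 / delta).
have sqb : 0 < Num.sqrt b%:R :> R by rewrite sqrtr_gt0 ltr0n.
have Cd00 : 0 < Cd0 by rewrite /Cd0; do ?apply: mulr_gt0; rewrite ?expR_gt0 ?invr_gt0.
have Cd_gt0 : 0 < Cd.
  by rewrite mulr_gt0// -addrA ltr_wpDl ?sqrtr_ge0// ltr_pwDl ?sqrtr_ge0.
have CdE : Cd0 * Num.sqrt (n - b)%:R <= Cd.
  by rewrite ler_pM2l// -addrA lerDl addr_ge0 ?sqrtr_ge0.
have [F [mF FE PF]] : exists F : set T, [/\ measurable F,
     (forall w, F w -> Ot1 (sample_mx X w) \in unitmx ->
        specnorm (Ot2 (sample_mx X w) *m invmx (Ot1 (sample_mx X w))) <= Cd) &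
     ((1 - 450 / 49 * (Num.sqrt b%:R * Num.sqrt (n - b)%:R) / Cd)%:E <= P F)%E].
  exact: (gaussian_range_constant gX b0 bn oVt Cd_gt0).
exists F; split => //.
  move=> w Fw /= uO Ql oQl xi; split; first exact: iii.
  have -> : (\matrix_(i, j) G i j w) = sample_mx X w by [].
  rewrite ler_wpM2r//; first by case: xi => /=; [exact: specnorm_ge0|exact: fnorm_ge0].
  rewrite ler_sqrt ?lerD2l; last first.
    by rewrite addr_ge0// mulr_ge0 ?sqr_ge0// exprn_ge0.
  rewrite ler_wpM2l ?exprn_ge0// lerXn2r ?nnegrE ?specnorm_ge0 ?(ltW Cd_gt0)//.
  exact: FE.
(* By [CdE], [delta * Cd] is at least [4 e sqrt b sqrt (n - b)], so the failure probability is at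
   most [delta] once [450 / 49 <= 4 e]. *)
apply: le_trans PF; rewrite lee_fin lerD2l lerN2 ler_pdivrMr//.
apply: le_trans (ler_wpM2l (ltW d0) CdE).
have -> : delta * (Cd0 * Num.sqrt (n - b)%:R) =
    4 * expR 1 * (Num.sqrt b%:R * Num.sqrt (n - b)%:R).
  by rewrite /Cd0; field; rewrite gt_eqF.
rewrite ler_wpM2r ?mulr_ge0 ?sqrtr_ge0//.
by have := expR1_ge R; lra.
Qed.
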